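(* Let $1<p<\infty$ and $f\in L^{p/(p-1)}(\omega_2)$. For $\ell>0$ let $u_\ell\in W^{1,p}_0(\Omega_\ell)$ be the weak solution of $$-\mathrm{div}\left(H^{p-1}(\nabla u_\ell)\nabla H(\nabla u_\ell)\right)=f(X_2)\ \text{ in }\Omega_\ell,\qquad u_\ell\in W^{1,p}_0(\Omega_\ell),$$ and let $u_\infty\in W^{1,p}_0(\omega_2)$ be the weak solution of $$-\mathrm{div}\left(H^{p-1}(\nabla_2 u_\infty)\nabla_{Z_2} H(\nabla_2 u_\infty)\right)=f(X_2)\ \text{ in }\omega_2,\qquad u_\infty\in W^{1,p}_0(\omega_2),$$ extended to $\Omega_\ell$ as a function constant in the variables $X_1$. If $p\ge 2$, there is a constant $C_1>0$ independent of $\ell$ such that $$\|\nabla(u_\ell-u_\infty)\|^p_{L^p(\Omega_{\ell/2})}\le C_1\,\ell^{\,m-\frac{p}{p-1}}.$$ If $1<p<2$, there is a constant $C_2>0$ independent of $\ell$ such that $$\|\nabla(u_\ell-u_\infty)\|^p_{L^p(\Omega_{\ell/2})}\le C_2\,\ell^{\,m-\frac{p^2}{2-p}}.$$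
   Context: Let $1\le m<n$, let $\omega_1\subset\mathbb{R}^m$ be open, bounded and convex with $0\in\omega_1$, and let $\omega_2\subset\mathbb{R}^{n-m}$ be open and bounded. For $\ell>0$ set $\Omega_\ell=\ell\omega_1\times\omega_2\subset\mathbb{R}^n$. Points of $\mathbb{R}^n$ are written $x=(X_1,X_2)$ with $X_1\in\mathbb{R}^m$, $X_2\in\mathbb{R}^{n-m}$; likewise $z=(Z_1,Z_2)$, and $\nabla_{Z_2}H$ denotes the gradient of $H$ with respect to its last $n-m$ variables. $\nabla_2:=(0,\dots,0,\partial_{x_{m+1}},\dots,\partial_{x_n})\in\mathbb{R}^n$. $H:\mathbb{R}^n\to[0,+\infty)$ satisfies: $H(x)>0$ for $x\neq0$; $H$ is convex; $H(tx)=|t|H(x)$ for all $t\in\mathbb{R}$, $x\in\mathbb{R}^n$; $H\in C^1(\mathbb{R}^n\setminus\{0\})$. The field $H^{p-1}(z)\nabla H(z)$ is understood to be $0$ at $z=0$. Moreover, there are constants $c_1,c_2,c_3>0$ such that for all $z_1,z_2\in\mathbb{R}^n$: (i) if $p\ge2$, $\langle H^{p-1}(z_1)\nabla H(z_1)-H^{p-1}(z_2)\nabla H(z_2),\,z_1-z_2\rangle\ge c_1|z_1-z_2|^p$; (ii) if $1<p<2$, $\langle H^{p-1}(z_1)\nabla H(z_1)-H^{p-1}(z_2)\nabla H(z_2),\,z_1-z_2\rangle\ge c_2|z_1-z_2|^2(|z_1|+|z_2|)^{p-2}$; (iii) if $1<p<2$, $|H^{p-1}(z_1)\nabla H(z_1)-H^{p-1}(z_2)\nabla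 H(z_2)|\le c_3|z_1-z_2|(|z_1|+|z_2|)^{p-2}$ (in (ii) and (iii) the right-hand side is read as $0$ when $z_1=z_2=0$). Weak solution: $u\in W^{1,p}_0(\Omega_\ell)$ is a weak solution of the first problem if $\int_{\Omega_\ell}H^{p-1}(\nabla u)\langle\nabla H(\nabla u),\nabla\phi\rangle\,dx=\int_{\Omega_\ell}f(X_2)\phi\,dx$ for all $\phi\in W^{1,p}_0(\Omega_\ell)$; and $w\in W^{1,p}_0(\omega_2)$ is a weak solution of the second if $\int_{\omega_2}H^{p-1}(0,\nabla_{X_2}w)\langle\nabla_{Z_2}H(0,\nabla_{X_2}w),\nabla_{X_2}\phi\rangle\,dX_2=\int_{\omega_2}f\phi\,dX_2$ for all $\phi\in W^{1,p}_0(\omega_2)$. *)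

(* Defs.v *)
From HB Require Import structures.
From mathcomp Require Import all_boot all_order all_algebra.
From mathcomp Require Import all_classical all_reals all_analysis.

Set Implicit Arguments.
Unset Strict Implicit.
Unset Printing Implicit Defensive.

Import Order.TTheory GRing.Theory Num.Theory.
Import numFieldNormedType.Exports.

Local Open Scope classical_set_scope.
Local Open Scope ring_scope.

(* The sigma-algebra on R^n generated by the coordinate functions; it is the
   Borel sigma-algebra of the topology of 'rV[R]_n. *)
Definition rV_display : measure_display. Proof. exact. Qed.

Section rV_measurable.
Context {R : realType} {n : nat}.

Definition rV_coord (i : 'I_n) (x : 'rV[R]_n) : measurableTypeR R := x ord0 i.

Let rV_set0 : g_sigma_preimage rV_coord set0.
Proof. exact: sigma_algebra0. Qed.

Let rV_setC A : g_sigma_preimage rV_coord A -> g_sigma_preimage rV_coord (~` A).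
Proof. exact: sigma_algebraC. Qed.

Let rV_bigcup (F : _^nat) : (forall i, g_sigma_preimage rV_coord (F i)) ->
  g_sigma_preimage rV_coord (\bigcup_i (F i)).
Proof. exact: sigma_algebra_bigcup. Qed.

HB.instance Definition _ := @isMeasurable.Build rV_display
  'rV[R]_n (g_sigma_preimage rV_coord) rV_set0 rV_setC rV_bigcup.

Lemma measurable_rV_coord i : measurable_fun [set: 'rV[R]_n] (rV_coord i).
Proof.
move=> _ Y mY; rewrite setTI; apply: sub_sigma_algebra => /=.
rewrite -bigcup_seq/=; exists i => /=; first by rewrite mem_index_enum.
by exists Y => //; rewrite setTI.
Qed.

Lemma measurable_fun_rV d (T : measurableType d) (f : T -> 'rV[R]_n) :
  (forall i, measurable_fun [set: T] (rV_coord i \o f)) ->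
  measurable_fun [set: T] f.
Proof.
move=> mf; have prefS : g_sigma_preimage (fun i => rV_coord i \o f)
    `<=` measurable.
  apply: smallest_sub; first exact: sigma_algebra_measurable.
  rewrite -bigcup_seq => A [i _ [B mB <-]]; exact: mf.
move=> _ A mA; apply: prefS; rewrite g_sigma_preimage_comp.
by exists A.
Qed.

End rV_measurable.

Section lebesgue_rV.
Context {R : realType}.

Definition row_cons n (z : measurableTypeR R * 'rV[R]_n) : 'rV[R]_n.+1 :=
  \row_i oapp (z.2 ord0) z.1 (unlift ord0 i).

Definition row_uncons n (x : 'rV[R]_n.+1) : measurableTypeR R * 'rV[R]_n :=
  (x ord0 ord0, \row_i x ord0 (lift ord0 i)).

Lemma row_consK n : cancel (@row_cons n) (@row_uncons n).
Proof.
move=> [a v]; rewrite /row_uncons /row_cons mxE unlift_none; congr pair.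
by apply/rowP => i; rewrite !mxE liftK.
Qed.

Lemma measurable_row_cons n : measurable_fun setT (@row_cons n).
Proof.
apply: measurable_fun_rV => i.
have [j ->|->] := unliftP ord0 i.
  rewrite (_ : _ \o _ = rV_coord j \o snd).
    by apply: measurableT_comp => //; exact: measurable_rV_coord.
  by apply/funext => -[a v] /=; rewrite /rV_coord mxE liftK.
rewrite (_ : _ \o _ = fst)//; apply/funext => -[a v] /=.
by rewrite /rV_coord mxE unlift_none.
Qed.

Lemma measurable_row_uncons n : measurable_fun setT (@row_uncons n).
Proof.
apply: measurable_fun_pair; first exact: (measurable_rV_coord ord0).
apply: measurable_fun_rV => i.
rewrite (_ : _ \o _ = rV_coord (lift ord0 i)); first exact: measurable_rV_coord.
by apply/funext => x; rewrite /rV_coord /= mxE.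
Qed.

Section lebesgue_succ.
Variables (n : nat) (mu : {sigma_finite_measure set 'rV[R]_n -> \bar R}).
Local Open Scope ereal_scope.

Definition lebesgue_succ : set 'rV[R]_n.+1 -> \bar R :=
  pushforward (lebesgue_measure \x mu) (@row_cons n).

Let nu : {measure set 'rV[R]_n.+1 -> \bar R} :=
  measure_function_pushforward__canonical__measure_function_Measure
    (lebesgue_measure \x mu) (@measurable_row_cons n).

Let succ0 : lebesgue_succ set0 = 0. Proof. exact: (measure0 nu). Qed.

Let succ_ge0 A : 0 <= lebesgue_succ A. Proof. exact: (measure_ge0 nu). Qed.

Let succ_sigma_additive : semi_sigma_additive lebesgue_succ.
Proof. exact: (@measure_semi_sigma_additive _ _ _ nu). Qed.

HB.instance Definition _ := isMeasure.Build _ _ _ lebesgue_succ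
  succ0 succ_ge0 succ_sigma_additive.

Let succ_sigma_finite : sigma_finite setT lebesgue_succ.
Proof.
have /sigma_finiteP[F [TF ndF Foo]] :=
  sigma_finiteT (@lebesgue_measure R : {sigma_finite_measure set _ -> \bar R}).
have /sigma_finiteP[G [TG ndG Goo]] := sigma_finiteT mu.
exists (fun k => @row_uncons n @^-1` (F k `*` G k)).
  apply/esym; rewrite -subTset => x _.
  have [i _ Fi] : (\bigcup_i F i) (@row_uncons n x).1 by rewrite -TF.
  have [j _ Gj] : (\bigcup_i G i) (@row_uncons n x).2 by rewrite -TG.
  exists (maxn i j) => //; split.
    by move: Fi; exact/subsetPset/ndF/leq_maxl.
  by move: Gj; exact/subsetPset/ndG/leq_maxr.
move=> k; have [mF Fk] := Foo k; have [mG Gk] := Goo k; split.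
  rewrite -[X in measurable X]setTI; apply: measurable_row_uncons => //.
  exact: measurableX.
rewrite /lebesgue_succ /pushforward (_ : _ @^-1` _ = F k `*` G k).
  by rewrite product_measure1E// lte_mul_pinfty// ge0_fin_numE.
by rewrite -comp_preimage (_ : _ \o _ = id)//; exact/funext/row_consK.
Qed.

HB.instance Definition _ := Measure_isSigmaFinite.Build _ _ _ lebesgue_succ
  succ_sigma_finite.

End lebesgue_succ.

(* Lebesgue measure on R^n, as the n-fold product of the one-dimensional one. *)
Fixpoint lebesgue_rV n : {sigma_finite_measure set 'rV[R]_n -> \bar R} :=
  match n with
  | 0 => \d_(0 : 'rV[R]_0)
  | n'.+1 => lebesgue_succ (lebesgue_rV n')
  end.

End lebesgue_rV.
Arguments lebesgue_rV : clear implicits.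

Section calculus.
Context {R : realType} {n : nat}.
Implicit Types (f : 'rV[R]_n -> R) (x y : 'rV[R]_n).

Definition dot x y : R := \sum_(i < n) x ord0 i * y ord0 i.

(* The norm `|x| of 'rV[R]_n is the sup norm; |x| in the estimates is this
   Euclidean norm. *)
Definition enorm x : R := Num.sqrt (dot x x).

Definition partial (i : 'I_n) f x : R := 'D_(delta_mx ord0 i) f x.

Definition grad f x : 'rV[R]_n := \row_i partial i f x.

Fixpoint Ck (k : nat) f : Prop :=
  match k with
  | 0 => continuous f
  | k'.+1 => (forall x, differentiable f x) /\ forall i, Ck k' (partial i f)
  end.

Definition tsupport f : set 'rV[R]_n := closure [set x | f x != 0].

Definition test_function (Omega : set 'rV[R]_n) f : Prop :=
  [/\ forall k, Ck k f, compact (tsupport f) & tsupport f `<=` Omega].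

End calculus.

Section sobolev.
Context {R : realType} {n : nat}.
Implicit Types (Omega : set 'rV[R]_n) (p : R) (u : 'rV[R]_n -> R)
  (Du : 'rV[R]_n -> 'rV[R]_n).

Definition Lp_norm Omega p u : \bar R :=
  'N[lebesgue_rV R n]_(p%:E)[EFin \o (u \_ Omega)]%E.

Definition in_Lp Omega p u : Prop :=
  measurable_fun Omega (u : _ -> measurableTypeR R) /\
  (Lp_norm Omega p u < +oo)%E.

(* Elements of L^p and W^{1,p} are represented by Borel functions on R^n, of
   which only the values on Omega matter. A weak gradient being unique only
   almost everywhere, a Sobolev function u comes with a chosen version Du of
   its weak gradient. *)
Definition weak_gradient Omega u Du : Prop :=
  forall phi, test_function Omega phi -> forall i,
    \int[lebesgue_rV R n]_(x in Omega) (u x * partial i phi x) =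
    - \int[lebesgue_rV R n]_(x in Omega) (Du x ord0 i * phi x).

Definition W1p Omega p u Du : Prop :=
  [/\ in_Lp Omega p u,
      forall i, in_Lp Omega p (fun x => Du x ord0 i)
    & weak_gradient Omega u Du].

Definition W1p_norm Omega p u Du : \bar R :=
  (Lp_norm Omega p u + Lp_norm Omega p (fun x => enorm (Du x)))%E.

(* W_0^{1,p}(Omega) is the closure of C_c^\infty(Omega) in W^{1,p}(Omega). *)
Definition W1p0 Omega p u Du : Prop :=
  W1p Omega p u Du /\
  forall e : R, 0 < e -> exists2 phi, test_function Omega phi &
    (W1p_norm Omega p (fun x => u x - phi x)%R
       (fun x => Du x - grad phi x)%R < e%:E)%E.

End sobolev.

Section problem.
Context {R : realType} {m k : nat}.
Implicit Types (p : R) (H : 'rV[R]_(m + k) -> R) (f : 'rV[R]_k -> R).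

(* R^n is 'rV[R]_(m + k), with k = n - m: the blocks X_1 and X_2 of x are
   lsubmx x and rsubmx x. *)
Definition cylinder (omega1 : set 'rV[R]_m) (omega2 : set 'rV[R]_k) (l : R) :
    set 'rV[R]_(m + k) :=
  [set x | [set l *: y | y in omega1] (lsubmx x) /\ omega2 (rsubmx x)].

(* H^{p-1}(z) \nabla H(z). It vanishes at z = 0 whenever H 0 = 0 and 1 < p,
   since then H 0 `^ (p - 1) = 0. *)
Definition flux p H (z : 'rV[R]_(m + k)) : 'rV[R]_(m + k) :=
  H z `^ (p - 1) *: grad H z.

(* Here x `^ (p - 2) with p < 2 is 0 at x = 0, so that both right-hand sides
   are 0 for z1 = z2 = 0. *)
Definition structure_conditions p H (c1 c2 c3 : R) : Prop :=
  forall z1 z2 : 'rV[R]_(m + k),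
  [/\ 2 <= p ->
        c1 * enorm (z1 - z2) `^ p <= dot (flux p H z1 - flux p H z2) (z1 - z2),
      p < 2 ->
        c2 * enorm (z1 - z2) ^+ 2 * (enorm z1 + enorm z2) `^ (p - 2)
          <= dot (flux p H z1 - flux p H z2) (z1 - z2)
    & p < 2 ->
        enorm (flux p H z1 - flux p H z2)
          <= c3 * enorm (z1 - z2) * (enorm z1 + enorm z2) `^ (p - 2)].

Definition weak_solution p H f (Omega : set 'rV[R]_(m + k))
    (u : 'rV[R]_(m + k) -> R) (Du : 'rV[R]_(m + k) -> 'rV[R]_(m + k)) : Prop :=
  W1p0 Omega p u Du /\
  forall phi Dphi, W1p0 Omega p phi Dphi ->
    \int[lebesgue_rV R (m + k)]_(x in Omega)
      (H (Du x) `^ (p - 1) * dot (grad H (Du x)) (Dphi x)) =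
    \int[lebesgue_rV R (m + k)]_(x in Omega) (f (rsubmx x) * phi x).

Definition weak_solution_section p H f (omega2 : set 'rV[R]_k)
    (w : 'rV[R]_k -> R) (Dw : 'rV[R]_k -> 'rV[R]_k) : Prop :=
  W1p0 omega2 p w Dw /\
  forall phi Dphi, W1p0 omega2 p phi Dphi ->
    \int[lebesgue_rV R k]_(y in omega2)
      (H (row_mx 0 (Dw y)) `^ (p - 1) *
       dot (rsubmx (grad H (row_mx 0 (Dw y)))) (Dphi y)) =
    \int[lebesgue_rV R k]_(y in omega2) (f y * phi y).

End problem.

(* Main.v *)
(* Let A z := H(z)^(p-1) grad H(z), w := u_l - u_oo, a := A (grad u_l) - A (grad_2 u_oo)
   and S := |grad u_l| + |grad_2 u_oo|. Testing the equation of u_oo with the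
   slices of a test function of Omega_l shows that u_oo solves the same equation
   in Omega_l as u_l, so that int a . grad phi = 0 for all phi in
   W_0^{1,p}(Omega_l). Take phi := rho^(2g) w with rho x := theta (X_1 / l), where
   theta is a cutoff function of omega_1, bounded below on omega_1 / 2. As rho
   does not depend on X_2, the Poincare inequality in one of the directions X_2
   bounds int |rho^g w|^p by a constant times X := int (rho^g |grad w|)^p, and
   |grad rho| = O(1/l); the energies of u_l and u_oo in Omega_l are O(l^m).
   If p >= 2, then with g = 1 the strong monotonicity of A, the growth
   |A z| <= C |z|^(p-1) and Young's inequality give X = O(l^(m - p/(p-1))).
   If p < 2, then (ii), (iii) and Young's inequality give
   Y := int rho^(2g) |grad w|^2 S^(p-2) = O(l^(-p) X), while
   X <= lam Y + lam^(-p/(2-p)) int S^p for every lam > 0; choose lam of order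
   l^p to absorb lam Y in X. *)

Require Import Defs.
From mathcomp Require Import all_boot all_order all_algebra.
From mathcomp Require Import all_classical all_reals all_analysis.
From mathcomp Require Import measurable_realfun ring lra.
Import Order.TTheory GRing.Theory Num.Theory.
Import numFieldNormedType.Exports.
Set Implicit Arguments.
Unset Strict Implicit.
Unset Printing Implicit Defensive.
Local Open Scope classical_set_scope.
Local Open Scope ring_scope.

(** * Lebesgue measure on row vectors *)

(** The lift of u_oo does not vanish where X_1 lies on the boundary of l omega_1, so w itself is not
    an admissible test function. It is handled through approximants: w is a limit of functions phi -
    psi(X_2), and a positive power of rho turns each of them into a test function of the cylinder,
    since rho confines X_1 and psi confines X_2. The power g is dictated by Young's inequality. The
    cross term splits into rho^g |w| and rho^(g-1) |a|. For p >= 2 the second factor is merely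
    compared with S^(p-1). For p < 2 its power q = p/(p-1) must fall back under the integrand of Y,
    which asks for (g-1) q >= 2 g; such a g exists because q > 2 exactly when p < 2. Independence of
    l rests on the order of choices: theta, the Poincare constant and g are fixed before l, which
    enters only through grad rho and the volume (2 M l)^m of a box around l omega_1. Absorbing terms
    requires X and Y to be finite, and the real-valued integral of a nonnegative function with
    infinite integral is 0; hence integrability accompanies every estimate. *)

Section borel_rV.
Context {R : realType}.

Lemma measurable_ball_rV n (c : 'I_n -> R) (r : R) :
  measurable [set x : 'rV[R]_n | forall i, `|c i - x ord0 i| < r].
Proof.
rewrite (_ : mkset _ = \bigcap_(i in [set: 'I_n])
   (@rV_coord R n i @^-1` [set y | `|c i - y| < r])); last first.
  by apply/seteqP; split=> x /= h i; [move=> _|]; exact: h.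
apply: fin_bigcap_measurable => // i _.
rewrite -[X in measurable X]setTI; apply: measurable_rV_coord => //.
rewrite (_ : [set y | _] = ball (c i) r) //; exact: measurable_ball.
Qed.

(** The sigma-algebra is generated by coordinates, so U has to be a countable union of cubes: those
    with rational centre and radius 1/(j+1) that lie inside U. A radius below e/2 keeps a cube
    containing x within distance e of x. *)
Lemma open_measurable_rV n (U : set 'rV[R]_n) : open U -> measurable U.
Proof.
move=> oU.
pose B (z : 'rV[rat]_n * nat) : set 'rV[R]_n :=
  [set x | forall i, `|ratr (z.1 ord0 i) - x ord0 i| < z.2.+1%:R^-1].
(* Cubes that leave U are replaced by the empty set, so that the union runs over a whole countable
   type. *)
pose F z := if `[< B z `<=` U >] then B z else set0.
have -> : U = \bigcup_(z in setT) F z.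
  apply/seteqP; split => [x Ux|x [z _]]; last first.
    by rewrite /F; case: asboolP => // BU /BU.
  have /nbhs_ballP[e /= e0 eU] := open_nbhs_nbhs (conj oU Ux).
  have [j jh] : exists j : nat, (j.+1%:R^-1 : R) < e / 2.
    have [j _ jP] := near_infty_natSinv_lt (PosNum (divr_gt0 e0 (ltr0n _ 2))).
    by exists j; exact: jP j (leqnn j).
  have j0 : 0 < (j.+1%:R^-1 : R) by rewrite invr_gt0.
  have [d dE] : exists d : R, j.+1%:R^-1 = d by exists j.+1%:R^-1.
  rewrite dE in j0 jh.
  have qP i : exists q : rat, `|ratr q - x ord0 i| < d.
    have [|q] := @rat_in_itvoo R (x ord0 i - d) (x ord0 i + d).
      by lra.
    by rewrite in_itv /= => qx; exists q; rewrite ltr_norml; lra.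
  pose q := \row_i projT1 (cid (qP i)).
  exists (q, j) => //; rewrite /F.
  have Bx : B (q, j) x.
    by move=> i /=; rewrite mxE dE; exact: projT2 (cid (qP i)).
  case: asboolP => // nB; exfalso; apply: nB => y By; apply: eU.
  split => // a i; rewrite ord1 /ball /=.
  have := By i; have := Bx i; rewrite /B /= dE !ltr_norml.
  by change (0 : 'I_1) with (ord0 : 'I_1); lra.
apply: countable_bigcupT_measurable => [|z]; first exact: countableP.
by rewrite /F; case: asboolP => // _; exact: (measurable_ball_rV (fun i => ratr (z.1 ord0 i))).
Qed.

Lemma continuous_measurable_rV n (f : 'rV[R]_n -> R) :
  continuous f -> measurable_fun setT f.
Proof.
move=> cf; apply: (measurability _ (RGenOpens.measurableE R)).
move=> _ [_ [a [b ->] <-]]; rewrite setTI.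
by apply: open_measurable_rV; apply: open_comp; [move=> x _; exact: cf|exact: interval_open].
Qed.

End borel_rV.

(** * Tonelli and Fubini along a measurable identification with a product space *)

Section change_to_product.
Context d1 d2 d (T1 : measurableType d1) (T2 : measurableType d2)
  (T : measurableType d) {R : realType}.
Variables (m1 : {sigma_finite_measure set T1 -> \bar R})
  (m2 : {sigma_finite_measure set T2 -> \bar R})
  (mu : {measure set T -> \bar R}).
Variables (phi : T1 * T2 -> T) (psi : T -> T1 * T2).
Hypotheses (mphi : measurable_fun setT phi) (mpsi : measurable_fun setT psi).
Hypothesis psiK : cancel psi phi.
Hypothesis muE : forall A, measurable A -> mu (psi @^-1` A) = (m1 \x m2)%E A.
Local Open Scope ereal_scope.

Let eqm A : measurable A -> A `<=` setT ->
  (m1 \x m2) A = pushforward mu psi A.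
Proof. by move=> mA _; rewrite /pushforward muE. Qed.

(** By [muE] the product measure is the image of [mu] under [psi], and [psiK] writes f as (f o phi)
    o psi; the claim is the change of variables for image measures. *)
Lemma ge0_integral_to_product (f : T -> \bar R) :
  measurable_fun setT f -> (forall x, 0 <= f x) ->
  \int[mu]_x f x = \int[m1 \x m2]_z f (phi z).
Proof.
move=> mf f0; rewrite (eq_measure_integral
  (measure_function_pushforward__canonical__measure_function_Measure mu mpsi))//.
rewrite (ge0_integral_pushforward mpsi mu)//.
- by apply: eq_integral => x _ /=; rewrite psiK.
- exact: measurableT_comp.
Qed.

Lemma integrable_to_product (f : T -> \bar R) :
  mu.-integrable setT f -> (m1 \x m2).-integrable setT (f \o phi).
Proof.
move=> /integrableP[mf foo]; apply/integrableP; split.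
  exact: measurableT_comp.
move: foo; rewrite ge0_integral_to_product//.
exact: measurableT_comp.
Qed.

Lemma integral_to_product (f : T -> \bar R) :
  mu.-integrable setT f ->
  \int[mu]_x f x = \int[m1 \x m2]_z f (phi z).
Proof.
move=> fi; have /integrableP[mf _] := fi.
rewrite [LHS]integralE [RHS]integralE.
rewrite (ge0_integral_to_product (measurable_funepos mf))//.
rewrite (ge0_integral_to_product (measurable_funeneg mf))//.
have -> : (fun z => f (phi z))^\+ = f^\+ \o phi by exact: funepos_comp.
by have -> : (fun z => f (phi z))^\- = f^\- \o phi by exact: funeneg_comp.
Qed.

Lemma tonelli_change (f : T -> \bar R) :
  measurable_fun setT f -> (forall x, 0 <= f x) ->
  \int[mu]_x f x = \int[m1]_x \int[m2]_y f (phi (x, y)).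
Proof.
move=> mf f0; rewrite ge0_integral_to_product//.
apply: (@fubini_tonelli1 _ _ _ _ _ m1 m2 (f \o phi)).
  exact: measurableT_comp.
by move=> z; exact: f0.
Qed.

Lemma fubini_change (f : T -> \bar R) : mu.-integrable setT f ->
  \int[mu]_x f x = \int[m1]_x \int[m2]_y f (phi (x, y)).
Proof.
move=> fi; rewrite integral_to_product//.
by rewrite -(integral12_prod_meas1 (integrable_to_product fi)).
Qed.

Lemma fubini_change2 (f : T -> \bar R) : mu.-integrable setT f ->
  \int[mu]_x f x = \int[m2]_y \int[m1]_x f (phi (x, y)).
Proof.
move=> fi; rewrite integral_to_product//.
by rewrite -(integral21_prod_meas1 (integrable_to_product fi)).
Qed.

End change_to_product.

Section lebesgue_rV_product.
Context {R : realType}.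
Local Notation leb := (lebesgue_rV R).

Lemma row_uncons_lebesgue n (A : set (measurableTypeR R * 'rV[R]_n)) :
  measurable A ->
  leb n.+1 (@row_uncons R n @^-1` A) = (lebesgue_measure \x leb n)%E A.
Proof.
move=> mA; rewrite [LHS]/= /lebesgue_succ /pushforward -comp_preimage.
by rewrite (_ : _ \o _ = id)//; apply/funext; exact: row_consK.
Qed.

Lemma row_unconsK n : cancel (@row_uncons R n) (@row_cons R n).
Proof.
move=> x; apply/rowP => i; rewrite mxE.
by case: unliftP => [j ->|->] //=; rewrite mxE.
Qed.

Definition row_glue m k (z : 'rV[R]_m * 'rV[R]_k) : 'rV[R]_(m + k) :=
  row_mx z.1 z.2.

Definition row_split m k (x : 'rV[R]_(m + k)) : 'rV[R]_m * 'rV[R]_k :=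
  (lsubmx x, rsubmx x).

Lemma row_splitK m k : cancel (@row_split m k) (@row_glue m k).
Proof. by move=> x; rewrite /row_glue hsubmxK. Qed.

Lemma measurable_row_glue m k : measurable_fun setT (@row_glue m k).
Proof.
apply: measurable_fun_rV => i.
case: (splitP i) => j ij.
  have -> : i = lshift k j by exact/val_inj.
  rewrite (_ : _ \o _ = rV_coord j \o fst).
    by apply: measurableT_comp => //; exact: measurable_rV_coord.
  by apply/funext => -[a v] /=; rewrite /rV_coord row_mxEl.
have -> : i = rshift m j by exact/val_inj.
rewrite (_ : _ \o _ = rV_coord j \o snd).
  by apply: measurableT_comp => //; exact: measurable_rV_coord.
by apply/funext => -[a v] /=; rewrite /rV_coord row_mxEr.
Qed.

Lemma measurable_lsubmx m k :
  measurable_fun setT (lsubmx : 'rV[R]_(m + k) -> 'rV[R]_m).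
Proof.
apply: measurable_fun_rV => i.
rewrite (_ : _ \o _ = rV_coord (lshift k i)); first exact: measurable_rV_coord.
by apply/funext => x; rewrite /rV_coord /= mxE.
Qed.

Lemma measurable_rsubmx m k :
  measurable_fun setT (rsubmx : 'rV[R]_(m + k) -> 'rV[R]_k).
Proof.
apply: measurable_fun_rV => i.
rewrite (_ : _ \o _ = rV_coord (rshift m i)); first exact: measurable_rV_coord.
by apply/funext => x; rewrite /rV_coord /= mxE.
Qed.

Lemma measurable_row_split m k : measurable_fun setT (@row_split m k).
Proof.
by apply: measurable_fun_pair; [exact: measurable_lsubmx|exact: measurable_rsubmx].
Qed.

Lemma lsubmx_row_cons m k (t : R) (z : 'rV[R]_(m + k)) :
  @lsubmx R 1 m.+1 k (@row_cons R (m + k) (t, z)) = row_cons (t, lsubmx z).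
Proof.
apply/rowP => i; rewrite mxE [LHS]mxE [RHS]mxE.
have [j ->|->] := unliftP ord0 i.
  have -> : lshift k (lift ord0 j) = lift ord0 (lshift k j) :> 'I_(m + k).+1.
    exact/val_inj.
  by rewrite liftK /= mxE.
have -> : lshift k ord0 = ord0 :> 'I_(m + k).+1 by exact/val_inj.
by rewrite unlift_none.
Qed.

Lemma rsubmx_row_cons m k (t : R) (z : 'rV[R]_(m + k)) :
  @rsubmx R 1 m.+1 k (@row_cons R (m + k) (t, z)) = rsubmx z.
Proof.
apply/rowP => i; rewrite mxE [LHS]mxE [RHS]mxE.
have -> : rshift m.+1 i = lift ord0 (rshift m i) :> 'I_(m + k).+1.
  exact/val_inj.
by rewrite liftK.
Qed.

(** Induction on m, because the measure on rows peels off one coordinate at a time from the left: A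
    is sliced at its first coordinate and each slice is a smaller rectangle. For m = 0 the first
    factor is a Dirac mass, so only the membership of 0 in A matters. *)
Lemma lebesgue_rectangle m k (A : set 'rV[R]_m) (B : set 'rV[R]_k) :
  measurable A -> measurable B ->
  leb (m + k) (@row_split m k @^-1` (A `*` B)) = (leb m A * leb k B)%E.
Proof.
elim: m A => [|m IH] A mA mB.
  rewrite /= diracE; have [A0|A0] := boolP (0 \in A).
    rewrite mul1e; congr (leb k _); apply/seteqP; split => x /=.
      rewrite (_ : rsubmx (x : 'rV_(0 + k)) = x); first by case.
      by apply/rowP => i; rewrite mxE; congr (x _ _); exact/val_inj.
    move=> Bx; split; first by rewrite thinmx0; exact: set_mem.
    rewrite (_ : rsubmx (x : 'rV_(0 + k)) = x)//.
    by apply/rowP => i; rewrite mxE; congr (x _ _); exact/val_inj.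
  rewrite mul0e (_ : _ @^-1` _ = set0) ?measure0//.
  apply/seteqP; split => x //= [Ax _].
  by move/negP: A0; apply; rewrite inE; move: Ax; rewrite thinmx0.
have mS : measurable (@row_cons R m @^-1` A).
  by rewrite -[X in measurable X]setTI; exact: measurable_row_cons.
have mB' : measurable (@row_split m.+1 k @^-1` (A `*` B)).
  by rewrite -[X in measurable X]setTI; apply: measurable_row_split => //;
    exact: measurableX.
transitivity (\int[lebesgue_measure]_t
    (leb m [set a | A (row_cons (t, a))] * leb k B))%E.
  rewrite [LHS]/= /lebesgue_succ /pushforward /product_measure1 /=.
  apply: eq_integral => t _.
  rewrite -IH//; last first.
    have := measurable_xsection (t : measurableTypeR R) mS.
    by rewrite xsectionE.
  rewrite xsectionE; congr (leb (m + k) _); apply/seteqP; split => z /=;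
    by rewrite lsubmx_row_cons rsubmx_row_cons.
rewrite ge0_integralZr//.
- congr (_ * _)%E; rewrite /= /lebesgue_succ /pushforward /product_measure1 /=.
  by apply: eq_integral => t _; rewrite xsectionE.
- have := measurable_fun_xsection (leb m) mS.
  by apply: eq_measurable_fun => t _ /=; rewrite xsectionE.
Qed.

(** A product of sigma-finite measures is determined by its values on rectangles. *)
Lemma row_split_lebesgue m k (A : set ('rV[R]_m * 'rV[R]_k)) :
  measurable A -> leb (m + k) (@row_split m k @^-1` A) = (leb m \x leb k)%E A.
Proof.
move=> mA; symmetry.
rewrite (@product_measure_unique _ _ _ _ _ (leb m) (leb k)
  (measure_function_pushforward__canonical__measure_function_Measure
    (leb (m + k)) (@measurable_row_split m k)))//.
by move=> B C mB mC; rewrite -lebesgue_rectangle.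
Qed.

Lemma lebesgue_box n (M : R) : 0 <= M ->
  leb n [set x | forall i, `|x ord0 i| <= M] = ((2 * M) ^+ n)%:E.
Proof.
move=> M0; elim: n => [|n IH].
  by rewrite /= diracE expr0 mem_set//= => i; case: i.
have mI : measurable (`[- M, M]%classic : set (measurableTypeR R)).
  exact: measurable_itv.
have mB : measurable [set x : 'rV[R]_n | forall i, `|x ord0 i| <= M].
  rewrite (_ : mkset _ = \bigcap_(i in [set: 'I_n])
     (@rV_coord R n i @^-1` `[- M, M])); last first.
    apply/seteqP; split=> x /= h i.
      by move=> _; have := h i; rewrite /rV_coord /= in_itv /= ler_norml.
    by have := h i I; rewrite /rV_coord /= in_itv /= ler_norml.
  apply: fin_bigcap_measurable => // i _.
  by rewrite -[X in measurable X]setTI; apply: measurable_rV_coord.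
transitivity (leb n.+1 (@row_uncons R n @^-1`
    (`[- M, M] `*` [set x : 'rV[R]_n | forall i, `|x ord0 i| <= M]))).
  congr (leb n.+1 _); apply/seteqP; split => x /=.
    move=> h; split; first by rewrite in_itv /= -ler_norml.
    by move=> i; rewrite mxE.
  rewrite in_itv /= -ler_norml => -[h0 h] i.
  by case: (unliftP ord0 i) => [j ->|->]//; have := h j; rewrite mxE.
rewrite row_uncons_lebesgue; last exact: measurableX.
rewrite product_measure1E// [X in (_ * X)%E]IH exprS EFinM.
congr (_ * _)%E.
have /= -> := @lebesgue_measure_itv R `[- M, M]; rewrite lte_fin.
by case: ltP => MM; [rewrite -EFinD|]; congr EFin; lra.
Qed.

End lebesgue_rV_product.

Section rV_topology.
Context {R : realType}.

Lemma ler_rV_norm n (x : 'rV[R]_n) i : `|x ord0 i| <= `|x|.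
Proof.
rewrite [leRHS]/Num.norm /= mx_normrE.
exact: (le_bigmax _ (fun ij : 'I_1 * 'I_n => `|x ij.1 ij.2|) (ord0, i)).
Qed.

Lemma rV_norm_le n (x : 'rV[R]_n) (M : R) : 0 <= M ->
  (forall i, `|x ord0 i| <= M) -> `|x| <= M.
Proof.
move=> M0 xM; rewrite [leLHS]/Num.norm /= mx_normrE.
by apply: bigmax_le => // -[a i] _ /=; rewrite ord1.
Qed.

Lemma continuous_rV n (T : topologicalType) (f : T -> 'rV[R]_n) :
  (forall i, continuous (fun x => f x ord0 i)) -> continuous f.
Proof.
move=> cf x; apply/cvgrPdist_le => e e0.
have : \forall y \near x, forall i : 'I_n, `|f x ord0 i - f y ord0 i| <= e.
  apply: filter_forall => i; have /cvgrPdist_le := cf i x; exact.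
apply: filterS => y h; apply: rV_norm_le => [|i]; first exact: ltW.
by rewrite !mxE; exact: h.
Qed.

Lemma continuous_row_cons n (t : R) : continuous (fun y : 'rV[R]_n => row_cons (t, y)).
Proof.
apply: continuous_rV => i; under eq_fun do rewrite mxE.
case: (unliftP ord0 i) => [j _|_] /=; first exact: coord_continuous.
exact: cst_continuous.
Qed.

Lemma continuous_row_consl n (y : 'rV[R]_n) : continuous (fun t : R => row_cons (t, y)).
Proof.
apply: continuous_rV => i; under eq_fun do rewrite mxE.
by case: (unliftP ord0 i) => [j _|_] /=; [exact: cst_continuous|move=> ?; exact: cvg_id].
Qed.

Lemma norm_row_cons_ger n (t : R) (y : 'rV[R]_n) : `|y| <= `|row_cons (t, y)|.
Proof.
apply: rV_norm_le => // i.
have <- : row_cons (t, y) ord0 (lift ord0 i) = y ord0 i by rewrite mxE liftK.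
exact: ler_rV_norm.
Qed.

Lemma norm_row_cons_gel n (t : R) (y : 'rV[R]_n) : `|t| <= `|row_cons (t, y)|.
Proof.
have {1}<- : row_cons (t, y) ord0 ord0 = t by rewrite mxE unlift_none.
exact: ler_rV_norm.
Qed.

Lemma compact_norm_le n (M : R) : compact [set x : 'rV[R]_n | `|x| <= M].
Proof.
apply: bounded_closed_compact.
  by exists M; split; [exact: num_real|move=> y My x /= xM; apply: le_trans xM (ltW My)].
rewrite (_ : mkset _ = (fun x : 'rV[R]_n => `|x|) @^-1` [set y | y <= M])//.
apply: preimage_closed; last exact: closed_le.
by move=> x _; exact: norm_continuous.
Qed.

Lemma measurable_norm_le n (M : R) : measurable [set x : 'rV[R]_n | `|x| <= M].
Proof.
have /(measurable_fun_ler (@measurable_cst _ _ _ _ setT M)) := 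
  continuous_measurable_rV (@norm_continuous R 'rV[R]_n).
rewrite (_ : mkset _ = ~` [set x : 'rV[R]_n | M < `|x|]).
  move=> _; apply: measurableC; apply: open_measurable_rV.
  apply: (@open_comp _ _ (fun x : 'rV[R]_n => `|x|) [set y | M < y]).
    by move=> x _; exact: norm_continuous.
  exact: open_gt.
by apply/seteqP; split => x /=; [move=> h; apply/negP; rewrite -leNgt|move/negP; rewrite -leNgt].
Qed.

Lemma lebesgue_norm_le n (M : R) : 0 <= M ->
  lebesgue_rV R n [set x | `|x| <= M] = ((2 * M) ^+ n)%:E.
Proof.
move=> M0; rewrite -lebesgue_box//; congr (lebesgue_rV R n _).
apply/seteqP; split => x /= h; last exact: rV_norm_le.
by move=> i; apply: le_trans h; exact: ler_rV_norm.
Qed.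

End rV_topology.

Section derive_along.
Context {R : numFieldType} {V W U : normedModType R}.

(** L maps the line through y in direction v onto the line through L y in direction w at the same
    speed, so the two difference quotients coincide. This covers freezing, gluing, projecting and
    rescaling coordinates. *)
Lemma derive_along (g : W -> U) (L : V -> W) v w y :
  (forall h : R, L (h *: v + y) = h *: w + L y) ->
  'D_v (g \o L) y = 'D_w g (L y).
Proof.
by move=> Lh; rewrite /derive; under eq_fun do rewrite /= Lh.
Qed.

Lemma derivable_along (g : W -> U) (L : V -> W) v w y :
  (forall h : R, L (h *: v + y) = h *: w + L y) ->
  derivable (g \o L) y v = derivable g (L y) w.
Proof.
by move=> Lh; rewrite /derivable; under eq_fun do rewrite /= Lh.
Qed.

End derive_along.

(** * Fubini on rows and vanishing integrals of partial derivatives *)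

Section integral_partial.
Context {R : realType}.
Local Notation leb := (lebesgue_rV R).

Lemma integrable_norm_le n (M : R) :
  (leb n).-integrable setT (fun x => (\1_[set x : 'rV[R]_n | `|x| <= M] x)%:E).
Proof.
apply/integrableP; split.
  by apply/measurable_EFinP; apply: measurable_indic; exact: measurable_norm_le.
under eq_integral do rewrite gee0_abs ?lee_fin//.
rewrite integral_indic// ?setIT; last exact: measurable_norm_le.
apply: (@le_lt_trans _ _ (leb n [set x | `|x| <= `|M|])).
  apply: le_measure; rewrite ?inE; [exact: measurable_norm_le..|].
  by move=> x /= xM; apply: le_trans xM (ler_norm _).
by rewrite lebesgue_norm_le// ltry.
Qed.

Lemma integrable_bounded_support n (g : 'rV[R]_n -> R) (M : R) :
  continuous g -> (forall x, M < `|x| -> g x = 0) ->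
  (leb n).-integrable setT (EFin \o g).
Proof.
move=> cg gM.
have cK := @compact_norm_le R n M.
have [B [_ Bh]] : bounded_set (g @` [set x : 'rV[R]_n | `|x| <= M]).
  apply: compact_bounded; apply: continuous_compact => //.
  exact: continuous_subspaceT.
(* [bounded_set] gives the bound only for numbers strictly above B, whose sign is unknown; hence
   [|B| + 1]. *)
have gB x : `|x| <= M -> `|g x| <= `|B| + 1.
  move=> xM; apply: (Bh (`|B| + 1)); last by exists x.
  by apply: le_lt_trans (ler_norm B) _; rewrite ltrDl.
apply: (@le_integrable _ _ _ _ _ measurableT _
    (fun x => ((`|B| + 1)%:E * (\1_[set x : 'rV[R]_n | `|x| <= M] x)%:E)%E)).
- by apply/measurable_EFinP; exact: continuous_measurable_rV.
- move=> x _; rewrite -EFinM /= lee_fin indicE.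
  have [xM|xM] := leP `|x| M.
    by rewrite mem_set// mulr1 (le_trans (gB _ xM))// ler_norm.
  by rewrite gM// normr0.
- by apply: integrableZl => //; exact: integrable_norm_le.
Qed.

Lemma fubini_row_cons n (f : 'rV[R]_n.+1 -> \bar R) :
  (leb n.+1).-integrable setT f ->
  (\int[leb n.+1]_x f x =
   \int[lebesgue_measure]_t \int[leb n]_y f (row_cons (t, y)))%E.
Proof.
exact: (fubini_change (@measurable_row_cons R n) (@measurable_row_uncons R n)
  (@row_unconsK R n) (@row_uncons_lebesgue R n)).
Qed.

Lemma fubini_row_cons2 n (f : 'rV[R]_n.+1 -> \bar R) :
  (leb n.+1).-integrable setT f ->
  (\int[leb n.+1]_x f x =
   \int[leb n]_y \int[lebesgue_measure]_t f (row_cons (t, y)))%E.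
Proof.
exact: (fubini_change2 (@measurable_row_cons R n) (@measurable_row_uncons R n)
  (@row_unconsK R n) (@row_uncons_lebesgue R n)).
Qed.

Lemma tonelli_row_mx m k (f : 'rV[R]_(m + k) -> \bar R) :
  measurable_fun setT f -> (forall x, 0 <= f x)%E ->
  (\int[leb (m + k)]_x f x =
   \int[leb m]_x \int[leb k]_y f (row_mx x y))%E.
Proof.
exact: (tonelli_change (@measurable_row_glue R m k) (@measurable_row_split R m k)
  (@row_splitK R m k) (@row_split_lebesgue R m k)).
Qed.

Lemma fubini_row_mx m k (f : 'rV[R]_(m + k) -> \bar R) :
  (leb (m + k)).-integrable setT f ->
  (\int[leb (m + k)]_x f x =
   \int[leb m]_x \int[leb k]_y f (row_mx x y))%E.
Proof.
exact: (fubini_change (@measurable_row_glue R m k) (@measurable_row_split R m k)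
  (@row_splitK R m k) (@row_split_lebesgue R m k)).
Qed.

Lemma fubini_row_mx2 m k (f : 'rV[R]_(m + k) -> \bar R) :
  (leb (m + k)).-integrable setT f ->
  (\int[leb (m + k)]_x f x =
   \int[leb k]_y \int[leb m]_x f (row_mx x y))%E.
Proof.
exact: (fubini_change2 (@measurable_row_glue R m k) (@measurable_row_split R m k)
  (@row_splitK R m k) (@row_split_lebesgue R m k)).
Qed.

(** Fundamental theorem of calculus on [-a, a] with a = |M| + 1: the strict margin makes h vanish at
    both ends and, locally around every point outside, so that its derivative vanishes there too. *)
Lemma integral_derive_bounded_support (h : R -> R) (M : R) :
  (forall t, derivable h t 1) -> continuous ('D_1 h) ->
  (forall t, M < `|t| -> h t = 0) ->
  (\int[lebesgue_measure]_t ('D_1 h t)%:E = 0)%E.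
Proof.
move=> dh ch hM; set a : R := `|M| + 1.
have Ma (t : R) : a <= `|t| -> M < `|t|.
  by apply: lt_le_trans; rewrite /a (le_lt_trans (ler_norm M))// ltrDl.
have a0 : 0 < a by rewrite ltr_wpDl.
have dh0 (t : R) : M < `|t| -> 'D_1 h t = 0.
  move=> Mt; rewrite (@near_eq_derive _ _ _ h (cst 0))//; first exact: derive_cst.
  have : \forall s \near t, M < `|s|.
    have := @norm_continuous R R^o t => /cvgrPdist_lt /(_ (`|t| - M)).
    rewrite subr_gt0 => /(_ Mt); apply: filterS => s.
    by rewrite ltr_norml => /andP[]; lra.
  by apply: filterS => s; exact: hM.
have <- : (\int[lebesgue_measure]_(t in `[(- a)%R, a]) ('D_1 h t)%:E =
   \int[lebesgue_measure]_t ('D_1 h t)%:E)%E.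
  rewrite integral_mkcond; apply: eq_integral => t _.
  rewrite patchE; case: ifPn => // /negP ta; rewrite dh0//; apply: Ma.
  rewrite leNgt; apply/negP => at_; apply: ta; rewrite inE /= in_itv /= -ler_norml.
  exact: ltW.
rewrite (@continuous_FTC2 _ _ h).
- by rewrite !hM ?subee//; apply: Ma; rewrite ?normrN ger0_norm// ltW.
- lra.
- exact: continuous_subspaceT.
- split; first by move=> t _; exact: dh.
    by apply: cvg_at_right_filter; apply/differentiable_continuous/derivable1_diffP.
  by apply: cvg_at_left_filter; apply/differentiable_continuous/derivable1_diffP.
- by move=> t _; rewrite derive1E.
Qed.

(** Induction on the dimension, with the order of integration chosen so that the inner integral
    vanishes. If i is not the first coordinate, the first one is frozen and the induction hypothesis
    applies to the slice; if it is, the inner integral runs along the first axis and is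
    one-dimensional. *)
Lemma integral_partial0 n (i : 'I_n) (g : 'rV[R]_n -> R) (M : R) :
  (forall x, derivable g x (delta_mx ord0 i)) -> continuous (partial i g) ->
  (forall x, M < `|x| -> g x = 0) ->
  (\int[leb n]_x (partial i g x)%:E = 0)%E.
Proof.
elim: n i g => [[]//|n IH] i g dg cg gM.
have ig : (leb n.+1).-integrable setT (EFin \o partial i g).
  apply: (@integrable_bounded_support _ _ M) => // x Mx.
  rewrite /partial (@near_eq_derive _ _ _ g (cst 0)) ?derive_cst//.
  have : \forall s \near x, M < `|s|.
    have := @norm_continuous R 'rV[R]_n.+1 x => /cvgrPdist_lt /(_ (`|x| - M)).
    rewrite subr_gt0 => /(_ Mx); apply: filterS => s.
    by rewrite ltr_norml => /andP[]; lra.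
  by apply: filterS => s; exact: gM.
have [j ij|i0] := unliftP ord0 i.
- rewrite fubini_row_cons// integral0_eq// => t _.
  have L y (h : R) : row_cons (t, h *: delta_mx ord0 j + y) =
      h *: delta_mx ord0 i + row_cons (t, y).
    apply/rowP => a; rewrite !mxE ij.
    have [b ->|->] /= := unliftP ord0 a; last by rewrite mulr0 add0r.
    by rewrite !mxE /= (inj_eq lift_inj).
  have E : partial j (g \o (fun y => row_cons (t, y))) =
      partial i g \o (fun y => row_cons (t, y)).
    by apply/funext => y; exact: (derive_along g (L y)).
  rewrite -[RHS](IH j (g \o (fun y => row_cons (t, y)))).
  + by rewrite E.
  + by move=> y; rewrite (derivable_along g (L y)).
  + rewrite E => y; apply: continuous_comp; last exact: cg.
    exact: continuous_row_cons.
  + by move=> y My; apply: gM; apply: lt_le_trans My (norm_row_cons_ger _ _).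
- rewrite fubini_row_cons2// integral0_eq// => y _.
  have L (t h : R) : row_cons (h *: (1 : R) + t, y) =
      h *: delta_mx ord0 i + row_cons (t, y).
    apply/rowP => a; rewrite !mxE i0.
    have [b ->|->] /= := unliftP ord0 a; last by rewrite /GRing.scale.
    by rewrite mulr0 add0r.
  have E : 'D_1 (g \o (fun t : R => row_cons (t, y))) =
      partial i g \o (fun t : R => row_cons (t, y)).
    by apply/funext => t; exact: (derive_along g (L t)).
  rewrite -[RHS](@integral_derive_bounded_support
     (g \o (fun t : R => row_cons (t, y))) M).
  + apply: eq_integral => t _; congr EFin.
    exact: (esym (derive_along g (L t))).
  + by move=> t; rewrite (derivable_along g (L t)).
  + rewrite E => t; apply: continuous_comp; last exact: cg.
    exact: continuous_row_consl.
  + by move=> t Mt; apply: gM; apply: lt_le_trans Mt (norm_row_cons_gel _ _).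
Qed.

End integral_partial.

(** * Smooth functions and cutoffs *)

Section smooth.
Context {R : realType}.

Section smooth_n.
Context {n : nat}.
Implicit Types (f g : 'rV[R]_n -> R) (x : 'rV[R]_n) (i : 'I_n).

Lemma partialE f x i : differentiable f x ->
  partial i f x = 'd f x (delta_mx ord0 i).
Proof. by move=> df; rewrite /partial deriveE. Qed.

Lemma derive_partial f x (w : 'rV[R]_n) : differentiable f x ->
  'D_w f x = \sum_j w ord0 j * partial j f x.
Proof.
move=> df; rewrite deriveE// {1}(row_sum_delta w) linear_sum /=.
by apply: eq_bigr => j _; rewrite linearZ /= partialE.
Qed.

Lemma partialD f g x i : differentiable f x -> differentiable g x ->
  partial i (f \+ g) x = partial i f x + partial i g x.
Proof. by move=> df dg; rewrite /partial deriveD//; exact: diff_derivable. Qed.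

Lemma partialB f g x i : differentiable f x -> differentiable g x ->
  partial i (f \- g) x = partial i f x - partial i g x.
Proof. by move=> df dg; rewrite /partial deriveB//; exact: diff_derivable. Qed.

Lemma partialM f g x i : differentiable f x -> differentiable g x ->
  partial i (f \* g) x = f x * partial i g x + g x * partial i f x.
Proof. by move=> df dg; rewrite /partial deriveM//; exact: diff_derivable. Qed.

Lemma partial_cst (c : R) x i : partial i (fun=> c) x = 0.
Proof. exact: derive_cst. Qed.

Lemma partial_comp (h dh : R -> R) f x i : (forall t : R, is_derive t 1 h (dh t)) ->
  differentiable f x -> partial i (h \o f) x = dh (f x) * partial i f x.
Proof.
move=> hh df; have dhf : differentiable h (f x).
  by apply/derivable1_diffP; apply: ex_derive.
rewrite !partialE//; last exact: differentiable_comp.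
rewrite diff_comp//= deriv1E; last by apply/derivable1_diffP.
by rewrite derive1E derive_val /GRing.scale /= mulrC.
Qed.

Lemma CkS k f : Ck k.+1 f -> Ck k f.
Proof.
elim: k f => [|k IH] f /= [df dpf].
  by move=> x; exact: differentiable_continuous.
by split => // i; apply: IH; split; [exact: (dpf i).1|exact: (dpf i).2].
Qed.

Lemma Ck_continuous k f : Ck k f -> continuous f.
Proof. by elim: k => // k IH /CkS. Qed.

Lemma CkD k f g : Ck k f -> Ck k g -> Ck k (f \+ g).
Proof.
elim: k f g => [f g cf cg x|k IH f g /= [df pf] [dg pg]].
  exact: continuousD (cf x) (cg x).
split=> [x|i]; first exact: differentiableD.
rewrite (_ : partial i _ = partial i f \+ partial i g); first exact: IH.
by apply/funext => x; rewrite partialD.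
Qed.

Lemma CkB k f g : Ck k f -> Ck k g -> Ck k (f \- g).
Proof.
elim: k f g => [f g cf cg x|k IH f g /= [df pf] [dg pg]].
  exact: continuousB (cf x) (cg x).
split=> [x|i]; first exact: differentiableB.
rewrite (_ : partial i _ = partial i f \- partial i g); first exact: IH.
by apply/funext => x; rewrite partialB.
Qed.

Lemma CkM k f g : Ck k f -> Ck k g -> Ck k (f \* g).
Proof.
elim: k f g => [f g cf cg x|k IH f g Cf Cg].
  exact: continuousM (cf x) (cg x).
move: (Cf) (Cg) => [df pf] [dg pg].
split=> [x|i]; first exact: differentiableM.
rewrite (_ : partial i _ = (f \* partial i g) \+ (g \* partial i f)).
  by apply: CkD; apply: IH; [exact: CkS Cf|exact: pg|exact: CkS Cg|exact: pf].
by apply/funext => x; rewrite partialM.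
Qed.

Lemma Ck_cst k (c : R) : Ck k (fun _ : 'rV[R]_n => c).
Proof.
elim: k c => [|k IH] c; first by move=> x; exact: cst_continuous.
split=> [x|i]; first exact: differentiable_cst.
rewrite (_ : partial i _ = fun=> 0)//.
by apply/funext => x; rewrite partial_cst.
Qed.

Lemma differentiable_rV_coord (j : 'I_n) x :
  differentiable (fun y : 'rV[R]_n => y ord0 j) x.
Proof. exact: differentiable_coord. Qed.

Lemma partial_coord (i j : 'I_n) x :
  partial i (fun y : 'rV[R]_n => y ord0 j) x = (j == i)%:R.
Proof.
rewrite /partial /derive; apply: (@lim_near_cst) => //.
near=> h.
by rewrite /= !mxE eqxx /= addrK /GRing.scale /= mulrA mulVf ?mul1r//;
  near: h; exact: nbhs_dnbhs_neq.
Unshelve. all: by end_near. Qed.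

Lemma Ck_coord k (j : 'I_n) : Ck k (fun y : 'rV[R]_n => y ord0 j).
Proof.
case: k => [|k]; first exact: coord_continuous.
split=> [x|i]; first exact: differentiable_coord.
rewrite (_ : partial i _ = fun=> (j == i)%:R); first exact: Ck_cst.
by apply/funext => x; rewrite partial_coord.
Qed.

Lemma Ck_sum k (I : Type) (s : seq I) (F : I -> 'rV[R]_n -> R) :
  (forall a, Ck k (F a)) -> Ck k (fun x => \sum_(a <- s) F a x).
Proof.
move=> CF; elim: s => [|a s IH].
  by under eq_fun do rewrite big_nil; exact: Ck_cst.
by under eq_fun do rewrite big_cons; exact: CkD.
Qed.

Lemma Ck_prod k (I : Type) (s : seq I) (F : I -> 'rV[R]_n -> R) :
  (forall a, Ck k (F a)) -> Ck k (fun x => \prod_(a <- s) F a x).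
Proof.
move=> CF; elim: s => [|a s IH].
  by under eq_fun do rewrite big_nil; exact: Ck_cst.
by under eq_fun do rewrite big_cons; exact: CkM.
Qed.

Lemma CkX k f N : Ck k f -> Ck k (fun x => f x ^+ N).
Proof.
move=> Cf; elim: N => [|N IH].
  by under eq_fun do rewrite expr0; exact: Ck_cst.
by under eq_fun do rewrite exprS; exact: CkM.
Qed.

Lemma partialX f N x i : (forall x, differentiable f x) ->
  partial i (fun x => f x ^+ N.+1) x = N.+1%:R * f x ^+ N * partial i f x.
Proof.
move=> df; rewrite /partial.
have -> : (fun x => f x ^+ N.+1) = f ^+ N.+1 by apply/funext => y; rewrite fctE.
rewrite deriveX ?fctE; last exact: diff_derivable.
by rewrite /GRing.scale /= -mulr_natl.
Qed.

End smooth_n.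

Section affine.
Variables (a b : nat) (c : 'rV[R]_b) (A : 'M[R]_(a, b)).

Let L (x : 'rV[R]_a) := c + x *m A.

Let dL x : differentiable L x.
Proof.
apply: differentiableD; first exact: differentiable_cst.
apply: (@linear_differentiable _ _ _ (mulmxr A)).
apply: continuous_rV => j; under eq_fun do rewrite mxE.
apply: (@Ck_continuous _ 0); apply: Ck_sum => i.
by apply: CkM; [exact: Ck_coord|exact: Ck_cst].
Qed.

Lemma partial_affine (f : 'rV[R]_b -> R) i x : differentiable f (c + x *m A) ->
  partial i (fun x => f (c + x *m A)) x =
  \sum_j A i j * partial j f (c + x *m A).
Proof.
move=> df; rewrite /partial.
rewrite (@derive_along _ _ _ _ f L _ (row i A)).
  by rewrite derive_partial//; apply: eq_bigr => j _; rewrite mxE.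
by move=> h; rewrite /L mulmxDl -scalemxAl -rowE addrCA.
Qed.

Lemma differentiable_affine (f : 'rV[R]_b -> R) x :
  differentiable f (c + x *m A) ->
  differentiable (fun x => f (c + x *m A)) x.
Proof. by move=> df; apply: (@differentiable_comp _ _ _ _ L f). Qed.

(** Slices of test functions, the lift through [rsubmx] and the rescaled cutoff are all of this
    form. The induction closes because each partial derivative is a combination, with constant
    coefficients, of functions of the same form. *)
Lemma Ck_affine k (f : 'rV[R]_b -> R) : Ck k f ->
  Ck k (fun x => f (c + x *m A)).
Proof.
elim: k f => [|k IH] f.
  move=> cf x; apply: (@continuous_comp _ _ _ L f); last exact: cf.
  exact/differentiable_continuous/dL.
move=> [df pf]; split=> [x|i]; first exact: differentiable_affine.
rewrite (_ : partial i _ =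
   fun x => \sum_j A i j * partial j f (c + x *m A)); last first.
  by apply/funext => x; rewrite partial_affine.
apply: Ck_sum => j; apply: (@CkM _ _ (fun=> A i j)); first exact: Ck_cst.
exact: (IH _ (pf j)).
Qed.

End affine.

End smooth.

Section unit_bump.
Context {R : realType}.

(* The derivatives of [exp (- t^-1)] are combinations of the functions [flat j]. *)
Definition flat (j : nat) (t : R) : R :=
  if 0 < t then (t^-1) ^+ j * expR (- t^-1) else 0.

Lemma flat_ge0 j t : 0 <= flat j t.
Proof.
rewrite /flat; case: ifPn => // t0.
by rewrite mulr_ge0// ?expR_ge0// exprn_ge0// invr_ge0 ltW.
Qed.

Lemma flat_gt0 j t : 0 < t -> 0 < flat j t.
Proof. by move=> t0; rewrite /flat t0 mulr_gt0 ?expR_gt0// exprn_gt0// invr_gt0. Qed.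

Lemma flat_le0 j t : t <= 0 -> flat j t = 0.
Proof. by move=> t0; rewrite /flat ltNge t0. Qed.

(* exp s = (exp (s / N))^N >= (s / N)^N with s = 1 / t and N = j + 2. *)
Lemma flat_le j t : flat j t <= j.+2%:R ^+ j.+2 * t ^+ 2.
Proof.
have [t0|t0] := ltP 0 t; last first.
  by rewrite flat_le0//; apply: mulr_ge0; [exact: exprn_ge0|exact: sqr_ge0].
rewrite /flat t0; set s := t^-1.
have s0 : 0 < s by rewrite invr_gt0.
have N0 : 0 < j.+2%:R :> R by [].
have E : (s / j.+2%:R) ^+ j.+2 <= expR s.
  rewrite -[s in expR s](divfK (lt0r_neq0 N0)) expRM_natr.
  apply: lerXn2r; rewrite ?nnegrE ?expR_ge0 ?divr_ge0 ?(ltW s0)//.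
  by apply: le_trans (expR_ge1Dx _); rewrite lerDr.
have sN : s ^+ j.+2 <= j.+2%:R ^+ j.+2 * expR s.
  by rewrite -ler_pdivrMl ?exprn_gt0// mulrC -expr_div_n.
have sj : s ^+ j = s ^+ j.+2 * t ^+ 2.
  by rewrite -(addn2 j) exprD -mulrA -exprMn mulVf ?gt_eqF// expr1n mulr1.
rewrite expRN ler_pdivrMr ?expR_gt0// sj [leRHS]mulrAC.
by apply: ler_wpM2r => //; exact: sqr_ge0.
Qed.

Lemma is_derive_flat j (t : R) :
  is_derive t 1 (flat j) (- j%:R * flat j.+1 t + flat j.+2 t).
Proof.
have [t0|t0|->] := ltgtP t 0.
- rewrite !flat_le0 ?ltW// mulr0 addr0.
  have N : \forall s \near t, (0 : R) = flat j s.
    near=> s; rewrite flat_le0//; apply: ltW; near: s; exact: lt_nbhsl.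
  by apply: (near_eq_is_derive N); exact: is_derive_cst.
- have N : \forall s \near t, s^-1 ^+ j * expR (- s^-1) = flat j s.
    near=> s; rewrite /flat ifT//; near: s; exact: lt_nbhsr.
  apply: (near_eq_is_derive N).
  rewrite /flat t0.
  have dV : is_derive t 1 (fun s : R => s^-1) (- t ^- 2).
    have := @is_deriveV R (@id R) t 1 1 (lt0r_neq0 t0) _.
    rewrite /GRing.scale /= mulr1; apply; exact: is_derive_id.
  have dX : is_derive t 1 (fun s : R => s^-1 ^+ j) (j%:R * t^-1 ^+ j.-1 * - t ^- 2).
    have -> : (fun s : R => s^-1 ^+ j) = (fun s : R => s^-1) ^+ j.
      by apply/funext => s; rewrite fctE.
    exact: (@is_deriveX _ _ (fun s : R => s^-1) j t 1 _ dV).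
  have dE : is_derive t 1 (fun s : R => expR (- s^-1)) (t ^- 2 * expR (- t^-1)).
    have dN : is_derive t 1 (fun s : R => - s^-1) (t ^- 2).
      by rewrite -[t ^- 2]opprK; exact: is_deriveN.
    have := @is_derive1_comp _ expR (fun s : R => - s^-1) t _ _ (is_derive_expR _) dN.
    by rewrite mulrC.
  have dM := is_deriveM dX dE.
  apply: (is_derive_eq dM); rewrite /GRing.scale /=.
  rewrite -!exprVn.
  by case: j {N dX dM} => [|j] /=; rewrite ?exprS; ring.
(* At the origin [flat_le] bounds the difference quotient by N^N |h| with N = j + 2, so the
   derivative is 0. *)
- rewrite !flat_le0// mulr0 addr0.
  have C : h^-1 *: ((flat j \o shift (0 : R)) (h *: (1 : R)) - flat j 0) @[h --> 0^'] --> (0 : R).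
    apply/cvgrPdist_le => e e0; near=> h.
    rewrite sub0r normrN /= addr0 (flat_le0 _ (lexx _)) subr0 /GRing.scale /= mulr1.
    have h0 : h != 0 by near: h; exact: nbhs_dnbhs_neq.
    rewrite normrM normfV ler_pdivrMl ?normr_gt0// ger0_norm ?flat_ge0//.
    apply: (le_trans (flat_le j h)).
    rewrite -real_normK ?num_real// expr2 mulrCA.
    apply: ler_wpM2l => //; rewrite mulrC -ler_pdivlMr ?exprn_gt0//.
    by near: h; apply: dnbhs0_le; rewrite divr_gt0// exprn_gt0.
  by apply: DeriveDef; [apply/cvg_ex; exists 0|exact: cvg_lim C].
Unshelve. all: by end_near. Qed.

Lemma continuous_flat j : continuous (flat j).
Proof.
move=> t; apply/differentiable_continuous/derivable1_diffP.
by have [] := is_derive_flat j t.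
Qed.

(** Differentiating [flat j] produces [flat j.+1] and [flat j.+2], so the induction on the order of
    smoothness must be uniform in j. *)
Lemma Ck_flat_comp n k j (q : 'rV[R]_n -> R) : (forall k, Ck k q) ->
  Ck k (flat j \o q).
Proof.
move=> Cq; elim: k j => [|k IH] j.
  by move=> x; apply: continuous_comp; [exact: (Cq 0)|exact: continuous_flat].
split=> [x|i].
  apply: differentiable_comp; first exact: (Cq 1).1.
  by apply/derivable1_diffP; have [] := is_derive_flat j (q x).
rewrite (_ : partial i _ =
  (((fun=> - j%:R) \* (flat j.+1 \o q)) \+ (flat j.+2 \o q)) \* partial i q).
  apply: CkM; last exact: (Cq k.+1).2.
  by apply: CkD => //; apply: CkM => //; exact: Ck_cst.
apply/funext => x.
by rewrite (@partial_comp _ _ _ _ _ _ _ (is_derive_flat j))//; exact: (Cq 1).1.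
Qed.

(** A product over coordinates instead of a radial function, because the norm on rows is the sup
    norm: for r > 0 it is positive exactly on the open ball of radius r about c. *)
Definition unit_bump n (c : 'rV[R]_n) (r : R) (x : 'rV[R]_n) : R :=
  \prod_i flat 0 (r ^+ 2 - (x ord0 i - c ord0 i) ^+ 2).

Lemma Ck_bump n k (c : 'rV[R]_n) r : Ck k (unit_bump c r).
Proof.
apply: Ck_prod => i; apply: (@Ck_flat_comp _ _ _
  (fun x => r ^+ 2 - (x ord0 i - c ord0 i) ^+ 2)) => {}k.
apply: (@CkB _ _ _ (fun=> r ^+ 2)); first exact: Ck_cst.
apply: (@CkX _ _ _ (fun x => x ord0 i - c ord0 i)).
by apply: (@CkB _ _ _ (fun x => x ord0 i)); [exact: Ck_coord|exact: Ck_cst].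
Qed.

Lemma bump_ge0 n (c : 'rV[R]_n) r x : 0 <= unit_bump c r x.
Proof. by apply: prodr_ge0 => i _; exact: flat_ge0. Qed.

Lemma bump_gt0 n (c : 'rV[R]_n) r x : `|x - c| < r -> 0 < unit_bump c r x.
Proof.
move=> xr; apply: prodr_gt0 => i _; apply: flat_gt0; rewrite subr_gt0.
have : `|x ord0 i - c ord0 i| < r.
  by apply: le_lt_trans xr; have := ler_rV_norm (x - c) i; rewrite !mxE.
rewrite -[_ ^+ 2]real_normK ?num_real// => h.
by rewrite ltr_pXn2r// nnegrE// (le_trans _ (ltW h)).
Qed.

Lemma bump_neq0 n (c : 'rV[R]_n) r x : 0 <= r -> unit_bump c r x != 0 ->
  `|x - c| <= r.
Proof.
move=> r0 /prodf_neq0 xr; apply: rV_norm_le => // i; rewrite !mxE.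
have := xr i isT; apply: contraNle => h; rewrite flat_le0// subr_le0.
rewrite -[leRHS]real_normK ?num_real//.
by rewrite ler_pXn2r ?nnegrE ?(ltW h)//.
Qed.

End unit_bump.

(** * Stability of test functions, and a cutoff for a compact subset of an open set *)

Section test_functions.
Context {R : realType} {n : nat}.
Implicit Types (Om : set 'rV[R]_n) (f g : 'rV[R]_n -> R).

Lemma tsupport_sub f C : closed C -> (forall x, f x != 0 -> C x) ->
  tsupport f `<=` C.
Proof.
move=> cC fC x tx; apply: cC => B /tx [y [fy By]].
by exists y; split => //; exact: fC.
Qed.

(** Spares the computation of supports: it suffices to enclose the nonzero set in some compact C
    inside Om, because the support is then a closed subset of C. *)
Lemma test_function_of Om f C : (forall k, Ck k f) -> compact C ->
  C `<=` Om -> (forall x, f x != 0 -> C x) -> test_function Om f.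
Proof.
move=> Cf cC CO fC.
have hC : closed C by apply: compact_closed => //; exact: norm_hausdorff.
have fC' := tsupport_sub hC fC.
split => //; last exact: subset_trans CO.
by apply: subclosed_compact cC fC'; exact: closed_closure.
Qed.

Lemma tsupport_neq0 f x : f x != 0 -> tsupport f x.
Proof. by move=> fx; apply: subset_closure. Qed.

Lemma test_function_out Om f x : test_function Om f -> ~ Om x -> f x = 0.
Proof.
move=> [_ _ fO] Ox; apply/eqP; apply: contra_notT Ox => fx.
by apply: fO; exact: tsupport_neq0.
Qed.

Lemma test_function0 Om : test_function Om (fun=> 0).
Proof.
apply: (@test_function_of _ _ set0) => //.
- by move=> k; exact: Ck_cst.
- exact: compact0.
- by move=> x; rewrite eqxx.
Qed.

Lemma test_functionD Om f g : test_function Om f -> test_function Om g ->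
  test_function Om (f \+ g).
Proof.
move=> [Cf cf fO] [Cg cg gO].
apply: (@test_function_of _ _ (tsupport f `|` tsupport g)).
- by move=> k; exact: CkD.
- exact: compactU.
- by move=> x [/fO|/gO].
- move=> x fg; have [fx|fx] := eqVneq (f x) 0; last by left; exact: tsupport_neq0.
  by right; apply: tsupport_neq0; move: fg; rewrite /= fx add0r.
Qed.

Lemma test_functionM Om f g : (forall k, Ck k f) -> test_function Om g ->
  test_function Om (f \* g).
Proof.
move=> Cf [Cg cg gO]; apply: (@test_function_of _ _ (tsupport g)) => //.
- by move=> k; exact: CkM.
- by move=> x; rewrite mulf_eq0 negb_or => /andP[_]; exact: tsupport_neq0.
Qed.

Lemma test_function_partial Om f i : test_function Om f ->
  test_function Om (partial i f).
Proof.
move=> [Cf cf fO]; apply: (@test_function_of _ _ (tsupport f)) => //.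
  by move=> k; exact: (Cf k.+1).2.
move=> x; apply: contra_neqP => fx.
rewrite /partial (@near_eq_derive _ _ _ f (cst 0)) ?derive_cst//.
have : \forall y \near x, ~ tsupport f y.
  have o : open (~` tsupport f) by apply: closed_openC; exact: closed_closure.
  by apply: open_nbhs_nbhs.
by apply: filterS => y; apply: contra_notP => /eqP; exact: tsupport_neq0.
Qed.

Lemma test_function_bounded_support Om f : test_function Om f ->
  exists M : R, forall x, M < `|x| -> f x = 0.
Proof.
move=> [_ /compact_bounded[M [_ fM]] _].
exists (M + 1) => x Mx; apply/eqP; apply/negPn/negP => fx.
have := fM (M + 1); rewrite ltrDl => /(_ ltr01 x (tsupport_neq0 fx)).
by rewrite /= leNgt Mx.
Qed.

Lemma test_function_bounded Om f : test_function Om f ->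
  exists2 B : R, 0 < B & forall x, `|f x| <= B.
Proof.
move=> tf; have [M fM] := test_function_bounded_support tf.
have [Cf _ _] := tf.
have [B [_ Bh]] : bounded_set (f @` [set x : 'rV[R]_n | `|x| <= M]).
  apply: compact_bounded; apply: continuous_compact; last exact: compact_norm_le.
  by apply: continuous_subspaceT; exact: (Cf 0).
exists (`|B| + 1) => [|x]; first by rewrite ltr_wpDl.
have [xM|xM] := leP `|x| M; last by rewrite fM// normr0 addr_ge0.
apply: (Bh (`|B| + 1)); last by exists x.
by apply: le_lt_trans (ler_norm B) _; rewrite ltrDl.
Qed.

Lemma test_function_measurable Om f : test_function Om f ->
  measurable_fun setT f.
Proof. by move=> [Cf _ _]; apply: continuous_measurable_rV; exact: (Cf 0). Qed.

Lemma test_function_integrable Om f : test_function Om f ->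
  (lebesgue_rV R n).-integrable setT (EFin \o f).
Proof.
move=> tf; have [M fM] := test_function_bounded_support tf.
by apply: integrable_bounded_support fM; have [Cf _ _] := tf; exact: (Cf 0).
Qed.

Lemma test_function_integral_partial Om f i : test_function Om f ->
  (\int[lebesgue_rV R n]_x (partial i f x)%:E = 0)%E.
Proof.
move=> tf; have [M fM] := test_function_bounded_support tf.
have [Cf _ _] := tf; apply: integral_partial0 fM.
  by move=> x; apply: diff_derivable; exact: (Cf 1).1.
exact: ((Cf 1).2 i).
Qed.

Lemma compact_ball_norm (c : 'rV[R]_n) (r : R) :
  compact [set y : 'rV[R]_n | `|y - c| <= r].
Proof.
apply: bounded_closed_compact.
  exists (`|c| + r); split; first exact: num_real.
  move=> M cM x /= xc; rewrite -[x](subrK c).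
  apply: le_trans (ler_normD _ _) _.
  by rewrite addrC ltW// (le_lt_trans _ cM)// lerD2l.
rewrite (_ : mkset _ = (fun y : 'rV[R]_n => `|y - c|) @^-1` [set t | t <= r])//.
have cd : continuous (fun y : 'rV[R]_n => `|y - c|).
  move=> y; apply: (@continuous_comp _ _ _ (fun y : 'rV[R]_n => y - c)
    (fun z : 'rV[R]_n => `|z|)); last exact: norm_continuous.
  apply: continuous_rV => i; under eq_fun do rewrite !mxE.
  by apply: (@Ck_continuous _ _ 0); apply: CkB; [exact: Ck_coord|exact: Ck_cst].
by apply: preimage_closed; [move=> y _; exact: cd|exact: closed_le].
Qed.

(** A finite sum of bumps over a cover of K by balls whose closures stay in U, divided by its bound.
    A positive lower bound on K can replace the value 1, since a power of d is later absorbed in the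
    constant; it comes from the minimum over the compact K. *)
Lemma exists_cutoff (K U : set 'rV[R]_n) : compact K -> open U -> K `<=` U ->
  exists2 th, test_function U th &
    (forall x, 0 <= th x <= 1) /\
    exists2 d : R, 0 < d & forall x, K x -> d <= th x.
Proof.
move=> cK oU KU.
(* A radius is attached to every point, with the dummy value 1 outside U, so that r becomes a total
   function. *)
have rP x : exists r : R, 0 < r /\ (U x -> forall y, `|y - x| <= r -> U y).
  have [Ux|Ux] := pselect (U x); last by exists 1.
  have /nbhs_ballP[e /= e0 eU] := open_nbhs_nbhs (conj oU Ux).
  exists (e / 2); split; first by rewrite divr_gt0.
  move=> _ y yx; apply: eU; rewrite mx_norm_ball /ball_ /= distrC.
  by apply: le_lt_trans yx _; rewrite ltr_pdivrMr// ltr_pMr// ltr1n.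
pose r x := projT1 (cid (rP x)).
have r0 x : 0 < r x by exact: (projT2 (cid (rP x))).1.
have rU x : U x -> forall y, `|y - x| <= r x -> U y.
  exact: (projT2 (cid (rP x))).2.
move: (cK); rewrite compact_cover => /(_ _ K (fun x => [set y | `|y - x| < r x])).
case=> [x Kx|x Kx|D DK KD].
- rewrite (_ : mkset _ = ball x (r x)); first exact: ball_open.
  by rewrite mx_norm_ball; apply/seteqP; split => y; rewrite /ball_ /= distrC.
- by exists x => //=; rewrite subrr normr0.
pose g x := \sum_(c <- finmap.enum_fset D) unit_bump c (r c) x.
have gT : test_function U g.
  have DU c : c \in finmap.enum_fset D -> U c.
    by move=> cD; apply: KU; apply: set_mem; exact: DK.
  rewrite /g; elim: (finmap.enum_fset D) DU => [_|c s IH sU].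
    by under eq_fun do rewrite big_nil; exact: test_function0.
  under eq_fun do rewrite big_cons; apply: test_functionD; last first.
    by apply: IH => c' c's; apply: sU; rewrite inE c's orbT.
  apply: (@test_function_of _ _ [set y | `|y - c| <= r c]).
  - by move=> k; exact: Ck_bump.
  - exact: compact_ball_norm.
  - by apply: rU; apply: sU; rewrite inE eqxx.
  - by move=> x; apply: bump_neq0; exact: ltW.
have g0 x : 0 <= g x by apply: sumr_ge0 => c _; exact: bump_ge0.
have gK x : K x -> 0 < g x.
  move=> /KD [c /= cD xc].
  have cs : c \in finmap.enum_fset D by [].
  rewrite /g (big_rem _ cs) /= ltr_pwDl ?bump_gt0//.
  by apply: sumr_ge0 => a _; exact: bump_ge0.
have [B B0 gB] := test_function_bounded gT.
have [d d0 dK] : exists2 d : R, 0 < d & forall x, K x -> d <= g x.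
  (* An empty K has no minimum point; any positive d serves. *)
  have [K0|/set0P[x0 Kx0]] := eqVneq K set0.
    by exists 1 => // x; rewrite K0.
  have [||c cK' cmin] := @EVT_min_rV _ _ g K _ cK; first by exists x0.
    by apply: continuous_subspaceT; have [Cg _ _] := gT; exact: (Cg 0).
  exists (g c); first by apply: gK; exact: set_mem.
  by move=> x Kx; apply: cmin; exact: mem_set.
exists ((fun=> B^-1) \* g).
  by apply: test_functionM => // k; exact: Ck_cst.
split=> [x|].
  rewrite mulr_ge0 ?invr_ge0 ?(ltW B0)//= ler_pdivrMl// mulr1.
  by apply: le_trans (ler_norm _) (gB x).
exists (B^-1 * d); first by rewrite mulr_gt0// invr_gt0.
by move=> x Kx; rewrite ler_wpM2l ?invr_ge0 ?(ltW B0)// dK.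
Qed.

End test_functions.

(** * L^p functions and the Euclidean norm *)

Lemma conjugate_exponent_gt1 {R : realType} (p : R) : 1 < p -> 1 < p / (p - 1).
Proof. by move=> p1; rewrite ltr_pdivlMr ?subr_gt0// mul1r ltrBlDr ltrDl. Qed.

Lemma conjugate_exponentE {R : realType} (p : R) : 1 < p ->
  p^-1 + (p / (p - 1))^-1 = 1.
Proof.
move=> p1; have p0 : 0 < p by exact: lt_trans p1.
by rewrite invf_div -[X in X + _]mul1r -mulrDl subrKC divff// gt_eqF.
Qed.

Section powR_inequalities.
Context {R : realType}.
Implicit Types a b p q : R.

(** From |a + b| <= 2 max(|a|, |b|). The factor 2^p is not sharp, but it serves every p >= 0 and
    replaces the Minkowski inequality throughout. *)
Lemma powR_normD p a b : 0 <= p ->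
  `|a + b| `^ p <= 2 `^ p * (`|a| `^ p + `|b| `^ p).
Proof.
move=> p0.
have key u v : `|u| <= `|v| -> `|u + v| `^ p <= 2 `^ p * (`|u| `^ p + `|v| `^ p).
  move=> uv; apply: (@le_trans _ _ ((2 * `|v|) `^ p)).
    apply: ge0_ler_powR => //; rewrite ?nnegrE ?mulr_ge0//.
    by apply: le_trans (ler_normD _ _) _; rewrite mulr2n mulrDl mul1r lerD2r.
  by rewrite powRM// ler_wpM2l ?powR_ge0// lerDr powR_ge0.
have [ab|/ltW ba] := leP `|a| `|b|; first exact: key.
by rewrite addrC [X in _ * X]addrC; exact: key.
Qed.

(** Young's inequality for s |a| and |b| / s with s^q = t; the weights 1/p and 1/q are at most 1 and
    are dropped, which gives C = s^(-p). *)
Lemma young_eps p q (t : R) : 0 < p -> 0 < q -> p^-1 + q^-1 = 1 -> 0 < t ->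
  exists2 C : R, 0 < C & forall a b, `|a * b| <= t * `|a| `^ q + C * `|b| `^ p.
Proof.
move=> p0 q0 pq t0; pose s := t `^ q^-1.
have s0 : 0 < s by rewrite powR_gt0.
have sq : s `^ q = t by rewrite -powRrM mulVf ?gt_eqF// powRr1// ltW.
exists (s^-1 `^ p) => [|a b]; first by rewrite powR_gt0// invr_gt0.
have p1 : p^-1 <= 1 by rewrite -pq lerDl invr_ge0 ltW.
have q1 : q^-1 <= 1 by rewrite -pq lerDr invr_ge0 ltW.
have := @conjugate_powR R (s^-1 * `|b|) (s * `|a|) p q.
rewrite !mulr_ge0 ?invr_ge0 ?(ltW s0)// => /(_ isT isT p0 q0 pq).
rewrite !powRM ?invr_ge0 ?(ltW s0)// sq mulrACA mulVf ?gt_eqF// mul1r.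
rewrite normrM mulrC => h; apply: le_trans h _; rewrite addrC.
by apply: lerD; rewrite ler_piMr// mulr_ge0 ?powR_ge0// ltW.
Qed.

Lemma powR_sum_le n p (F : 'I_n -> R) : 0 < p -> (forall i, 0 <= F i) ->
  (\sum_i F i) `^ p <= n%:R `^ p * \sum_i F i `^ p.
Proof.
move=> p0; case: n F => [|n] F F0.
  by rewrite !big_ord0 mulr0 powR0// gt_eqF.
have [i0 _ iM] := @arg_maxP _ _ _ ord0 xpredT F isT.
apply: (@le_trans _ _ ((n.+1%:R * F i0) `^ p)).
  apply: ge0_ler_powR; rewrite ?nnegrE ?mulr_ge0 ?sumr_ge0 ?(ltW p0)//.
  apply: (@le_trans _ _ (\sum_(i < n.+1) F i0)); first exact: ler_sum.
  by rewrite sumr_const card_ord mulr_natl.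
rewrite powRM// ler_wpM2l ?powR_ge0// (bigD1 i0)//= lerDl.
by apply: sumr_ge0 => i _; exact: powR_ge0.
Qed.

End powR_inequalities.

Section euclidean_norm.
Context {R : realType} {n : nat}.
Implicit Types x y : 'rV[R]_n.

Lemma dot_ge0 x : 0 <= dot x x.
Proof. by apply: sumr_ge0 => i _; rewrite -expr2 sqr_ge0. Qed.

Lemma enorm_ge0 x : 0 <= enorm x.
Proof. exact: sqrtr_ge0. Qed.

Lemma enorm_sqr x : enorm x ^+ 2 = dot x x.
Proof. by rewrite sqr_sqrtr// dot_ge0. Qed.

Lemma coord_le_enorm x i : `|x ord0 i| <= enorm x.
Proof.
rewrite -(@ler_pXn2r _ 2) ?nnegrE ?enorm_ge0// enorm_sqr real_normK ?num_real//.
rewrite /dot (bigD1 i)//= -expr2 lerDl.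
by apply: sumr_ge0 => j _; rewrite -expr2 sqr_ge0.
Qed.

Lemma enorm_le_sum x : enorm x <= \sum_i `|x ord0 i|.
Proof.
have s0 : 0 <= \sum_i `|x ord0 i| by exact: sumr_ge0.
rewrite -(@ler_pXn2r _ 2) ?nnegrE ?enorm_ge0// enorm_sqr /dot.
rewrite expr2 mulr_suml; apply: ler_sum => i _.
rewrite -expr2 -[x ord0 i ^+ 2]real_normK ?num_real// expr2 ler_wpM2l//.
by rewrite (bigD1 i)//= lerDl sumr_ge0.
Qed.

Lemma dot_le x y : `|dot x y| <= enorm x * \sum_i `|y ord0 i|.
Proof.
rewrite /dot; apply: le_trans (ler_norm_sum _ _ _) _.
rewrite mulr_sumr; apply: ler_sum => i _; rewrite normrM ler_wpM2r//.
exact: coord_le_enorm.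
Qed.

Lemma enorm0 : enorm (0 : 'rV[R]_n) = 0.
Proof.
by rewrite /enorm /dot big1 ?sqrtr0// => i _; rewrite mxE mul0r.
Qed.

Lemma enorm_eq0 x : enorm x = 0 -> x = 0.
Proof.
move=> x0; apply/rowP => i; rewrite mxE; apply/normr0_eq0/eqP.
by rewrite eq_le normr_ge0 andbT -x0 coord_le_enorm.
Qed.

Lemma enormN x : enorm (- x) = enorm x.
Proof.
rewrite /enorm /dot; congr Num.sqrt; apply: eq_bigr => i _.
by rewrite !mxE mulrNN.
Qed.

Lemma dotBl x y z : dot (x - y) z = dot x z - dot y z.
Proof. by rewrite /dot -sumrB; apply: eq_bigr => i _; rewrite !mxE mulrBl. Qed.

Lemma dotDr x y z : dot x (y + z) = dot x y + dot x z.
Proof. by rewrite /dot -big_split; apply: eq_bigr => i _; rewrite !mxE mulrDr. Qed.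

Lemma dotZr (t : R) x y : dot x (t *: y) = t * dot x y.
Proof. by rewrite /dot mulr_sumr; apply: eq_bigr => i _; rewrite !mxE mulrCA. Qed.

End euclidean_norm.

Section enorm_triangle.
Context {R : realType} {n : nat}.

Lemma dot_cauchy (x y : 'rV[R]_n) : `|dot x y| <= enorm x * enorm y.
Proof.
have [x0|x0] := eqVneq (enorm x) 0.
  by rewrite (enorm_eq0 x0) /dot big1 ?normr0 ?mulr_ge0 ?enorm_ge0// => i _;
    rewrite mxE mul0r.
have xp : 0 < enorm x by rewrite lt0r x0 enorm_ge0.
rewrite -(@ler_pXn2r _ 2) ?nnegrE ?mulr_ge0 ?enorm_ge0//.
rewrite real_normK ?num_real// exprMn !enorm_sqr.
(* This vector is |x|^2 times the component of y orthogonal to x; its squared length is |x|^2 times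
   the difference to be shown nonnegative. *)
have := dot_ge0 (dot x x *: y - dot x y *: x).
have -> : dot (dot x x *: y - dot x y *: x) (dot x x *: y - dot x y *: x) =
   dot x x * (dot x x * dot y y - dot x y ^+ 2).
  set A := dot x x; set B := dot x y.
  transitivity (\sum_i (A ^+ 2 * (y ord0 i * y ord0 i) -
     2 * A * B * (x ord0 i * y ord0 i) + B ^+ 2 * (x ord0 i * x ord0 i))).
    by apply: eq_bigr => i _; rewrite !mxE; ring.
  rewrite big_split sumrB /= -!mulr_sumr -/(dot y y) -/(dot x y) -/(dot x x).
  by rewrite -/A -/B; ring.
by rewrite pmulr_rge0 ?subr_ge0// -enorm_sqr exprn_gt0.
Qed.

Lemma enorm_triangle (x y : 'rV[R]_n) : enorm (x + y) <= enorm x + enorm y.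
Proof.
rewrite -(@ler_pXn2r _ 2) ?nnegrE ?addr_ge0 ?enorm_ge0// sqrrD !enorm_sqr.
have -> : dot (x + y) (x + y) = dot x x + dot x y *+ 2 + dot y y.
  by rewrite /dot -sumrMnl -!big_split; apply: eq_bigr => i _ /=; rewrite !mxE; ring.
rewrite lerD2r lerD2l lerMn2r /=.
by apply: le_trans (ler_norm _) (dot_cauchy x y).
Qed.

End enorm_triangle.

Section Lp_functions.
Context d (T : measurableType d) {R : realType}.
Variables (mu : {measure set T -> \bar R}) (D : set T).
Hypothesis mD : measurable D.
Implicit Types f g a b : T -> R.

Definition integ f : Prop := mu.-integrable D (EFin \o f).

Lemma integ_measurable f : integ f -> measurable_fun D f.
Proof. by move=> /integrableP[/measurable_EFinP]. Qed.

Lemma integD f g : integ f -> integ g -> integ (fun x => f x + g x).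
Proof. by move=> fi gi; exact: (integrableD mD fi gi). Qed.

Lemma integB f g : integ f -> integ g -> integ (fun x => f x - g x).
Proof. by move=> fi gi; exact: (integrableB mD fi gi). Qed.

Lemma integZ (c : R) f : integ f -> integ (fun x => c * f x).
Proof. by move=> fi; exact: (integrableZl mD c fi). Qed.

Lemma integ0 : integ (fun=> 0).
Proof. exact: integrable0. Qed.

Lemma integ_sum (I : Type) (s : seq I) (F : I -> T -> R) :
  (forall i, integ (F i)) -> integ (fun x => \sum_(i <- s) F i x).
Proof.
move=> Fi; elim: s => [|i s IH].
  by rewrite /integ; under eq_fun do rewrite big_nil; exact: integ0.
by rewrite /integ; under eq_fun do rewrite big_cons; exact: integD.
Qed.

Lemma integ_le f g : measurable_fun D f -> (forall x, D x -> `|f x| <= g x) ->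
  integ g -> integ f.
Proof.
move=> mf fg gi; apply: (le_integrable mD _ _ gi).
  exact/measurable_EFinP.
move=> x Dx; rewrite /= lee_fin; apply: le_trans (fg x Dx) (ler_norm _).
Qed.

Lemma Rint_ge0 f : (forall x, D x -> 0 <= f x) -> 0 <= \int[mu]_(x in D) f x.
Proof. exact: Rintegral_ge0. Qed.

Lemma le_Rint f g : integ f -> integ g -> (forall x, D x -> f x <= g x) ->
  \int[mu]_(x in D) f x <= \int[mu]_(x in D) g x.
Proof. exact: le_Rintegral. Qed.

Lemma RintD f g : integ f -> integ g ->
  \int[mu]_(x in D) (f x + g x) =
  \int[mu]_(x in D) f x + \int[mu]_(x in D) g x.
Proof. exact: RintegralD. Qed.

Lemma RintB f g : integ f -> integ g ->
  \int[mu]_(x in D) (f x - g x) =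
  \int[mu]_(x in D) f x - \int[mu]_(x in D) g x.
Proof. exact: RintegralB. Qed.

Lemma RintZ (c : R) f : integ f ->
  \int[mu]_(x in D) (c * f x) = c * \int[mu]_(x in D) f x.
Proof. by move=> fi; rewrite RintegralZl. Qed.

Lemma Rint_zero : \int[mu]_(x in D) (0 : R) = 0.
Proof. by rewrite /Rintegral integral0. Qed.

Lemma Rint_sum (I : Type) (s : seq I) (F : I -> T -> R) :
  (forall i, integ (F i)) ->
  \int[mu]_(x in D) (\sum_(i <- s) F i x) =
  \sum_(i <- s) \int[mu]_(x in D) F i x.
Proof.
move=> Fi; elim: s => [|i s IH].
  by rewrite big_nil; under eq_Rintegral do rewrite big_nil; exact: Rint_zero.
rewrite big_cons -IH -RintD//; last exact: integ_sum.
by apply: eq_Rintegral => x _; rewrite big_cons.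
Qed.

Lemma norm_Rint_le f : integ f ->
  `|\int[mu]_(x in D) f x| <= \int[mu]_(x in D) `|f x|.
Proof. by move=> fi; exact: le_normr_Rintegral. Qed.

Lemma Rint_EFin f : integ f ->
  (\int[mu]_(x in D) (f x)%:E)%E = (\int[mu]_(x in D) f x)%:E.
Proof. by move=> fi; rewrite /Rintegral fineK//; exact: integrable_fin_num. Qed.

Lemma measurable_fun_pow (p : R) f : measurable_fun D f ->
  measurable_fun D (fun x => `|f x| `^ p).
Proof.
move=> mf; apply: (measurableT_comp (measurable_powR p)).
exact: measurableT_comp.
Qed.

(** Membership in L^p stated on the integral of |f|^p, without the extended-real norm, so that the
    real-valued integral of |f|^p is meaningful wherever it is used. *)
Definition pLp (p : R) f : Prop :=
  measurable_fun D f /\ integ (fun x => `|f x| `^ p).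

Lemma pLp_le (p : R) f g : 0 <= p -> measurable_fun D f ->
  (forall x, D x -> `|f x| <= `|g x|) -> pLp p g -> pLp p f.
Proof.
move=> p0 mf fg [mg gi]; split => //; apply: integ_le gi.
  exact: measurable_fun_pow.
move=> x Dx; rewrite ger0_norm ?powR_ge0//.
by apply: ge0_ler_powR; rewrite ?nnegrE// fg.
Qed.

Lemma pLp_of_integ (p : R) f g : measurable_fun D f ->
  (forall x, D x -> `|f x| `^ p <= g x) -> integ g -> pLp p f.
Proof.
move=> mf fg gi; split => //; apply: integ_le gi; first exact: measurable_fun_pow.
by move=> x Dx; rewrite ger0_norm ?powR_ge0// fg.
Qed.

Lemma pLpD (p : R) f g : 0 <= p -> pLp p f -> pLp p g ->
  pLp p (fun x => f x + g x).
Proof.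
move=> p0 [mf fi] [mg gi].
apply: (@pLp_of_integ _ _ (fun x => 2 `^ p * (`|f x| `^ p + `|g x| `^ p))).
- exact: measurable_funD.
- by move=> x _; exact: powR_normD.
- by apply: integZ; exact: integD.
Qed.

Lemma pLpN (p : R) f : pLp p f -> pLp p (fun x => - f x).
Proof.
move=> [mf fi]; split; first exact: measurable_funN.
by rewrite /integ; under eq_fun do rewrite normrN.
Qed.

Lemma pLpB (p : R) f g : 0 <= p -> pLp p f -> pLp p g ->
  pLp p (fun x => f x - g x).
Proof. by move=> p0 fp gp; apply: pLpD => //; exact: pLpN. Qed.

Lemma pLpM (p B : R) b f : 0 <= p -> measurable_fun D b ->
  (forall x, D x -> `|b x| <= B) -> pLp p f -> pLp p (fun x => b x * f x).
Proof.
move=> p0 mb bB [mf fi].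
apply: (@pLp_of_integ _ _ (fun x => `|B| `^ p * `|f x| `^ p)).
- exact: measurable_funM.
- move=> x Dx; rewrite normrM -powRM//.
  apply: ge0_ler_powR; rewrite ?nnegrE ?mulr_ge0// ler_wpM2r//.
  by apply: le_trans (bB x Dx) (ler_norm _).
- exact: integZ.
Qed.

Lemma pLp_sum (p : R) (I : Type) (s : seq I) (F : I -> T -> R) : 0 < p ->
  (forall i, pLp p (F i)) -> pLp p (fun x => \sum_(i <- s) F i x).
Proof.
move=> p0 Fi; elim: s => [|i s IH].
  under eq_fun do rewrite big_nil; split => //.
  rewrite /integ; under eq_fun do rewrite normr0 powR0 ?gt_eqF//.
  exact: integ0.
by under eq_fun do rewrite big_cons; apply: pLpD => //; exact: ltW.
Qed.

Lemma le_ipowD (p : R) f g : 0 <= p -> pLp p f -> pLp p g ->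
  \int[mu]_(x in D) (`|f x + g x| `^ p) <=
  2 `^ p * (\int[mu]_(x in D) (`|f x| `^ p) + \int[mu]_(x in D) (`|g x| `^ p)).
Proof.
move=> p0 fp gp; rewrite -RintD; [|exact: fp.2|exact: gp.2].
rewrite -RintZ; last by apply: integD; [exact: fp.2|exact: gp.2].
apply: le_Rint; first exact: (pLpD p0 fp gp).2.
  by apply: integZ; apply: integD; [exact: fp.2|exact: gp.2].
by move=> x _; exact: powR_normD.
Qed.

Section conjugate.
Variables p q : R.
Hypotheses (p0 : 0 < p) (q0 : 0 < q) (pq : p^-1 + q^-1 = 1).

Lemma integM a b : pLp q a -> pLp p b -> integ (fun x => a x * b x).
Proof.
move=> [ma ia] [mb ib]; have [C C0 Ch] := young_eps p0 q0 pq ltr01.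
apply: (@integ_le _ (fun x => 1 * `|a x| `^ q + C * `|b x| `^ p)).
- exact: measurable_funM.
- by move=> x _; exact: Ch.
- by apply: integD; exact: integZ.
Qed.

(** Continuity at 0 of the pairing with a fixed a in L^q, in the form that density arguments
    consume. The weighted Young inequality replaces Hoelder's. *)
Lemma prod_small a (e : R) : pLp q a -> 0 < e ->
  exists2 dl : R, 0 < dl & forall b, pLp p b ->
    \int[mu]_(x in D) (`|b x| `^ p) <= dl -> `|\int[mu]_(x in D) (a x * b x)| <= e.
Proof.
move=> ap e0; have [ma ia] := ap.
set A := \int[mu]_(x in D) (`|a x| `^ q).
have A0 : 0 <= A by apply: Rint_ge0 => x _; exact: powR_ge0.
(* With this weight the term in |a|^q costs at most e/2; the + 1 guards against A = 0. The other e/2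
   is left to b. *)
have t0 : 0 < e / 2 / (A + 1) by rewrite !divr_gt0// ltr_wpDl.
have [C C0 Ch] := young_eps p0 q0 pq t0.
exists (e / 2 / C); first by rewrite !divr_gt0.
move=> b bp; have [mb ib] := bp => bd.
have iab := integM ap bp.
apply: le_trans (norm_Rint_le iab) _.
apply: (@le_trans _ _ (\int[mu]_(x in D)
   (e / 2 / (A + 1) * `|a x| `^ q + C * `|b x| `^ p))).
  apply: le_Rint => //; last by apply: integD; exact: integZ.
  by rewrite /integ; exact: (integrable_abse iab).
rewrite RintD ?RintZ//; [|exact: integZ|exact: integZ].
rewrite -/A [leRHS]splitr; apply: lerD.
  by rewrite mulrAC ler_pdivrMr ?ltr_wpDl// ler_wpM2l ?divr_ge0 ?(ltW e0)// lerDl.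
by rewrite mulrC -ler_pdivlMr.
Qed.

End conjugate.

End Lp_functions.

(** * Sobolev functions as limits of smooth functions *)

Section power_derivative.
Context {R : realType}.
Variable p : R.
Hypothesis p1 : 1 < p.

Definition dpow (t : R) : R := p * Num.sg t * `|t| `^ (p - 1).

Let p0 : 0 < p. Proof. exact: lt_trans p1. Qed.
Let pm0 : 0 < p - 1. Proof. by rewrite subr_gt0. Qed.

Lemma norm_dpow_le t : `|dpow t| <= p * `|t| `^ (p - 1).
Proof.
rewrite /dpow normrM normrM (gtr0_norm p0) [X in _ * X]ger0_norm ?powR_ge0//.
rewrite ler_wpM2r ?powR_ge0// ler_piMr ?(ltW p0)//.
by rewrite normr_sg; case: eqP.
Qed.

Lemma near0_powR_le (r e : R) : 0 < r -> 0 < e ->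
  \forall t \near (0 : R), `|t| `^ r <= e.
Proof.
move=> r0 e0; have d0 : 0 < e `^ r^-1 by rewrite powR_gt0.
have : \forall t \near (0 : R), `|t| <= e `^ r^-1.
  exists (e `^ r^-1) => //= t; rewrite /ball_ /= sub0r normrN; exact: ltW.
apply: filterS => t td.
apply: (@le_trans _ _ ((e `^ r^-1) `^ r)).
  by apply: ge0_ler_powR; rewrite ?nnegrE ?powR_ge0 ?(ltW r0).
by rewrite -powRrM mulVf ?gt_eqF// powRr1// ltW.
Qed.

Lemma is_derive_norm_powR (t : R) : is_derive t 1 (fun s : R => `|s| `^ p) (dpow t).
Proof.
have [t0|t0|->] := ltgtP t 0.
- have N : \forall s \near t, (- s) `^ p = `|s| `^ p.
    near=> s; rewrite ltr0_norm//; near: s; exact: lt_nbhsl.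
  apply: (near_eq_is_derive N).
  have dN : is_derive t 1 (fun s : R => - s) (-1).
    by apply: is_deriveN; exact: is_derive_id.
  have nt0 : 0 < - t by rewrite oppr_gt0.
  have d := @is_derive1_comp R _ (fun s : R => - s) t _ _ (is_derive1_powR p nt0) dN.
  apply: (is_derive_eq d).
  by rewrite /dpow ltr0_sg// ltr0_norm// mulrN1 mulrN mulr1 mulNr.
- have N : \forall s \near t, s `^ p = `|s| `^ p.
    near=> s; rewrite gtr0_norm//; near: s; exact: lt_nbhsr.
  apply: (near_eq_is_derive N); apply: (is_derive_eq (is_derive1_powR p t0)).
  by rewrite /dpow gtr0_sg// gtr0_norm// mulr1.
(* At 0 the difference quotient has absolute value |h|^(p-1), which tends to 0 because p > 1. *)
- have C : h^-1 *: (((fun s : R => `|s| `^ p) \o shift (0 : R)) (h *: (1 : R)) - `|0 : R| `^ p)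
      @[h --> 0^'] --> (0 : R).
    apply/cvgrPdist_le => e e0; near=> h.
    have h0 : h != 0 by near: h; exact: nbhs_dnbhs_neq.
    rewrite sub0r normrN /= addr0 normr0 powR0 ?gt_eqF// subr0.
    rewrite /GRing.scale /= mulr1 normrM normfV ger0_norm ?powR_ge0//.
    rewrite -(mulr_powRB1 (normr_ge0 h) p0) mulKf ?normr_eq0//.
    near: h; apply: cvg_within; exact: near0_powR_le.
  rewrite /dpow sgr0 mulr0 mul0r.
  by apply: DeriveDef; [apply/cvg_ex; exists 0|exact: cvg_lim C].
Unshelve. all: by end_near. Qed.

Lemma continuous_dpow : continuous dpow.
Proof.
have dc (r t : R) : 0 < t -> {for t, continuous (fun s => s `^ r)}.
  move=> t0; apply/differentiable_continuous/derivable1_diffP.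
  by have [] := is_derive1_powR r t0.
move=> t; have [t0|t0|->] := ltgtP t 0.
- have N : \forall s \near t, - p * (- s) `^ (p - 1) = dpow s.
    near=> s; have s0 : s < 0 by near: s; exact: lt_nbhsl.
    by rewrite /dpow ltr0_sg// ltr0_norm// mulrN1.
  rewrite /continuous_at -(nbhs_singleton N).
  apply: cvg_trans (near_eq_cvg N) _ => /=.
  apply: cvgMr; apply: (@continuous_comp _ _ _ (fun s : R => - s) (fun s => s `^ (p - 1))).
    exact: oppr_continuous.
  by apply: dc; rewrite oppr_gt0.
- have N : \forall s \near t, p * s `^ (p - 1) = dpow s.
    near=> s; have s0 : 0 < s by near: s; exact: lt_nbhsr.
    by rewrite /dpow gtr0_sg// gtr0_norm// mulr1.
  rewrite /continuous_at -(nbhs_singleton N).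
  apply: cvg_trans (near_eq_cvg N) _ => /=.
  by apply: cvgMr; exact: dc.
- rewrite /continuous_at {2}/dpow sgr0 mulr0 mul0r.
  apply/cvgrPdist_le => e e0; near=> s.
  rewrite sub0r normrN; apply: le_trans (norm_dpow_le s) _.
  rewrite mulrC -ler_pdivlMr//.
  by near: s; apply: near0_powR_le; rewrite ?divr_gt0.
Unshelve. all: by end_near. Qed.

End power_derivative.

Section sobolev_approximation.
Context {R : realType} {n : nat}.
Local Notation leb := (lebesgue_rV R n).
Implicit Types (Om : set 'rV[R]_n) (u : 'rV[R]_n -> R) (Du : 'rV[R]_n -> 'rV[R]_n).

Section one_set.
Variables (Om : set 'rV[R]_n) (p : R).
Hypotheses (mO : measurable Om) (p1 : 1 < p).

Let p0 : 0 < p. Proof. exact: lt_trans p1. Qed.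

Lemma Lp_norm_pow u : (Lp_norm Om p u `^ p = \int[leb]_(x in Om) (`|u x| `^ p)%:E)%E.
Proof.
rewrite /Lp_norm powR_Lnorm; last by rewrite gt_eqF.
rewrite [RHS](integral_mkcond Om (fun x => (`|u x| `^ p)%:E)).
apply: eq_integral => x _; rewrite /= !patchE.
by case: ifPn => // _; rewrite normr0 powR0 ?gt_eqF.
Qed.

Lemma Lp_norm_ge0 u : (0 <= Lp_norm Om p u)%E.
Proof. exact: Lnorm_ge0. Qed.

Lemma in_LpP u : in_Lp Om p u <-> pLp leb Om p u.
Proof.
split=> -[mu uoo]; split => //.
  apply/integrableP; split.
    exact/measurable_EFinP/measurable_fun_pow.
  under eq_integral do rewrite gee0_abs ?lee_fin ?powR_ge0//.
  by rewrite -Lp_norm_pow; exact: poweR_lty.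
move/integrableP: uoo => [_].
under eq_integral do rewrite gee0_abs ?lee_fin ?powR_ge0//.
by rewrite -Lp_norm_pow; apply: lty_poweRy; rewrite gt_eqF.
Qed.

Lemma Lp_norm_powE u : pLp leb Om p u ->
  (Lp_norm Om p u `^ p = (\int[leb]_(x in Om) (`|u x| `^ p))%R%:E)%E.
Proof. by move=> [_ ui]; rewrite Lp_norm_pow Rint_EFin. Qed.

Lemma ipow_le_of_norm u (e : R) : 0 <= e -> pLp leb Om p u ->
  (Lp_norm Om p u <= e%:E)%E -> \int[leb]_(x in Om) (`|u x| `^ p) <= e `^ p.
Proof.
move=> e0 up ue; rewrite -lee_fin -Lp_norm_powE// -poweR_EFin.
by apply: gt0_ler_poweR; rewrite ?(ltW p0)// in_itv /= leey andbT ?Lp_norm_ge0// lee_fin.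
Qed.

Lemma norm_le_of_ipow u (e : R) : 0 <= e -> pLp leb Om p u ->
  \int[leb]_(x in Om) (`|u x| `^ p) <= e `^ p -> (Lp_norm Om p u <= e%:E)%E.
Proof.
move=> e0 up; rewrite -lee_fin -Lp_norm_powE// -poweR_EFin => h.
have K x : (0 <= x -> (x `^ p) `^ p^-1 = x)%E.
  by move=> x0; rewrite -poweRrM mulfV ?gt_eqF// poweRe1.
rewrite -(K _ (Lp_norm_ge0 u)) -(K e%:E) ?lee_fin//.
apply: gt0_ler_poweR; [by rewrite invr_ge0 ltW| | |exact: h].
  by rewrite in_itv /=; apply/andP; split; [exact: poweR_ge0|exact: leey].
by rewrite in_itv /=; apply/andP; split; [exact: (poweR_ge0 e%:E)|exact: leey].
Qed.

(** Smallness of the p-th power of the norm: a sum costs the factor 2^p and a bounded multiplier the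
    factor B^p, and no root has to be taken. *)
Definition Lsmall (e : R) u : Prop :=
  pLp leb Om p u /\ \int[leb]_(x in Om) (`|u x| `^ p) <= e.

Lemma LsmallD (e e' : R) u v : Lsmall e u -> Lsmall e' v ->
  Lsmall (2 `^ p * (e + e')) (fun x => u x + v x).
Proof.
move=> [up ue] [vp ve]; split; first exact: pLpD (ltW p0) up vp.
apply: le_trans (le_ipowD mO (ltW p0) up vp) _.
by rewrite ler_wpM2l ?powR_ge0// lerD.
Qed.

Lemma LsmallN (e : R) u : Lsmall e u -> Lsmall e (fun x => - u x).
Proof.
move=> [up ue]; split; first exact: pLpN.
by under eq_Rintegral do rewrite normrN.
Qed.

Lemma LsmallB (e e' : R) u v : Lsmall e u -> Lsmall e' v ->
  Lsmall (2 `^ p * (e + e')) (fun x => u x - v x).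
Proof.
by move=> us vs; exact: (@LsmallD _ _ u (fun x => - v x) us (LsmallN vs)).
Qed.

Lemma LsmallM (e B : R) (b u : 'rV[R]_n -> R) : 0 <= B -> measurable_fun Om b ->
  (forall x, Om x -> `|b x| <= B) -> Lsmall e u ->
  Lsmall (B `^ p * e) (fun x => b x * u x).
Proof.
move=> B0 mb bB [up ue]; have bup := pLpM mO (ltW p0) mb bB up; split => //.
apply: (@le_trans _ _ (\int[leb]_(x in Om) (B `^ p * `|u x| `^ p))).
  apply: le_Rint => //; [exact: bup.2|exact: integZ up.2|move=> x Ox].
  rewrite normrM -powRM//; apply: ge0_ler_powR; rewrite ?nnegrE ?mulr_ge0 ?(ltW p0)//.
  by rewrite ler_wpM2r// bB.
by rewrite RintZ//; [rewrite ler_wpM2l ?powR_ge0|exact: up.2].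
Qed.

Lemma Lsmall_le (e e' : R) u : e <= e' -> Lsmall e u -> Lsmall e' u.
Proof. by move=> ee [up ue]; split => //; exact: le_trans ee. Qed.

Lemma Lsmall_eq (e : R) u v : u =1 v -> Lsmall e u -> Lsmall e v.
Proof. by move/funext ->. Qed.

(* [P] is the class of approximating functions: [P := test_function Om] gives
   W_0^{1,p}, while a class of merely smooth functions gives elements of W^{1,p}. *)
Definition Wapprox (P : ('rV[R]_n -> R) -> Prop) u Du : Prop :=
  [/\ pLp leb Om p u, forall i, pLp leb Om p (fun x => Du x ord0 i)
    & forall e : R, 0 < e -> exists2 g, P g &
       Lsmall e (fun x => u x - g x) /\
       forall i, Lsmall e (fun x => Du x ord0 i - partial i g x)].

Lemma measurable_enorm Du : (forall i, measurable_fun Om (fun x => Du x ord0 i)) ->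
  measurable_fun Om (fun x => enorm (Du x)).
Proof.
move=> mDu; apply: (@measurableT_comp _ _ _ _ _ _ (@Num.sqrt R)).
  by apply: continuous_measurable_fun; exact: sqrt_continuous.
by apply: measurable_sum => i; exact: measurable_funM.
Qed.

Lemma pLp_enorm Du : (forall i, pLp leb Om p (fun x => Du x ord0 i)) ->
  pLp leb Om p (fun x => enorm (Du x)).
Proof.
move=> Dup.
apply: (@pLp_le _ _ _ leb Om mO _ _ (fun x => \sum_i `|Du x ord0 i|)) => //.
- exact: ltW.
- by apply: measurable_enorm => i; exact: (Dup i).1.
- move=> x _; rewrite ger0_norm ?enorm_ge0//.
  by apply: le_trans (enorm_le_sum _) (ler_norm _).
- apply: pLp_sum => // i; have [mD iD] := Dup i; split.
    exact: measurableT_comp.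
  by rewrite /integ; under eq_fun do rewrite normr_id.
Qed.

Lemma ipow_enorm_le Du : (forall i, pLp leb Om p (fun x => Du x ord0 i)) ->
  \int[leb]_(x in Om) (`|enorm (Du x)| `^ p) <=
  n%:R `^ p * \sum_i \int[leb]_(x in Om) (`|Du x ord0 i| `^ p).
Proof.
move=> Dup; have Di i := (Dup i).2.
rewrite -Rint_sum// -RintZ//; last exact: integ_sum.
apply: le_Rint => //; first exact: (pLp_enorm Dup).2.
  by apply: integZ => //; exact: integ_sum.
move=> x _; apply: le_trans (powR_sum_le p0 _) => //.
rewrite ger0_norm ?enorm_ge0//; apply: ge0_ler_powR; rewrite ?nnegrE ?enorm_ge0 ?sumr_ge0 ?(ltW p0)//.
exact: enorm_le_sum.
Qed.

(** With |f| <= B one has |f|^p <= B^(p-1) |f|, and f is integrable. *)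
Lemma test_function_pLp f : test_function Om f -> pLp leb Om p f.
Proof.
move=> tf; have [B B0 fB] := test_function_bounded tf.
have fi : integ leb Om f.
  by apply: integrableS (test_function_integrable tf).
apply: (@pLp_of_integ _ _ _ leb Om mO _ _ (fun x => B `^ (p - 1) * `|f x|)).
- by apply: measurable_funTS; exact: test_function_measurable tf.
- move=> x _; rewrite -(mulr_powRB1 (normr_ge0 _) p0) mulrC ler_wpM2r//.
  by apply: ge0_ler_powR; rewrite ?nnegrE ?subr_ge0 ?(ltW p1) ?(ltW B0).
- by apply: integZ => //; exact: (integrable_abse fi).
Qed.

End one_set.

Lemma Rint_out Om (f : 'rV[R]_n -> R) : (forall x, ~ Om x -> f x = 0) ->
  \int[leb]_(x in Om) f x = \int[leb]_x f x.
Proof.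
move=> fO; rewrite Rintegral_mkcond; apply: eq_Rintegral => x _.
by rewrite patchE; case: ifPn => // /negP xO; rewrite fO// => /mem_set.
Qed.

Section weak_gradients.
Variables (Om : set 'rV[R]_n) (p : R).
Hypotheses (mO : measurable Om) (p1 : 1 < p).

Let p0 : 0 < p. Proof. exact: lt_trans p1. Qed.
Let q := p / (p - 1).
Let q1 : 1 < q.
Proof. exact: conjugate_exponent_gt1. Qed.
Let q0 : 0 < q. Proof. exact: lt_trans q1. Qed.
Let pq : p^-1 + q^-1 = 1.
Proof. exact: conjugate_exponentE. Qed.

Lemma Rint_partialM_eq0 g phi i : (forall k, Ck k g) -> test_function Om phi ->
  \int[leb]_(x in Om) (g x * partial i phi x + partial i g x * phi x) = 0.
Proof.
move=> Cg tphi; have tgphi := test_functionM Cg tphi.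
have [Cphi _ _] := tphi.
have E x : partial i (g \* phi) x = g x * partial i phi x + partial i g x * phi x.
  by rewrite partialM ?[in RHS](mulrC (partial i g x))//; [exact: (Cg 1).1|exact: (Cphi 1).1].
under eq_Rintegral do rewrite -E.
rewrite Rint_out; last first.
  by move=> x; exact: test_function_out (test_function_partial i tgphi).
by rewrite /Rintegral (test_function_integral_partial i tgphi).
Qed.

(** For a smooth approximant g the identity says that the integral of the i-th derivative of g phi
    is 0. It passes to the limit in L^p because phi and its derivative lie in L^q. *)
Lemma Wapprox_weak_gradient (P : ('rV[R]_n -> R) -> Prop) u Du :
  (forall g, P g -> forall k, Ck k g) -> Wapprox Om p P u Du ->
  weak_gradient Om u Du.
Proof.
move=> PC [up Dup app] phi tphi i.
have tdphi := test_function_partial i tphi.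
have phiq := test_function_pLp mO q1 tphi.
have dphiq := test_function_pLp mO q1 tdphi.
have i1 v : pLp leb Om p v -> integ leb Om (fun x => v x * partial i phi x).
  move=> vp; have := integM mO p0 q0 pq dphiq vp.
  by rewrite /integ; under eq_fun do rewrite mulrC.
have i2 v : pLp leb Om p v -> integ leb Om (fun x => v x * phi x).
  move=> vp; have := integM mO p0 q0 pq phiq vp.
  by rewrite /integ; under eq_fun do rewrite mulrC.
apply/eqP; rewrite -subr_eq0 opprK -RintD//; [|exact: i1|exact: i2].
rewrite -normr_eq0 eq_le normr_ge0 andbT; apply/ler_addgt0Pr => e e0; rewrite add0r.
have e20 : 0 < e / 2 by rewrite divr_gt0.
have [d1 d10 h1] := prod_small mO p0 q0 pq dphiq e20.
have [d2 d20 h2] := prod_small mO p0 q0 pq phiq e20.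
have [|g Pg [gu gDu]] := app (Num.min d1 d2); first by rewrite lt_min d10.
have [ugp uge] := gu; have [Dugp Duge] := gDu i.
have -> : \int[leb]_(x in Om) (u x * partial i phi x + Du x ord0 i * phi x) =
    \int[leb]_(x in Om) ((u x - g x) * partial i phi x) +
    \int[leb]_(x in Om) ((Du x ord0 i - partial i g x) * phi x).
  rewrite -RintD//; [|exact: i1|exact: i2].
  rewrite -[LHS]subr0 -(Rint_partialM_eq0 i (PC _ Pg) tphi) -RintB//.
  - by apply: eq_Rintegral => x _; ring.
  - by apply: integD => //; [exact: i1|exact: i2].
  - have := integB mO (integD mO (i1 _ up) (i2 _ (Dup i)))
      (integD mO (i1 _ ugp) (i2 _ Dugp)).
    congr (integ _ _); apply/funext => x; ring.
apply: le_trans (ler_normD _ _) _; rewrite [leRHS]splitr; apply: lerD.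
  under eq_Rintegral do rewrite mulrC.
  by apply: h1 => //; apply: le_trans uge _; rewrite ge_min lexx.
under eq_Rintegral do rewrite mulrC.
by apply: h2 => //; apply: le_trans Duge _; rewrite ge_min lexx orbT.
Qed.

Lemma Wapprox_W1p (P : ('rV[R]_n -> R) -> Prop) u Du :
  (forall g, P g -> forall k, Ck k g) -> Wapprox Om p P u Du -> W1p Om p u Du.
Proof.
move=> PC app; have [up Dup _] := app; split.
- exact/in_LpP.
- by move=> i; apply/in_LpP.
- exact: Wapprox_weak_gradient app.
Qed.

Lemma W1p0_Wapprox u Du : W1p0 Om p u Du -> Wapprox Om p (test_function Om) u Du.
Proof.
move=> [[/(@in_LpP Om p p1 u).1 up Dup _] app].
have {}Dup i : pLp leb Om p (fun x => Du x ord0 i) by apply/in_LpP.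
(* [W1p0] measures norms and [Wapprox] their p-th powers, hence the tolerance e^(1/p). *)
split => // e e0; have ep0 : 0 < e `^ p^-1 by rewrite powR_gt0.
have [phi tphi phie] := app _ ep0; exists phi => //.
have epp : (e `^ p^-1) `^ p = e.
  by rewrite -powRrM mulVf ?gt_eqF// powRr1// ltW.
have phip := test_function_pLp mO p1 tphi.
have dphip i := test_function_pLp mO p1 (test_function_partial i tphi).
have ud := pLpB mO (ltW p0) up phip.
have Dd i := pLpB mO (ltW p0) (Dup i) (dphip i).
have gE x i : (Du x - grad phi x) ord0 i = Du x ord0 i - partial i phi x.
  by rewrite !mxE.
have Dd' i : pLp leb Om p (fun x => (Du x - grad phi x) ord0 i).
  by under eq_fun do rewrite gE; exact: Dd.
have En := pLp_enorm mO p1 Dd'.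
split.
  split => //; rewrite -[leRHS]epp; apply: ipow_le_of_norm => //; first exact: ltW.
  apply: le_trans (ltW phie); rewrite /W1p_norm leeDl//.
  exact: Lp_norm_ge0.
move=> i; split; first exact: Dd.
apply: (@le_trans _ _ (\int[leb]_(x in Om) (`|enorm (Du x - grad phi x)| `^ p))).
  apply: le_Rint => //; [exact: (Dd i).2|exact: En.2|move=> x _].
  apply: ge0_ler_powR; rewrite ?nnegrE ?(ltW p0)//.
  by rewrite [leRHS]ger0_norm ?enorm_ge0// -gE coord_le_enorm.
rewrite -[leRHS]epp; apply: ipow_le_of_norm => //; first exact: ltW.
apply: le_trans (ltW phie); rewrite /W1p_norm leeDr//.
exact: Lp_norm_ge0.
Qed.

Lemma Wapprox_W1p0 u Du : Wapprox Om p (test_function Om) u Du -> W1p0 Om p u Du.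
Proof.
move=> app; split; first by apply: Wapprox_W1p app => g [].
have [up Dup app'] := app; move=> e e0.
(* Function and gradient receive e/3 each, which leaves room for the strict inequality. K below pays
   for bounding the Euclidean norm of the gradient by its n coordinates. *)
pose c := (e / 3) `^ p; have c0 : 0 < c by rewrite powR_gt0// divr_gt0.
pose K := n%:R `^ p * n%:R + 1 : R.
have K0 : 0 < K by rewrite ltr_wpDl// mulr_ge0 ?powR_ge0.
have [|phi tphi [us Ds]] := app' (c / K); first by rewrite divr_gt0.
exists phi => //.
have gE x i : (Du x - grad phi x) ord0 i = Du x ord0 i - partial i phi x.
  by rewrite !mxE.
have Dd' i : pLp leb Om p (fun x => (Du x - grad phi x) ord0 i).
  by under eq_fun do rewrite gE; exact: (Ds i).1.
have cK : c / K <= c.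
  by rewrite ler_pdivrMr// ler_peMr ?(ltW c0)// /K lerDr mulr_ge0 ?powR_ge0.
apply: (@le_lt_trans _ _ ((e / 3)%:E + (e / 3)%:E)%E); last first.
  by rewrite -EFinD lte_fin; lra.
apply: leeD.
  apply: norm_le_of_ipow => //; [by rewrite divr_ge0// ltW|exact: us.1|].
  exact: le_trans us.2 cK.
apply: norm_le_of_ipow => //; [by rewrite divr_ge0// ltW|exact: pLp_enorm|].
apply: le_trans (ipow_enorm_le mO p1 Dd') _.
apply: (@le_trans _ _ (n%:R `^ p * \sum_(i < n) (c / K))).
  rewrite ler_wpM2l ?powR_ge0//; apply: ler_sum => i _.
  by under eq_Rintegral do rewrite gE; exact: (Ds i).2.
rewrite sumr_const card_ord -(mulr_natl (c / K)) mulrA mulrCA ler_piMr ?(ltW c0)//.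
by rewrite -/c ler_pdivrMr// mul1r /K lerDl.
Qed.

End weak_gradients.

(** * Poincare inequality in a single direction, for sets contained in a slab *)

Section poincare_inequality.
Variable p : R.
Hypothesis p1 : 1 < p.

Let p0 : 0 < p. Proof. exact: lt_trans p1. Qed.
Let q := p / (p - 1).
Let q1 : 1 < q.
Proof. exact: conjugate_exponent_gt1. Qed.
Let q0 : 0 < q. Proof. exact: lt_trans q1. Qed.
Let pq : p^-1 + q^-1 = 1.
Proof. exact: conjugate_exponentE. Qed.

(* Integrate the [i]-th partial derivative of [x_i |phi x|^p]. *)
Lemma poincare_test (M : R) : exists2 C : R, 0 < C &
  forall Om (i : 'I_n), measurable Om -> (forall x, Om x -> `|x ord0 i| <= M) ->
  forall phi, test_function Om phi ->
    \int[leb]_(x in Om) (`|phi x| `^ p) <=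
    C * \int[leb]_(x in Om) (`|partial i phi x| `^ p).
Proof.
(* The weight 1/2 lets half of the integral of |phi|^p be absorbed on the left; this is the factor 2
   in the constant. *)
have h0 : 0 < (2^-1 : R) by rewrite invr_gt0.
have [C C0 Ch] := young_eps p0 q0 pq h0.
pose K := `|M| * p; have K0 : 0 <= K by rewrite mulr_ge0 ?(ltW p0).
have C'0 : 0 < 2 * (C * K `^ p + 1).
  by rewrite mulr_gt0// ltr_wpDl// mulr_ge0 ?(ltW C0) ?powR_ge0.
exists (2 * (C * K `^ p + 1)) => // Om i mO OM phi tphi.
have [Cphi _ _] := tphi.
have dphi x : differentiable phi x by exact: (Cphi 1).1.
have tdphi := test_function_partial i tphi.
have phip := test_function_pLp mO p1 tphi.
have dphip := test_function_pLp mO p1 tdphi.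
pose h (t : R) := `|t| `^ p.
pose g (x : 'rV[R]_n) : R := x ord0 i * h (phi x).
have dh x : differentiable (h \o phi) x.
  apply: differentiable_comp => //; apply/derivable1_diffP.
  by have [] := is_derive_norm_powR p1 (phi x).
have gE x : partial i g x = x ord0 i * (dpow p (phi x) * partial i phi x) + h (phi x).
  rewrite (@partialM _ _ (fun x => x ord0 i) (h \o phi))//; last first.
    exact: differentiable_rV_coord.
  rewrite partial_coord eqxx mulr1; congr (_ * _ + _).
  by rewrite (@partial_comp _ _ _ _ _ _ _ (is_derive_norm_powR p1)).
have chphi : continuous (h \o phi).
  by move=> x; apply: differentiable_continuous.
have cg : Ck 0 (partial i g).
  rewrite (_ : partial i g = ((fun x : 'rV[R]_n => x ord0 i) \*
      ((dpow p \o phi) \* partial i phi)) \+ (h \o phi)); last first.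
    by apply/funext => x; exact: gE.
  apply: CkD; last exact: chphi.
  apply: CkM; first exact: Ck_coord.
  apply: CkM; last exact: ((Cphi 1).2 i).
  by move=> x; apply: continuous_comp; [exact: (Cphi 0)|exact: continuous_dpow].
have ig0 : (\int[leb]_x (partial i g x)%:E = 0)%E.
  have [B phiB] := test_function_bounded_support tphi.
  apply: (@integral_partial0 _ _ _ _ B).
  - move=> x; apply: diff_derivable.
    exact: (differentiableM (differentiable_rV_coord i x) (dh x)).
  - exact: cg.
  - by move=> x Bx; rewrite /g phiB// /h normr0 powR0 ?gt_eqF// mulr0.
have g0 x : ~ Om x -> partial i g x = 0.
  move=> Ox; rewrite gE (test_function_out tphi Ox) /dpow sgr0 /h normr0.
  by rewrite !(mulr0, mul0r) add0r powR0// gt_eqF.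
have dgi : integ leb setT (partial i g).
  have [B phiB] := test_function_bounded_support tphi.
  apply: (@integrable_bounded_support _ _ _ B); first exact: cg.
  move=> x Bx; rewrite gE phiB// /dpow sgr0 /h normr0.
  by rewrite !(mulr0, mul0r) add0r powR0// gt_eqF.
have dgO : integ leb Om (partial i g) by apply: integrableS dgi.
have Ig : \int[leb]_(x in Om) partial i g x = 0.
  by rewrite Rint_out// /Rintegral ig0.
(* The derivative of g equals |phi|^p plus a term bounded by K |phi|^(p-1) |partial i phi|. Young
   applies to the latter, with (p-1) q = p. *)
have pt x : Om x -> `|phi x| `^ p <= partial i g x +
    (2^-1 * `|phi x| `^ p + C * K `^ p * `|partial i phi x| `^ p).
  move=> Ox; rewrite gE -/(h (phi x)) addrAC lerDr.
  have aq : `| `|phi x| `^ (p - 1) | `^ q = `|phi x| `^ p.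
    rewrite ger0_norm ?powR_ge0// -powRrM /q mulrC divfK//.
    by rewrite gt_eqF// subr_gt0.
  have := Ch (`|phi x| `^ (p - 1)) (K * partial i phi x).
  rewrite aq [`|K * _|]normrM (ger0_norm K0) powRM// [C * (_ * _)]mulrA.
  rewrite -/(h (phi x)) => hh; rewrite -lerBlDl sub0r.
  apply: le_trans hh; apply: le_trans (ler_norm _) _.
  rewrite normrN [`|_ * (K * _)|]normrM [`|K * _|]normrM (ger0_norm K0).
  rewrite (ger0_norm (powR_ge0 _ _)) [leLHS]normrM [`|dpow _ _ * _|]normrM.
  rewrite [leLHS]mulrA [leRHS]mulrA.
  rewrite ler_wpM2r// (@le_trans _ _ (`|M| * (p * `|phi x| `^ (p - 1))))//.
    apply: ler_pM => //; first exact: le_trans (OM x Ox) (ler_norm _).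
    exact: norm_dpow_le.
  by rewrite mulrA mulrC.
have i2 : integ leb Om (fun x => 2^-1 * `|phi x| `^ p) by apply: integZ => //; exact: phip.2.
have i3 : integ leb Om (fun x => C * K `^ p * `|partial i phi x| `^ p).
  by apply: integZ => //; exact: dphip.2.
have : \int[leb]_(x in Om) (`|phi x| `^ p) <= \int[leb]_(x in Om) (partial i g x +
    (2^-1 * `|phi x| `^ p + C * K `^ p * `|partial i phi x| `^ p)).
  apply: le_Rint => //; first exact: phip.2.
  by apply: integD => //; exact: integD.
rewrite RintD//; last exact: integD.
rewrite Ig add0r RintD// (RintZ mO _ phip.2) (RintZ mO _ dphip.2).
have I0 : 0 <= \int[leb]_(x in Om) (`|partial i phi x| `^ p).
  by apply: Rint_ge0 => x _; exact: powR_ge0.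
move: I0; set X := \int[leb]_(x in Om) (`|phi x| `^ p).
set Y := \int[leb]_(x in Om) (`|partial i phi x| `^ p).
by clearbody X Y; move: (C * K `^ p) => c Y0 XY; lra.
Qed.

(** Density extends the inequality from test functions, each passage costing 2^p. C is chosen before
    Om and i and depends on p and the slab only, so one constant serves all cylinders. *)
Lemma poincare (M : R) : exists2 C : R, 0 < C &
  forall Om (i : 'I_n), measurable Om -> (forall x, Om x -> `|x ord0 i| <= M) ->
  forall u Du, Wapprox Om p (test_function Om) u Du ->
    \int[leb]_(x in Om) (`|u x| `^ p) <=
    C * \int[leb]_(x in Om) (`|Du x ord0 i| `^ p).
Proof.
have [C C0 Ch] := poincare_test M; pose k := 2 `^ p : R.
have k0 : 0 < k by rewrite powR_gt0.
exists (k * (C * k)) => [|Om i mO OM u Du [up Dup app]]; first by rewrite !mulr_gt0.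
apply/ler_addgt0Pr => e e0.
have c0 : 0 < k * (1 + C * k) by rewrite mulr_gt0// addr_gt0// mulr_gt0.
have [|phi tphi [us Ds]] := app (e / (k * (1 + C * k))); first by rewrite divr_gt0.
have phip := test_function_pLp mO p1 tphi.
have dphip := test_function_pLp mO p1 (test_function_partial i tphi).
have [ud ude] := us; have [Dd Dde] := Ds i.
have h1 : \int[leb]_(x in Om) (`|u x| `^ p) <=
    k * (\int[leb]_(x in Om) (`|u x - phi x| `^ p) +
         \int[leb]_(x in Om) (`|phi x| `^ p)).
  apply: le_trans (le_ipowD mO (ltW p0) ud phip).
  by under [leRHS]eq_Rintegral do rewrite subrK.
have h2 : \int[leb]_(x in Om) (`|partial i phi x| `^ p) <=
    k * (\int[leb]_(x in Om) (`|Du x ord0 i| `^ p) +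
         \int[leb]_(x in Om) (`|Du x ord0 i - partial i phi x| `^ p)).
  under [X in _ <= _ * (_ + X)]eq_Rintegral do rewrite -normrN.
  apply: le_trans (le_ipowD mO (ltW p0) (Dup i) (pLpN Dd)).
  by under [leRHS]eq_Rintegral do rewrite opprB addrC subrK.
have h3 := Ch _ _ mO OM _ tphi.
move: h1 h2 h3 ude Dde; rewrite -/k.
set X := \int[leb]_(x in Om) _; set A := \int[leb]_(x in Om) _.
set B := \int[leb]_(x in Om) _; set D := \int[leb]_(x in Om) _.
set E := \int[leb]_(x in Om) _; set F := \int[leb]_(x in Om) _.
move=> h1 h2 h3 h4 h5.
apply: (le_trans h1).
apply: (@le_trans _ _ (k * (e / (k * (1 + C * k)) + C * (k * (E + e / (k * (1 + C * k))))))).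
  rewrite ler_wpM2l ?(ltW k0)//; apply: lerD; [exact: h4|apply: (le_trans h3)].
  rewrite ler_wpM2l ?(ltW C0)//; apply: (le_trans h2).
  by rewrite ler_wpM2l ?(ltW k0)// lerD2l.
have := divfK (lt0r_neq0 c0) e; set z := e / _ => ze.
by rewrite -[X in _ <= _ + X]ze le_eqVlt; apply/orP; left; apply/eqP; ring.
Qed.

End poincare_inequality.

End sobolev_approximation.

(** * The flux and the cylinders *)

Section measurability_on_sets.
Context {R : realType} {n : nat}.

Lemma measurable_fun_open_continuous (D : set 'rV[R]_n) (f : 'rV[R]_n -> R) :
  open D -> (forall x, D x -> {for x, continuous f}) -> measurable_fun D f.
Proof.
move=> oD cf; apply: (measurability _ (RGenOpens.measurableE R)).
move=> _ [_ [a [b ->] <-]]; apply: open_measurable_rV.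
rewrite openE => x [Dx fx]; apply: filterI; first exact: open_nbhs_nbhs.
by apply: (cf x Dx); apply: open_nbhs_nbhs; split => //; exact: interval_open.
Qed.

Lemma measurable_fun_rV_on d (T : measurableType d) (D : set T) (f : T -> 'rV[R]_n) :
  measurable D -> (forall i, measurable_fun D (fun x => f x ord0 i)) ->
  measurable_fun D f.
Proof.
move=> mD mf.
pose g x := \row_i (((fun x => f x ord0 i) \_ D) x : R).
have mg : measurable_fun setT g.
  apply: measurable_fun_rV => i.
  rewrite (_ : _ \o _ = (fun x => f x ord0 i) \_ D).
    exact: (measurable_restrictT _ mD).1 (mf i).
  by apply/funext => x; rewrite /rV_coord /= mxE.
apply: (eq_measurable_fun g); last exact: measurable_funTS.
by move=> x xD; apply/rowP => i; rewrite mxE patchE xD.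
Qed.

Lemma measurable_setC0 : measurable (~` [set (0 : 'rV[R]_n)]).
Proof.
apply: open_measurable_rV; apply: closed_openC; apply: accessible_closed_set1.
exact/hausdorff_accessible/norm_hausdorff.
Qed.

End measurability_on_sets.

Section homogeneous_convex.
Context {R : realType} {m k : nat}.
Variables (p : R) (H : 'rV[R]_(m + k) -> R).
Hypotheses (p1 : 1 < p) (H_ge0 : forall x, 0 <= H x)
  (H_convex : convex_function setT H)
  (H_homogeneous : forall t x, H (t *: x) = `|t| * H x)
  (H_C1 : forall x, x != 0 ->
     differentiable H x /\ {for x, continuous (grad H)}).

(** Midpoint convexity at 2x and 2y, whose factors 2 homogeneity cancels: H is a norm-like gauge. *)
Lemma H_le_add x y : H (x + y) <= H x + H y.
Proof.
have h0 : 0 <= (2^-1 : R) by rewrite invr_ge0.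
have h1 : (2^-1 : R) <= 1 by rewrite invf_le1// ler1n.
have := H_convex (Itv01 h0 h1) (x := 2 *: x) (y := 2 *: y).
rewrite !in_setT => /(_ isT isT).
have -> : conv (Itv01 h0 h1) (2 *: x : convex_lmodType _) (2 *: y) = x + y.
  rewrite /conv /= !scalerA /unstable.onem.
  have -> : (2^-1 * 2 : R) = 1 by rewrite mulVf.
  have -> : ((1 - 2^-1) * 2 : R) = 1 by lra.
  by rewrite !scale1r.
have -> : conv (Itv01 h0 h1) (H (2 *: x) : R^o) (H (2 *: y)) = H x + H y.
  rewrite convRE /= /unstable.onem !H_homogeneous ger0_norm//; lra.
by [].
Qed.

Lemma H0 : H 0 = 0.
Proof. by rewrite -(scale0r (0 : 'rV[R]_(m + k))) H_homogeneous normr0 mul0r. Qed.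

Lemma HN x : H (- x) = H x.
Proof. by rewrite -scaleN1r H_homogeneous normrN1 mul1r. Qed.

(** One constant for three bounds: H against the Euclidean norm, its Lipschitz constant, and its
    partial derivatives away from 0. *)
Definition Hsum := \sum_(i < m + k) H (delta_mx ord0 i).

Lemma Hsum_ge0 : 0 <= Hsum.
Proof. by apply: sumr_ge0 => i _. Qed.

Lemma H_delta_le i : H (delta_mx ord0 i) <= Hsum.
Proof. by rewrite /Hsum (bigD1 i)//= lerDl sumr_ge0. Qed.

Lemma H_le_enorm x : H x <= Hsum * enorm x.
Proof.
rewrite {1}(row_sum_delta x).
have : H (\sum_j x ord0 j *: delta_mx ord0 j) <=
    \sum_j `|x ord0 j| * H (delta_mx ord0 j).
  elim/big_ind2 : _ => [|u a v b ua vb|j _]; first by rewrite H0.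
    by apply: le_trans (H_le_add _ _) _; exact: lerD.
  by rewrite H_homogeneous.
move=> h; apply: le_trans h _; rewrite /Hsum mulr_suml.
by apply: ler_sum => j _; rewrite mulrC ler_wpM2l// coord_le_enorm.
Qed.

Lemma H_lipschitz x y : `|H x - H y| <= Hsum * enorm (x - y).
Proof.
have key u v : H u - H v <= Hsum * enorm (u - v).
  rewrite lerBlDr; apply: le_trans (lerD (H_le_enorm _) (lexx _)).
  by apply: le_trans (H_le_add _ _); rewrite subrK.
rewrite ler_norml key andbT lerNl opprB.
by apply: le_trans (key y x) _; rewrite -enormN opprB.
Qed.

Lemma continuous_H : continuous H.
Proof.
move=> x; apply/(@cvgrPdist_le _ _ _ (nbhs x) _ H (H x)) => e e0.
pose K := Hsum * (m + k)%:R + 1.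
have K0 : 0 < K by rewrite ltr_wpDl// mulr_ge0// Hsum_ge0.
have : \forall y \near x, `|x - y| <= e / K.
  near=> y; apply: ltW; near: y.
  by apply: cvgr_dist_lt; rewrite ?divr_gt0//; exact: cvg_id.
apply: filterS => y xy; apply: le_trans (H_lipschitz x y) _.
apply: (@le_trans _ _ (Hsum * \sum_(i < m + k) (e / K))).
  rewrite ler_wpM2l ?Hsum_ge0//; apply: le_trans (enorm_le_sum _) _.
  by apply: ler_sum => i _; apply: le_trans (ler_rV_norm _ _) xy.
rewrite sumr_const card_ord -[(e / K) *+ _]mulr_natl !mulrA ler_pdivrMr//.
by rewrite [leLHS]mulrC ler_wpM2l ?(ltW e0)// /K lerDl.
Unshelve. all: by end_near. Qed.

(** By subadditivity and homogeneity every difference quotient in direction i is bounded by H of the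
    i-th unit vector; the bound passes to the limit. *)
Lemma partial_H_le i z : z != 0 -> `|partial i H z| <= H (delta_mx ord0 i).
Proof.
move=> z0; have [dH _] := H_C1 z0.
have /cvgrPdist_le C := diff_derivable (v := delta_mx ord0 i) dH.
apply/ler_addgt0Pr => e e0.
have [h [h0 hD]] : exists h : R, h != 0 /\
    `|partial i H z - h^-1 *: ((H \o shift z) (h *: delta_mx ord0 i) - H z)| <= e.
  have := C e e0 => {}C.
  have : \forall h \near (0 : R)^', h != 0 /\
    `|partial i H z - h^-1 *: ((H \o shift z) (h *: delta_mx ord0 i) - H z)| <= e.
    by near=> h; split; near: h; [exact: nbhs_dnbhs_neq|exact: C].
  by move/filter_ex.
rewrite -[partial i H z](subrK (h^-1 *: ((H \o shift z) (h *: delta_mx ord0 i) - H z))).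
apply: le_trans (ler_normD _ _) _; rewrite addrC; apply: lerD hD.
rewrite normrZ normfV ler_pdivrMl ?normr_gt0//=.
rewrite -H_homogeneous ler_norml; apply/andP; split.
  rewrite lerNl opprB lerBlDr.
  by have := H_le_add (- (h *: delta_mx ord0 i)) (h *: delta_mx ord0 i + z); rewrite HN addKr.
by rewrite lerBlDr H_le_add.
Unshelve. all: by end_near. Qed.

Lemma flux0 : flux p H 0 = 0.
Proof. by rewrite /flux H0 powR0 ?scale0r// gt_eqF// subr_gt0. Qed.

Definition Cflux : R := Hsum `^ (p - 1) * Hsum.

Lemma Cflux_ge0 : 0 <= Cflux.
Proof. by rewrite mulr_ge0 ?powR_ge0 ?Hsum_ge0. Qed.

(** The structure conditions contain no upper bound on the flux for p >= 2; this growth comes from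
    convexity and homogeneity of H alone, and also puts the flux of an L^p gradient into L^q. *)
Lemma flux_le z i : `|flux p H z ord0 i| <= Cflux * enorm z `^ (p - 1).
Proof.
have [->|z0] := eqVneq z 0.
  by rewrite flux0 mxE normr0 mulr_ge0 ?Cflux_ge0 ?powR_ge0.
rewrite /flux !mxE normrM ger0_norm ?powR_ge0//.
apply: (@le_trans _ _ ((Hsum * enorm z) `^ (p - 1) * Hsum)).
  apply: ler_pM; rewrite ?powR_ge0//.
    apply: ge0_ler_powR; rewrite ?nnegrE ?subr_ge0 ?(ltW p1)//.
      by rewrite mulr_ge0 ?Hsum_ge0 ?enorm_ge0.
    exact: H_le_enorm.
  by apply: le_trans (partial_H_le _ z0) (H_delta_le _).
by rewrite powRM ?Hsum_ge0 ?enorm_ge0// mulrAC.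
Qed.

(** The gradient of H is controlled only off the origin, where it is continuous; the origin is split
    off as a set on which the flux is 0. *)
Lemma measurable_flux i : measurable_fun setT (fun z => flux p H z ord0 i).
Proof.
rewrite -(setUv [set (0 : 'rV[R]_(m + k))]).
have m0 : measurable [set (0 : 'rV[R]_(m + k))].
  by rewrite -[X in measurable X]setCK; apply: measurableC; exact: measurable_setC0.
apply/measurable_funU => //; first exact: measurable_setC0.
split.
  apply: (eq_measurable_fun (fun=> (0 : R))) => //.
  by move=> z; rewrite inE => ->; rewrite flux0 mxE.
apply: (eq_measurable_fun (fun z => H z `^ (p - 1) * partial i H z)).
  by move=> z _; rewrite /flux !mxE.
apply: measurable_funM.
  apply: (measurableT_comp (measurable_powR (p - 1))).
  by apply: measurable_funTS; apply: continuous_measurable_rV; exact: continuous_H.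
apply: measurable_fun_open_continuous.
  apply: closed_openC; apply: accessible_closed_set1.
  exact/hausdorff_accessible/norm_hausdorff.
move=> z /eqP z0; have [_ cg] := H_C1 z0.
have -> : partial i H = (fun v : 'rV[R]_(m + k) => v ord0 i) \o grad H.
  by apply/funext => w; rewrite /= mxE.
by apply: continuous_comp => //; exact: coord_continuous.
Qed.

Lemma measurable_flux_comp d (T : measurableType d) (D : set T)
  (F : T -> 'rV[R]_(m + k)) i : measurable D ->
  (forall j, measurable_fun D (fun x => F x ord0 j)) ->
  measurable_fun D (fun x => flux p H (F x) ord0 i).
Proof.
move=> mD mF; apply: (measurableT_comp (measurable_flux i)).
exact: measurable_fun_rV_on.
Qed.

End homogeneous_convex.

(** * Geometry of the cylinders and integrals of functions of X_2 over them *)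

Section cylinders.
Context {R : realType} {m k : nat}.
Variables (omega1 : set 'rV[R]_m) (omega2 : set 'rV[R]_k).
Hypotheses (omega1_open : open omega1) (omega1_convex : convex_set omega1)
  (omega1_0 : omega1 0) (omega2_open : open omega2).
Local Notation cyl := (cylinder omega1 omega2).
Local Notation leb := (lebesgue_rV R).

Lemma cylinderE l x : 0 < l ->
  cyl l x <-> omega1 (l^-1 *: lsubmx x) /\ omega2 (rsubmx x).
Proof.
move=> l0; split=> [[[y yO <-] o2]|[a1 a2]].
  by rewrite scalerA mulVf ?gt_eqF// scale1r.
by split => //; exists (l^-1 *: lsubmx x) => //; rewrite scalerA mulfV ?gt_eqF// scale1r.
Qed.

Lemma open_cylinder l : 0 < l -> open (cyl l).
Proof.
move=> l0; have -> : cyl l =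
    (fun x => l^-1 *: lsubmx x) @^-1` omega1 `&` rsubmx @^-1` omega2.
  by apply/seteqP; split => x; rewrite cylinderE.
apply: openI; apply: open_comp => // x _; last exact: continuous_rsubmx.
apply: continuous_rV => i; under eq_fun do rewrite !mxE.
by apply: (@Ck_continuous _ _ 0); apply: CkM; [exact: Ck_cst|exact: Ck_coord].
Qed.

Lemma measurable_cylinder l : 0 < l -> measurable (cyl l).
Proof. by move=> l0; apply: open_measurable_rV; exact: open_cylinder. Qed.

Lemma omega1_half x y : omega1 x -> omega1 y -> omega1 (2^-1 *: x + 2^-1 *: y).
Proof.
move=> ox oy.
have h0 : 0 <= (2^-1 : R) by rewrite invr_ge0.
have h1 : (2^-1 : R) <= 1 by rewrite invf_le1// ler1n.
have := omega1_convex (Itv01 h0 h1) (mem_set ox) (mem_set oy).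
move/set_mem; rewrite /conv /= /unstable.onem.
by have -> : 1 - 2^-1 = 2^-1 :> R by lra.
Qed.

(** X_1 / l is the midpoint of 2 X_1 / l and 0, both in the convex set omega1. *)
Lemma cylinder_half l : 0 < l -> cyl (l / 2) `<=` cyl l.
Proof.
move=> l0 x; have l20 : 0 < l / 2 by rewrite divr_gt0.
rewrite !cylinderE// => -[a1 a2]; split => //.
have := omega1_half a1 omega1_0; rewrite scaler0 addr0 scalerA.
by rewrite invf_div mulrA mulVf// mul1r.
Qed.

Section cylinder_integrals.
Variables (M l : R).
Hypotheses (M0 : 0 <= M) (omega1_M : forall x, omega1 x -> `|x| <= M) (l0 : 0 < l).

Let mO := measurable_cylinder l0.
Let mO2 : measurable omega2. Proof. exact: open_measurable_rV. Qed.

Lemma measurable_cylinder_rsubmx (v : 'rV[R]_k -> R) : measurable_fun omega2 v ->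
  measurable_fun (cyl l) (v \o rsubmx).
Proof.
move=> mv; apply: (measurable_comp mO2) => //; first by move=> _ [x [_ ox] <-].
by apply: measurable_funTS; exact: measurable_rsubmx.
Qed.

(** The source of every factor l^m: l omega1 lies in the cube |X_1| <= M l, of volume (2 M l)^m.
    Tonelli is applied to the indicator of that cube times the extension of g by zero, both defined
    on the whole space. *)
Lemma cylinder_integ (g : 'rV[R]_k -> R) : (forall y, omega2 y -> 0 <= g y) ->
  integ (leb k) omega2 g ->
  integ (leb (m + k)) (cyl l) (g \o rsubmx) /\
  \int[leb (m + k)]_(x in cyl l) g (rsubmx x) <=
    (2 * (M * l)) ^+ m * \int[leb k]_(y in omega2) g y.
Proof.
move=> g0 gi; have mg := integ_measurable gi.
pose g' := g \_ omega2.
have mg' : measurable_fun setT g' by exact/(measurable_restrictT _ mO2).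
have g'0 y : 0 <= g' y.
  by rewrite /g' patchE; case: ifPn => // /set_mem/g0.
pose box := [set x : 'rV[R]_m | `|x| <= M * l].
pose F (x : 'rV[R]_(m + k)) : \bar R := (\1_box (lsubmx x) * g' (rsubmx x))%:E.
have mF : measurable_fun setT F.
  apply/measurable_EFinP; apply: measurable_funM.
    have mb : measurable_fun setT (\1_box : 'rV[R]_m -> R).
      by apply: measurable_indic; exact: measurable_norm_le.
    exact: (measurableT_comp mb (@measurable_lsubmx R m k)).
  by apply: (measurableT_comp mg'); exact: measurable_rsubmx.
have F0 x : (0 <= F x)%E by rewrite lee_fin mulr_ge0.
have IF : (\int[leb (m + k)]_x F x =
    ((2 * (M * l)) ^+ m)%:E * (\int[leb k]_(y in omega2) g y)%:E)%E.
  rewrite tonelli_row_mx//.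
  transitivity (\int[leb m]_x ((\1_box x)%:E * (\int[leb k]_(y in omega2) g y)%:E))%E.
    apply: eq_integral => x _.
    under eq_integral do rewrite /F row_mxKl row_mxKr EFinM.
    rewrite ge0_integralZl//.
    - congr (_ * _)%E; rewrite -Rint_EFin// [RHS]integral_mkcond.
      by apply: eq_integral => y _; rewrite /g' !patchE; case: ifP.
    - exact/measurable_EFinP.
    - by move=> y _; rewrite lee_fin.
  rewrite ge0_integralZr//.
  - rewrite integral_indic//; last exact: measurable_norm_le.
    congr (_ * _)%E; rewrite setIT; apply: lebesgue_norm_le.
    by rewrite mulr_ge0// ltW.
  - by apply/measurable_EFinP; apply: measurable_indic; exact: measurable_norm_le.
  - by rewrite lee_fin Rint_ge0.
have gF x : cyl l x -> (g (rsubmx x))%:E = F x.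
  move=> /[dup] ox /(cylinderE _ l0)[a1 a2].
  rewrite /F /g' patchE mem_set// indicE mem_set ?mul1r//.
  have := omega1_M a1; rewrite normrZ gtr0_norm ?invr_gt0//.
  by rewrite ler_pdivrMl// mulrC.
have leF : (\int[leb (m + k)]_(x in cyl l) (g (rsubmx x))%:E <= \int[leb (m + k)]_x F x)%E.
  rewrite [leLHS](_ : _ = \int[leb (m + k)]_(x in cyl l) F x)%E; last first.
    by apply: eq_integral => x /set_mem; exact: gF.
  by apply: ge0_subset_integral.
have gi' : integ (leb (m + k)) (cyl l) (g \o rsubmx).
  apply/integrableP; split.
    by apply/measurable_EFinP; exact: measurable_cylinder_rsubmx.
  apply: le_lt_trans (_ : (\int[leb (m + k)]_x F x < +oo)%E); last first.
    by rewrite IF -EFinM ltry.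
  apply: le_trans leF; rewrite le_eqVlt; apply/orP; left; apply/eqP.
  apply: eq_integral => x /set_mem ox /=; rewrite ger0_norm//.
  by apply: g0; move: ox => /(cylinderE _ l0)[].
split => //.
by move: leF; rewrite IF -EFinM (Rint_EFin mO gi') lee_fin.
Qed.

Variable p : R.
Hypothesis p1 : 1 < p.

Lemma cylinder_pLp (v : 'rV[R]_k -> R) : pLp (leb k) omega2 p v ->
  pLp (leb (m + k)) (cyl l) p (v \o rsubmx) /\
  \int[leb (m + k)]_(x in cyl l) (`|v (rsubmx x)| `^ p) <=
    (2 * (M * l)) ^+ m * \int[leb k]_(y in omega2) (`|v y| `^ p).
Proof.
move=> [mv vi].
have [||vi' le] := @cylinder_integ (fun y => `|v y| `^ p) => //.
by split => //; split => //; exact: measurable_cylinder_rsubmx.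
Qed.

End cylinder_integrals.

End cylinders.

(** * Products and liftings of Sobolev functions *)

Section Wapprox_algebra.
Context {R : realType} {n : nat}.
Local Notation leb := (lebesgue_rV R n).
Implicit Types (u v : 'rV[R]_n -> R) (Du Dv : 'rV[R]_n -> 'rV[R]_n)
  (P Q S : ('rV[R]_n -> R) -> Prop).

Section one_set.
Variables (Om : set 'rV[R]_n) (p : R).
Hypotheses (mO : measurable Om) (p1 : 1 < p).

Let p0 : 0 < p. Proof. exact: lt_trans p1. Qed.

(** Allows a construction to lose a fixed factor K, by approximating with e / K. *)
Lemma Wapprox_intro P u Du (K : R) : 0 < K ->
  pLp leb Om p u -> (forall i, pLp leb Om p (fun x => Du x ord0 i)) ->
  (forall e : R, 0 < e -> exists2 g, P g &
     Lsmall Om p (K * e) (fun x => u x - g x) /\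
     forall i, Lsmall Om p (K * e) (fun x => Du x ord0 i - partial i g x)) ->
  Wapprox Om p P u Du.
Proof.
move=> K0 up Dup app; split => // e e0.
have [|g Pg] := app (e / K); first by rewrite divr_gt0.
by rewrite mulrCA mulfV ?gt_eqF// mulr1 => h; exists g.
Qed.

Lemma Wapprox_sub P Q S u Du v Dv :
  (forall g, P g -> forall j, Ck j g) -> (forall g, Q g -> forall j, Ck j g) ->
  (forall g h, P g -> Q h -> S (g \- h)) ->
  Wapprox Om p P u Du -> Wapprox Om p Q v Dv ->
  Wapprox Om p S (fun x => u x - v x) (fun x => Du x - Dv x).
Proof.
move=> PC QC PQS [up Dup appu] [vp Dvp appv].
apply: (@Wapprox_intro _ _ _ (2 `^ p * 2)).
- by rewrite mulr_gt0// powR_gt0.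
- exact: pLpB (ltW p0) up vp.
- by move=> i; under eq_fun do rewrite !mxE; exact: pLpB (ltW p0) (Dup i) (Dvp i).
move=> e e0; have [g Pg [gu gD]] := appu e e0; have [h Qh [hv hD]] := appv e e0.
exists (g \- h); first exact: PQS.
have E : 2 `^ p * 2 * e = 2 `^ p * (e + e) by ring.
rewrite E; split=> [|i].
  by apply: (Lsmall_eq _ (LsmallB mO p1 gu hv)) => x /=; ring.
apply: (Lsmall_eq _ (LsmallB mO p1 (gD i) (hD i))) => x /=.
rewrite partialB; [|exact: (PC _ Pg 1).1|exact: (QC _ Qh 1).1].
by rewrite !mxE; ring.
Qed.

Lemma Wapprox_mul P S u Du (ch : 'rV[R]_n -> R) (B : R) :
  (forall g, P g -> forall j, Ck j g) -> (forall j, Ck j ch) -> 0 <= B ->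
  (forall x, `|ch x| <= B) -> (forall i x, `|partial i ch x| <= B) ->
  (forall g, P g -> S (ch \* g)) ->
  Wapprox Om p P u Du ->
  Wapprox Om p S (fun x => ch x * u x)
    (fun x => ch x *: Du x + u x *: grad ch x).
Proof.
move=> PC Cc B0 cB dcB PS [up Dup app].
have mc : measurable_fun Om ch.
  by apply: measurable_funTS; apply: continuous_measurable_rV; exact: (Cc 0).
have mdc i : measurable_fun Om (partial i ch).
  by apply: measurable_funTS; apply: continuous_measurable_rV; exact: ((Cc 1).2 i).
have E x i : (ch x *: Du x + u x *: grad ch x) ord0 i =
    ch x * Du x ord0 i + partial i ch x * u x by rewrite !mxE [u x * _]mulrC.
pose Bp := B `^ p; have Bp0 : 0 <= Bp by exact: powR_ge0.
have tp0 : 0 <= 2 `^ p :> R by exact: powR_ge0.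
(* Covers both losses: B^p for the function, and 2^p (B^p + B^p) for the two terms of the product
   rule; the 1 makes K positive. *)
pose K := 2 `^ p * (Bp + Bp) + Bp + 1.
have K1 : 2 `^ p * (Bp + Bp) <= K.
  by rewrite /K -addrA lerDl addr_ge0.
have K2 : Bp <= K.
  by rewrite /K -addrA [X in _ <= _ + X]addrC addrA lerDr addr_ge0 ?mulr_ge0 ?addr_ge0.
apply: (@Wapprox_intro _ _ _ K).
- by rewrite /K ltr_wpDl// addr_ge0 ?mulr_ge0 ?addr_ge0.
- by apply: (pLpM mO (ltW p0) mc _ up) => x _; exact: cB.
- move=> i; under eq_fun do rewrite E; apply: (pLpD mO (ltW p0)).
    by apply: (pLpM mO (ltW p0) mc _ (Dup i)) => x _; exact: cB.
  by apply: (pLpM mO (ltW p0) (mdc i) _ up) => x _; exact: dcB.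
move=> e e0; have [g Pg [gu gD]] := app e e0.
exists (ch \* g); first exact: PS.
have cu : Lsmall Om p (Bp * e) (fun x => ch x * (u x - g x)).
  by apply: LsmallM gu => // x _; exact: cB.
split=> [|i].
  apply: (@Lsmall_le _ _ _ _ (Bp * e)); first by rewrite ler_wpM2r ?(ltW e0).
  by apply: (Lsmall_eq _ cu) => x /=; ring.
have dcu : Lsmall Om p (Bp * e) (fun x => partial i ch x * (u x - g x)).
  by apply: LsmallM gu => // x _; exact: dcB.
have cDu : Lsmall Om p (Bp * e) (fun x => ch x * (Du x ord0 i - partial i g x)).
  by apply: LsmallM (gD i) => // x _; exact: cB.
apply: (@Lsmall_le _ _ _ _ (2 `^ p * (Bp * e + Bp * e))).
  by rewrite -mulrDl mulrA ler_wpM2r ?(ltW e0).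
apply: (Lsmall_eq _ (LsmallD mO p1 cDu dcu)) => x /=.
rewrite E partialM; [|exact: (Cc 1).1|exact: (PC _ Pg 1).1].
ring.
Qed.

End one_set.

Lemma Rint_subset (A B : set 'rV[R]_n) (f : 'rV[R]_n -> R) : measurable A ->
  measurable B -> A `<=` B -> (forall x, 0 <= f x) -> integ leb B f ->
  integ leb A f /\ \int[leb]_(x in A) f x <= \int[leb]_(x in B) f x.
Proof.
move=> mA mB AB f0 fi; have fA : integ leb A f by apply: integrableS fi.
split => //; rewrite -lee_fin -(Rint_EFin mA fA) -(Rint_EFin mB fi).
apply: ge0_subset_integral => //; last by move=> x _; rewrite lee_fin.
by apply/measurable_EFinP; exact: integ_measurable fi.
Qed.

Lemma pLp_subset (A B : set 'rV[R]_n) p u : measurable A -> measurable B ->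
  A `<=` B -> pLp leb B p u ->
  pLp leb A p u /\
  \int[leb]_(x in A) (`|u x| `^ p) <= \int[leb]_(x in B) (`|u x| `^ p).
Proof.
move=> mA mB AB [mu ui].
have [|ui' le] := Rint_subset mA mB AB _ ui; first by move=> x; exact: powR_ge0.
by split => //; split => //; apply: measurable_funS mu.
Qed.

Lemma Wapprox_subset (A B : set 'rV[R]_n) p P u Du : measurable A ->
  measurable B -> A `<=` B -> Wapprox B p P u Du -> Wapprox A p P u Du.
Proof.
move=> mA mB AB [up Dup app]; split.
- exact: (pLp_subset mA mB AB up).1.
- by move=> i; exact: (pLp_subset mA mB AB (Dup i)).1.
have small e v : Lsmall B p e v -> Lsmall A p e v.
  move=> [vp ve]; have [vp' le] := pLp_subset mA mB AB vp.
  by split => //; exact: le_trans ve.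
move=> e e0; have [g Pg [gu gD]] := app e e0; exists g; first exact: Pg.
by split=> [|i]; [exact: (small _ _ gu)|exact: (small _ _ (gD i))].
Qed.

Section density.
Variables (Om : set 'rV[R]_n) (p q : R).
Hypotheses (mO : measurable Om) (p1 : 1 < p) (q0 : 0 < q) (pq : p^-1 + q^-1 = 1).

Let p0 : 0 < p. Proof. exact: lt_trans p1. Qed.

(** Both sides are continuous in the pair (u, Du) for L^p convergence, the coefficients being in
    L^q. There are n + 1 error terms, each made smaller than e / (n + 1). *)
Lemma Wapprox_identity (a : 'I_n -> 'rV[R]_n -> R) (a0 : 'rV[R]_n -> R) :
  (forall i, pLp leb Om q (a i)) -> pLp leb Om q a0 ->
  (forall phi, test_function Om phi ->
    \int[leb]_(x in Om) (\sum_i a i x * partial i phi x) =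
    \int[leb]_(x in Om) (a0 x * phi x)) ->
  forall u Du, Wapprox Om p (test_function Om) u Du ->
    \int[leb]_(x in Om) (\sum_i a i x * Du x ord0 i) =
    \int[leb]_(x in Om) (a0 x * u x).
Proof.
move=> aq a0q id u Du [up Dup app].
have iM b v : pLp leb Om q b -> pLp leb Om p v -> integ leb Om (fun x => b x * v x).
  exact: integM.
apply/eqP; rewrite -subr_eq0 -normr_eq0 eq_le normr_ge0 andbT.
apply/ler_addgt0Pr => e e0; rewrite add0r.
have N0 : 0 < n%:R + 1 :> R by rewrite ltr_wpDl.
have c0 : 0 < e / (n%:R + 1) by rewrite divr_gt0.
have /choice[d dP] i : exists d : R, 0 < d /\ forall b, pLp leb Om p b ->
    \int[leb]_(x in Om) (`|b x| `^ p) <= d ->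
    `|\int[leb]_(x in Om) (a i x * b x)| <= e / (n%:R + 1).
  by have [d d0 h] := prod_small mO p0 q0 pq (aq i) c0; exists d.
have [d' d'0 d'P] := prod_small mO p0 q0 pq a0q c0.
(* The smallest of the n + 1 tolerances; the default [d'] keeps the minimum positive when n = 0. *)
pose dm := Num.min d' (\big[Order.min/d']_i d i).
have dm0 : 0 < dm.
  by rewrite /dm lt_min d'0; apply: lt_bigmin => // i _; exact: (dP i).1.
have [phi tphi [us Ds]] := app dm dm0.
have dphip i := test_function_pLp mO p1 (test_function_partial i tphi).
have phip := test_function_pLp mO p1 tphi.
have E1 : \int[leb]_(x in Om) (\sum_i a i x * Du x ord0 i) -
    \int[leb]_(x in Om) (\sum_i a i x * partial i phi x) =
    \sum_i \int[leb]_(x in Om) (a i x * (Du x ord0 i - partial i phi x)).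
  rewrite !Rint_sum//; [|by move=> i; exact: iM..].
  rewrite -sumrB; apply: eq_bigr => i _; rewrite -RintB//; [|exact: iM..].
  by apply: eq_Rintegral => x _; rewrite mulrBr.
have E2 : \int[leb]_(x in Om) (a0 x * u x) -
    \int[leb]_(x in Om) (a0 x * phi x) =
    \int[leb]_(x in Om) (a0 x * (u x - phi x)).
  rewrite -RintB//; [|exact: iM..].
  by apply: eq_Rintegral => x _; rewrite mulrBr.
rewrite -[X in X - _](subrK (\int[leb]_(x in Om) (\sum_i a i x * partial i phi x))) E1.
rewrite (id _ tphi) -addrA -[X in _ + X]opprB E2.
apply: le_trans (ler_normB _ _) _.
apply: (@le_trans _ _ (n%:R * (e / (n%:R + 1)) + e / (n%:R + 1))); last first.
  by rewrite -[X in _ + X]mul1r -mulrDl mulrCA mulfV ?gt_eqF// mulr1.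
apply: lerD.
  apply: le_trans (ler_norm_sum _ _ _) _.
  apply: (@le_trans _ _ (\sum_(i < n) e / (n%:R + 1))).
    apply: ler_sum => i _; apply: (dP i).2; first exact: (Ds i).1.
    apply: le_trans (Ds i).2 _; rewrite /dm ge_min; apply/orP; right.
    exact: bigmin_le.
  by rewrite sumr_const card_ord -[(e / _) *+ _]mulr_natl.
apply: d'P; first exact: us.1.
by apply: le_trans us.2 _; rewrite /dm ge_min lexx.
Qed.

End density.

End Wapprox_algebra.

Section lifting.
Context {R : realType} {m k : nat}.
Local Notation leb := (lebesgue_rV R).
Implicit Types (psi : 'rV[R]_k -> R) (phi : 'rV[R]_(m + k) -> R).

Lemma rsubmxE_mul (x : 'rV[R]_(m + k)) : rsubmx x = 0 + x *m col_mx 0 1%:M.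
Proof. by rewrite add0r -{2}(hsubmxK x) mul_row_col mulmx0 add0r mulmx1. Qed.

Lemma row_mxE_mulr (a : 'rV[R]_m) (y : 'rV[R]_k) :
  row_mx a y = row_mx a 0 + y *m row_mx 0 1%:M.
Proof. by rewrite mul_mx_row mulmx0 mulmx1 add_row_mx addr0 add0r. Qed.

Lemma row_mxE_mull (a : 'rV[R]_m) (y : 'rV[R]_k) :
  row_mx a y = row_mx 0 y + a *m row_mx 1%:M 0.
Proof. by rewrite mul_mx_row mulmx0 mulmx1 add_row_mx addr0 add0r. Qed.

Lemma Ck_rsubmx psi : (forall j, Ck j psi) -> forall j, Ck j (psi \o rsubmx : 'rV[R]_(m + k) -> R).
Proof.
move=> Cp j; rewrite (_ : _ \o _ = fun x => psi (0 + x *m col_mx 0 1%:M)).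
  exact: Ck_affine.
by apply/funext => x; rewrite /= rsubmxE_mul.
Qed.

Lemma partial_lsubmx_rsubmx psi i (x : 'rV[R]_(m + k)) :
  partial (lshift k i) (psi \o rsubmx) x = 0.
Proof.
rewrite /partial (@derive_along _ _ _ _ psi rsubmx _ 0) ?derive0// => h.
by apply/rowP => j; rewrite !mxE eqxx /= eq_rlshift.
Qed.

Lemma partial_rsubmx psi j (x : 'rV[R]_(m + k)) :
  partial (rshift m j) (psi \o rsubmx) x = partial j psi (rsubmx x).
Proof.
rewrite /partial (@derive_along _ _ _ _ psi rsubmx _ (delta_mx ord0 j))// => h.
by apply/rowP => i; rewrite !mxE eqxx /= (inj_eq (@rshift_inj _ _)).
Qed.

Lemma partial_row_mxr phi a j (y : 'rV[R]_k) :
  partial j (fun y => phi (row_mx a y)) y = partial (rshift m j) phi (row_mx a y).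
Proof.
apply: (@derive_along _ _ _ _ phi (fun y => row_mx a y)) => h.
apply/rowP => i; rewrite !mxE; case: fintype.splitP => l il.
  have -> : i = lshift k l by exact/val_inj.
  by rewrite eq_lrshift mulr0 add0r.
have -> : i = rshift m l by exact/val_inj.
by rewrite !mxE /= (inj_eq (@rshift_inj _ _)).
Qed.

Lemma partial_row_mxl phi i (a : 'rV[R]_m) (y : 'rV[R]_k) :
  partial i (fun a => phi (row_mx a y)) a = partial (lshift k i) phi (row_mx a y).
Proof.
apply: (@derive_along _ _ _ _ phi (fun a => row_mx a y)) => h.
apply/rowP => j; rewrite !mxE; case: fintype.splitP => l jl.
  have -> : j = lshift k l by exact/val_inj.
  by rewrite !mxE /= (inj_eq (@lshift_inj _ _)).
have -> : j = rshift m l by exact/val_inj.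
by rewrite eq_rlshift mulr0 add0r.
Qed.

Variables (omega1 : set 'rV[R]_m) (omega2 : set 'rV[R]_k).
Local Notation cyl := (cylinder omega1 omega2).

(** The projection of the support of phi to X_2 is a compact subset of omega2 that encloses the
    supports of all slices, for any a whatsoever. *)
Lemma test_function_slicer l phi a : test_function (cyl l) phi ->
  test_function omega2 (fun y => phi (row_mx a y)).
Proof.
move=> [Cphi cphi phiO].
apply: (@test_function_of _ _ _ _ (rsubmx @` tsupport phi)).
- move=> j; under eq_fun do rewrite row_mxE_mulr; exact: Ck_affine.
- apply: continuous_compact => //; apply: continuous_subspaceT.
  exact: continuous_rsubmx.
- by move=> _ [x tx <-]; have [] := phiO x tx.
- move=> y yn; exists (row_mx a y); last by rewrite row_mxKr.
  exact: tsupport_neq0.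
Qed.

Lemma test_function_slicel l phi (y : 'rV[R]_k) : test_function (cyl l) phi ->
  test_function setT (fun a : 'rV[R]_m => phi (row_mx a y)).
Proof.
move=> [Cphi cphi phiO].
apply: (@test_function_of _ _ _ _ (lsubmx @` tsupport phi)) => //.
- move=> j; under eq_fun do rewrite row_mxE_mull; exact: Ck_affine.
- apply: continuous_compact => //; apply: continuous_subspaceT.
  exact: continuous_lsubmx.
- move=> a an; exists (row_mx a y); last by rewrite row_mxKl.
  exact: tsupport_neq0.
Qed.

Hypotheses (omega1_open : open omega1) (omega2_open : open omega2).
Variables (M l p q : R).
Hypotheses (M0 : 0 <= M) (omega1_M : forall x, omega1 x -> `|x| <= M) (l0 : 0 < l)
  (p1 : 1 < p) (q1 : 1 < q) (pq : p^-1 + q^-1 = 1).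

Let p0 : 0 < p. Proof. exact: lt_trans p1. Qed.
Let q0 : 0 < q. Proof. exact: lt_trans q1. Qed.
Let mO := measurable_cylinder omega1_open omega2_open l0.
Let mO2 : measurable omega2. Proof. exact: open_measurable_rV. Qed.

(** Moves the integral to the whole space, where Fubini is available: phi vanishes off the cylinder,
    so extending a by zero outside omega2 is the same as restricting the product to the cylinder. *)
Lemma lift_term (a : 'rV[R]_k -> R) phi : pLp (leb k) omega2 q a ->
  test_function (cyl l) phi ->
  integ (leb (m + k)) setT (fun x => (a \_ omega2) (rsubmx x) * phi x) /\
  \int[leb (m + k)]_(x in cyl l) (a (rsubmx x) * phi x) =
  \int[leb (m + k)]_x ((a \_ omega2) (rsubmx x) * phi x).
Proof.
move=> aq tphi.
have [aq' _] := cylinder_pLp omega1_open omega2_open M0 omega1_M l0 aq.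
have iphi := integM mO p0 q0 pq aq' (test_function_pLp mO p1 tphi).
have E : (fun x => (a \_ omega2) (rsubmx x) * phi x) =
    (fun x => a (rsubmx x) * phi x) \_ (cyl l).
  apply/funext => x; rewrite [RHS]patchE; case: ifPn => [xc|/negP ox].
    by have [_ ox2] := set_mem xc; rewrite patchE mem_set.
  by rewrite (test_function_out tphi) ?mulr0// => /mem_set.
split; last by rewrite Rintegral_mkcond E.
rewrite E; move/(integrable_mkcond _ mO): iphi.
by rewrite /integ restrict_EFin.
Qed.

(* For fixed [a], [y |-> phi (row_mx a y)] is a test function of omega2, and the
   derivatives along X_1 integrate to 0 because [A i] does not depend on X_1. *)
Lemma lift_identity (A : 'I_(m + k) -> 'rV[R]_k -> R) (f : 'rV[R]_k -> R) phi :
  (forall i, pLp (leb k) omega2 q (A i)) -> pLp (leb k) omega2 q f ->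
  (forall psi, test_function omega2 psi ->
    \int[leb k]_(y in omega2) (\sum_j A (rshift m j) y * partial j psi y) =
    \int[leb k]_(y in omega2) (f y * psi y)) ->
  test_function (cyl l) phi ->
  \int[leb (m + k)]_(x in cyl l) (\sum_i A i (rsubmx x) * partial i phi x) =
  \int[leb (m + k)]_(x in cyl l) (f (rsubmx x) * phi x).
Proof.
move=> Aq fq id tphi.
have td i := test_function_partial i tphi.
have T i := lift_term (Aq i) (td i).
have Tf := lift_term fq tphi.
have iA i : integ (leb (m + k)) (cyl l) (fun x => A i (rsubmx x) * partial i phi x).
  apply: (integM mO p0 q0 pq); last exact: test_function_pLp.
  exact: (cylinder_pLp omega1_open omega2_open M0 omega1_M l0 (Aq i)).1.
rewrite Rint_sum// big_split_ord /= [X in X + _]big1 ?add0r; last first.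
  move=> i _; rewrite (T (lshift k i)).2 /Rintegral.
  rewrite fubini_row_mx2; last exact: (T (lshift k i)).1.
  rewrite integral0_eq// => y _.
  under eq_integral do rewrite row_mxKr -partial_row_mxl.
  pose c := (A (lshift k i) \_ omega2) y.
  have ts := test_functionM (fun j => @Ck_cst R m j c) (test_function_slicel y tphi).
  rewrite -[RHS](test_function_integral_partial i ts).
  apply: eq_integral => x _; congr EFin.
  have [Cs _ _] := test_function_slicel y tphi.
  by rewrite partialM ?partial_cst ?mulr0 ?addr0//; exact: (Cs 1).1.
rewrite Tf.2; under eq_bigr do rewrite (T _).2.
rewrite -Rint_sum//; last by move=> j; exact: (T _).1.
have iS : integ (leb (m + k)) setT (fun x => \sum_(j < k)
    (A (rshift m j) \_ omega2) (rsubmx x) * partial (rshift m j) phi x).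
  by apply: integ_sum => // j; exact: (T _).1.
apply/eqP; rewrite -subr_eq0 -RintB//; last exact: Tf.1.
apply/eqP; rewrite /Rintegral fubini_row_mx; last exact: (integB measurableT iS Tf.1).
rewrite integral0_eq// => x _.
pose psi y := phi (row_mx x y).
have tpsi : test_function omega2 psi by exact: test_function_slicer tphi.
have psip := test_function_pLp mO2 p1 tpsi.
have dpsip j := test_function_pLp mO2 p1 (test_function_partial j tpsi).
have i1 : integ (leb k) omega2 (fun y => \sum_j A (rshift m j) y * partial j psi y).
  by apply: integ_sum => // j; exact: (integM mO2 p0 q0 pq).
have i2 : integ (leb k) omega2 (fun y => f y * psi y).
  exact: (integM mO2 p0 q0 pq).
transitivity ((\int[leb k]_(y in omega2)
   (\sum_j A (rshift m j) y * partial j psi y - f y * psi y)%:E)%E).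
  rewrite [RHS]integral_mkcond; apply: eq_integral => y _.
  rewrite row_mxKr !patchE.
  under eq_bigr do rewrite patchE -partial_row_mxr.
  case: ifP => // _; rewrite mul0r subr0 big1// => j _.
  by rewrite mul0r.
rewrite Rint_EFin//; last exact: integB.
by rewrite RintB// id// subrr.
Qed.

(** The lifted approximants have no compact support in X_1, so the lift is claimed for a class Q of
    its own and not for test functions of the cylinder. The factor K grows with l, which is harmless
    because it affects the approximation only. *)
Lemma Wapprox_lift (P : ('rV[R]_k -> R) -> Prop) (Q : ('rV[R]_(m + k) -> R) -> Prop) v Dv :
  (forall psi, P psi -> Q (psi \o rsubmx)) ->
  Wapprox omega2 p P v Dv ->
  Wapprox (cyl l) p Q (v \o rsubmx) (fun x => row_mx 0 (Dv (rsubmx x))).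
Proof.
move=> PQ [vp Dvp app].
have L := cylinder_pLp omega1_open omega2_open M0 omega1_M l0.
pose K := (2 * (M * l)) ^+ m + 1; have K0 : 0 < K.
  by rewrite ltr_wpDl// exprn_ge0// mulr_ge0// mulr_ge0// ltW.
have Ll (x : 'rV[R]_(m + k)) i : row_mx (0 : 'rV[R]_m) (Dv (rsubmx x)) ord0 (lshift k i) = 0.
  by rewrite row_mxEl mxE.
have Lr (x : 'rV[R]_(m + k)) j : row_mx (0 : 'rV[R]_m) (Dv (rsubmx x)) ord0 (rshift m j) = Dv (rsubmx x) ord0 j.
  by rewrite row_mxEr.
have z : pLp (leb (m + k)) (cyl l) p (fun=> 0).
  split => //; rewrite /integ; under eq_fun do rewrite normr0 powR0 ?gt_eqF//.
  exact: integ0.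
have ismall e w : 0 < e -> Lsmall omega2 p e w -> Lsmall (cyl l) p (K * e) (w \o rsubmx).
  move=> e0 [wp we]; have [wp' le] := L p w wp; split => //.
  apply: le_trans le _; apply: ler_pM => //; last by rewrite /K lerDl.
    by rewrite exprn_ge0// mulr_ge0// mulr_ge0// ltW.
  by apply: Rint_ge0 => y _; exact: powR_ge0.
apply: (@Wapprox_intro _ _ _ _ _ _ _ K) => //.
- exact: (L _ _ vp).1.
- move=> i; case: (fintype.splitP i) => j ij.
    have -> : i = lshift k j by exact/val_inj.
    by under eq_fun do rewrite Ll.
  have -> : i = rshift m j by exact/val_inj.
  under eq_fun do rewrite Lr; exact: (L _ _ (Dvp j)).1.
move=> e e0; have [psi Ppsi [us Ds]] := app e e0.
exists (psi \o rsubmx); first exact: PQ.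
split; first exact: ismall us.
move=> i; case: (fintype.splitP i) => j ij.
  have -> : i = lshift k j by exact/val_inj.
  apply: (@Lsmall_eq _ _ _ _ _ (fun=> 0)).
    by move=> x; rewrite Ll partial_lsubmx_rsubmx subrr.
  split => //; under eq_Rintegral do rewrite normr0 powR0 ?gt_eqF//.
  by rewrite Rint_zero mulr_ge0// ltW.
have -> : i = rshift m j by exact/val_inj.
apply: (Lsmall_eq _ (ismall _ _ e0 (Ds j))) => x /=.
by rewrite Lr partial_rsubmx.
Qed.

End lifting.

(** * The two equations in the cylinder *)

Section flux_integrability.
Context {R : realType} {m k : nat}.
Local Notation leb := (lebesgue_rV R).
Variables (p : R) (H : 'rV[R]_(m + k) -> R).
Hypotheses (p1 : 1 < p) (H_ge0 : forall x, 0 <= H x)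
  (H_convex : convex_function setT H)
  (H_homogeneous : forall t x, H (t *: x) = `|t| * H x)
  (H_C1 : forall x, x != 0 ->
     differentiable H x /\ {for x, continuous (grad H)}).

Let p0 : 0 < p. Proof. exact: lt_trans p1. Qed.
Let q := p / (p - 1).

Lemma powR_flux_le z i : `|flux p H z ord0 i| `^ q <= Cflux p H `^ q * enorm z `^ p.
Proof.
have q0 : 0 <= q by rewrite divr_ge0 ?subr_ge0 ?ltW.
have -> : enorm z `^ p = (enorm z `^ (p - 1)) `^ q.
  by rewrite -powRrM /q mulrC divfK// gt_eqF// subr_gt0.
have C0 := Cflux_ge0 p H_ge0.
rewrite -powRM ?powR_ge0//.
apply: ge0_ler_powR; rewrite ?nnegrE; [exact: q0|exact: normr_ge0| |exact: flux_le].
by apply: mulr_ge0 => //; exact: powR_ge0.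
Qed.

Lemma flux_pLp n (Om : set 'rV[R]_n) (F : 'rV[R]_n -> 'rV[R]_(m + k)) i :
  measurable Om -> (forall j, measurable_fun Om (fun x => F x ord0 j)) ->
  integ (leb n) Om (fun x => enorm (F x) `^ p) ->
  pLp (leb n) Om q (fun x => flux p H (F x) ord0 i).
Proof.
move=> mO mF iF.
apply: (@pLp_of_integ _ _ _ (leb n) Om mO _ _ (fun x => Cflux p H `^ q * enorm (F x) `^ p)).
- exact: measurable_flux_comp.
- by move=> x _; exact: powR_flux_le.
- exact: integZ.
Qed.

End flux_integrability.

Section row_mx_zero.
Context {R : realType} {m k : nat}.

Lemma enorm_row_mx0 (v : 'rV[R]_k) : enorm (row_mx (0 : 'rV[R]_m) v) = enorm v.
Proof.
rewrite /enorm /dot big_split_ord /= big1 ?add0r; last first.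
  by move=> i _; rewrite row_mxEl mxE mul0r.
by congr Num.sqrt; apply: eq_bigr => i _; rewrite row_mxEr.
Qed.

Lemma measurable_row_mx0 d (T : measurableType d) (D : set T) (F : T -> 'rV[R]_k) :
  measurable D -> (forall j, measurable_fun D (fun x => F x ord0 j)) ->
  forall i, measurable_fun D (fun x => row_mx (0 : 'rV[R]_m) (F x) ord0 i).
Proof.
move=> mD mF i; case: (fintype.splitP i) => j ij.
  have -> : i = lshift k j by exact/val_inj.
  by under eq_fun do rewrite row_mxEl mxE; exact: measurable_cst.
have -> : i = rshift m j by exact/val_inj.
by under eq_fun do rewrite row_mxEr; exact: mF.
Qed.

End row_mx_zero.

Lemma dotZl {R : realType} {n} (t : R) (x y : 'rV[R]_n) : dot (t *: x) y = t * dot x y.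
Proof. by rewrite /dot mulr_sumr; apply: eq_bigr => i _; rewrite !mxE mulrA. Qed.

Lemma Wapprox_self {R : realType} {n} (Om : set 'rV[R]_n) (p : R) phi :
  measurable Om -> 1 < p -> test_function Om phi ->
  Wapprox Om p (test_function Om) phi (grad phi).
Proof.
move=> mO p1 tphi; have p0 : 0 < p by exact: lt_trans p1.
have z e : 0 < e -> Lsmall Om p e (fun=> 0).
  move=> e0; split.
    split => //; rewrite /integ; under eq_fun do rewrite normr0 powR0 ?gt_eqF//.
    exact: integ0.
  under eq_Rintegral do rewrite normr0 powR0 ?gt_eqF//.
  by rewrite Rint_zero ltW.
split.
- exact: test_function_pLp.
- move=> i; under eq_fun do rewrite mxE.
  by apply: test_function_pLp => //; exact: test_function_partial.
- move=> e e0; exists phi => //; split=> [|i].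
    by apply: (Lsmall_eq _ (z e e0)) => x; rewrite subrr.
  by apply: (Lsmall_eq _ (z e e0)) => x; rewrite mxE subrr.
Qed.

Lemma test_function_grad_bounded {R : realType} {n} (Om : set 'rV[R]_n) f :
  test_function Om f ->
  exists2 B : R, 0 < B & forall i x, `|partial i f x| <= B.
Proof.
move=> tf; have /choice[B BP] i : exists B : R, 0 < B /\ forall x, `|partial i f x| <= B.
  by have [B] := test_function_bounded (test_function_partial i tf); exists B.
exists (\sum_i B i + 1) => [|i x].
  by rewrite ltr_wpDl// sumr_ge0// => i _; exact/ltW/(BP i).1.
apply: le_trans ((BP i).2 x) _.
rewrite (bigD1 i)//= -addrA lerDl addr_ge0// sumr_ge0// => j _.
exact/ltW/(BP j).1.
Qed.

Section problems.
Context {R : realType} {m k : nat}.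
Local Notation leb := (lebesgue_rV R).
Variables (omega1 : set 'rV[R]_m) (omega2 : set 'rV[R]_k) (M p : R)
  (H : 'rV[R]_(m + k) -> R) (f : 'rV[R]_k -> R)
  (w0 : 'rV[R]_k -> R) (Dw0 : 'rV[R]_k -> 'rV[R]_k).
Hypotheses (omega1_open : open omega1) (omega1_convex : convex_set omega1)
  (omega1_0 : omega1 0) (omega2_open : open omega2) (M0 : 0 <= M)
  (omega1_M : forall x, omega1 x -> `|x| <= M)
  (omega2_M : forall y, omega2 y -> `|y| <= M)
  (p1 : 1 < p) (H_ge0 : forall x, 0 <= H x)
  (H_convex : convex_function setT H)
  (H_homogeneous : forall t x, H (t *: x) = `|t| * H x)
  (H_C1 : forall x, x != 0 ->
     differentiable H x /\ {for x, continuous (grad H)}).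

Local Notation cyl := (cylinder omega1 omega2).
Local Notation A := (flux p H).
Local Notation q := (p / (p - 1)).
Local Notation lift0 v := (row_mx (0 : 'rV[R]_m) v).

Let p0 : 0 < p. Proof. exact: lt_trans p1. Qed.
Let q1 : 1 < q.
Proof. exact: conjugate_exponent_gt1. Qed.
Let q0 : 0 < q. Proof. exact: lt_trans q1. Qed.
Let pq : p^-1 + q^-1 = 1.
Proof. exact: conjugate_exponentE. Qed.
Let mO l (l0 : 0 < l) := measurable_cylinder omega1_open omega2_open l0.
Let mO2 : measurable omega2. Proof. exact: open_measurable_rV. Qed.

Hypothesis f_q : pLp (leb k) omega2 q f.

(** The weak formulation with [Wapprox] in place of [W1p0], the form in which test pairs are
    obtained by multiplying approximants with a cutoff. *)
Definition solves l (u : 'rV[R]_(m + k) -> R) (Du : 'rV[R]_(m + k) -> 'rV[R]_(m + k)) :=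
  Wapprox (cyl l) p (test_function (cyl l)) u Du /\
  forall phi Dphi, Wapprox (cyl l) p (test_function (cyl l)) phi Dphi ->
    \int[leb (m + k)]_(x in cyl l) dot (A (Du x)) (Dphi x) =
    \int[leb (m + k)]_(x in cyl l) (f (rsubmx x) * phi x).

Hypothesis w0_W : Wapprox omega2 p (test_function omega2) w0 Dw0.
Hypothesis w0_eq : forall psi, test_function omega2 psi ->
  \int[leb k]_(y in omega2)
    (\sum_j A (lift0 (Dw0 y)) ord0 (rshift m j) * partial j psi y) =
  \int[leb k]_(y in omega2) (f y * psi y).

Lemma weak_solution_solves l u Du : 0 < l ->
  weak_solution p H f (cyl l) u Du -> solves l u Du.
Proof.
move=> l0 [uW ueq]; split; first exact: (W1p0_Wapprox (mO l0) p1 uW).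
move=> phi Dphi phiW; rewrite -(ueq phi Dphi); last exact: (Wapprox_W1p0 (mO l0) p1 phiW).
by apply: eq_Rintegral => x _; rewrite dotZl.
Qed.

Lemma w0_integ : integ (leb k) omega2 (fun y => enorm (lift0 (Dw0 y)) `^ p).
Proof.
have [_ Dw0p _] := w0_W; have [_] := pLp_enorm mO2 p1 Dw0p.
rewrite /integ; congr (_.-integrable _ _); apply/funext => y /=.
by rewrite enorm_row_mx0 ger0_norm// enorm_ge0.
Qed.

Lemma A0_pLp i : pLp (leb k) omega2 q (fun y => A (lift0 (Dw0 y)) ord0 i).
Proof.
have [_ Dw0p _] := w0_W; apply: flux_pLp => //; last exact: w0_integ.
by apply: measurable_row_mx0 => // j; exact: (Dw0p j).1.
Qed.

Section fixed_l.
Variable l : R.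
Hypothesis l0 : 0 < l.

Lemma integ_enorm (Du : 'rV[R]_(m + k) -> 'rV[R]_(m + k)) : (forall i, pLp (leb (m + k)) (cyl l) p (fun x => Du x ord0 i)) ->
  integ (leb (m + k)) (cyl l) (fun x => enorm (Du x) `^ p).
Proof.
move=> Dup; have [_] := pLp_enorm (mO l0) p1 Dup.
rewrite /integ; congr (_.-integrable _ _); apply/funext => y /=.
by rewrite ger0_norm// enorm_ge0.
Qed.

Lemma A_pLp u Du i : Wapprox (cyl l) p (test_function (cyl l)) u Du ->
  pLp (leb (m + k)) (cyl l) q (fun x => A (Du x) ord0 i).
Proof.
move=> [_ Dup _]; apply: (flux_pLp p1 H_ge0 H_convex H_homogeneous H_C1 _ (mO l0)).
  by move=> j; exact: (Dup j).1.
exact: integ_enorm.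
Qed.

Lemma lifted_A0_pLp i :
  pLp (leb (m + k)) (cyl l) q (fun x => A (lift0 (Dw0 (rsubmx x))) ord0 i).
Proof.
exact: (cylinder_pLp omega1_open omega2_open M0 omega1_M l0 (A0_pLp i)).1.
Qed.

Lemma f_cyl_pLp : pLp (leb (m + k)) (cyl l) q (fun x => f (rsubmx x)).
Proof. exact: (cylinder_pLp omega1_open omega2_open M0 omega1_M l0 f_q).1. Qed.

(** [lift_identity] settles test functions; density does the rest, since the lifted flux and f are
    in L^q of the cylinder. *)
Lemma lifted_w0_eq phi Dphi : Wapprox (cyl l) p (test_function (cyl l)) phi Dphi ->
  \int[leb (m + k)]_(x in cyl l) dot (A (lift0 (Dw0 (rsubmx x)))) (Dphi x) =
  \int[leb (m + k)]_(x in cyl l) (f (rsubmx x) * phi x).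
Proof.
apply: (@Wapprox_identity _ _ _ _ _ (mO l0) p1 q0 pq
  (fun i x => A (lift0 (Dw0 (rsubmx x))) ord0 i)).
- exact: lifted_A0_pLp.
- exact: f_cyl_pLp.
- move=> psi tpsi.
  exact: (lift_identity omega1_open omega2_open M0 omega1_M l0 p1 q1 pq A0_pLp f_q).
Qed.

Lemma flux_difference_orthogonal u Du phi Dphi : solves l u Du ->
  Wapprox (cyl l) p (test_function (cyl l)) phi Dphi ->
  integ (leb (m + k)) (cyl l)
    (fun x => dot (A (Du x) - A (lift0 (Dw0 (rsubmx x)))) (Dphi x)) /\
  \int[leb (m + k)]_(x in cyl l)
    dot (A (Du x) - A (lift0 (Dw0 (rsubmx x)))) (Dphi x) = 0.
Proof.
move=> [uW ueq] phiW; have [_ Dphip _] := phiW.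
have i1 : integ (leb (m + k)) (cyl l) (fun x => dot (A (Du x)) (Dphi x)).
  apply: integ_sum (mO l0) _ _ _ _ => i.
  exact: (integM (mO l0) p0 q0 pq (A_pLp i uW) (Dphip i)).
have i2 : integ (leb (m + k)) (cyl l)
    (fun x => dot (A (lift0 (Dw0 (rsubmx x)))) (Dphi x)).
  apply: integ_sum (mO l0) _ _ _ _ => i.
  exact: (integM (mO l0) p0 q0 pq (lifted_A0_pLp i) (Dphip i)).
have E x : dot (A (Du x) - A (lift0 (Dw0 (rsubmx x)))) (Dphi x) =
    dot (A (Du x)) (Dphi x) - dot (A (lift0 (Dw0 (rsubmx x)))) (Dphi x).
  exact: dotBl.
split; first by rewrite /integ; under eq_fun do rewrite E; exact: (integB (mO l0) i1 i2).
under eq_Rintegral do rewrite E.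
by rewrite (RintB (mO l0) i1 i2) (ueq _ _ phiW) (lifted_w0_eq phiW) subrr.
Qed.

End fixed_l.

Section energy.
Variable c : R.
Hypotheses (c0 : 0 < c) (coercive : forall z, c * enorm z `^ p <= dot (A z) z).
Hypothesis k_gt0 : (0 < k)%N.

Let j0 : 'I_k := Ordinal k_gt0.

Lemma cyl_slab l x : cyl l x -> `|x ord0 (rshift m j0)| <= M.
Proof.
move=> [_ /omega2_M yM]; apply: le_trans yM.
by have := ler_rV_norm (rsubmx x) j0; rewrite mxE.
Qed.

(** The equation is tested with u itself. Coercivity bounds the left side from below; on the right,
    Young and Poincare return half of it, and the integral of |f|^q over the cylinder supplies
    l^m. *)
Lemma energy_solution : exists2 E : R, 0 < E & forall l u Du, 0 < l ->
  solves l u Du ->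
  \int[leb (m + k)]_(x in cyl l) (enorm (Du x) `^ p) <= E * l ^+ m.
Proof.
have [CP CP0 CPP] := poincare (n := m + k) p1 M.
have qp : q^-1 + p^-1 = 1 by rewrite addrC.
(* After Poincare the term in |u|^p weighs c / (2 CP) times CP, that is c/2: half of the coercivity
   constant. *)
have t0 : 0 < c / (2 * CP) by rewrite divr_gt0// mulr_gt0.
have [C C0 Ch] := young_eps q0 p0 qp t0.
pose F := \int[leb k]_(y in omega2) (`|f y| `^ q).
have F0 : 0 <= F by apply: Rint_ge0 => y _; exact: powR_ge0.
exists (2 * C * (2 * M) ^+ m * F / c + 1) => [|l u Du l0 us].
  by rewrite ltr_wpDl// divr_ge0 ?mulr_ge0 ?exprn_ge0 ?mulr_ge0 ?(ltW C0) ?(ltW c0).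
have [uW ueq] := us; have [up Dup _] := uW.
have := ueq u Du uW.
have i1 : integ (leb (m + k)) (cyl l) (fun x => dot (A (Du x)) (Du x)).
  apply: integ_sum (mO l0) _ _ _ _ => i.
  exact: (integM (mO l0) p0 q0 pq (A_pLp l0 i uW) (Dup i)).
have i2 := integM (mO l0) p0 q0 pq (f_cyl_pLp l0) up.
have ie := integ_enorm l0 Dup.
have [fl fle] := cylinder_pLp omega1_open omega2_open M0 omega1_M l0 f_q.
have h1 : c * \int[leb (m + k)]_(x in cyl l) (enorm (Du x) `^ p) <=
    \int[leb (m + k)]_(x in cyl l) dot (A (Du x)) (Du x).
  rewrite -(RintZ (mO l0) _ ie); apply: (le_Rint (mO l0)) => //.
  exact: (integZ (mO l0)).
have h2 : \int[leb (m + k)]_(x in cyl l) (f (rsubmx x) * u x) <=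
    c / (2 * CP) * \int[leb (m + k)]_(x in cyl l) (`|u x| `^ p) +
    C * \int[leb (m + k)]_(x in cyl l) (`|f (rsubmx x)| `^ q).
  rewrite -(RintZ (mO l0) _ up.2) -(RintZ (mO l0) _ fl.2).
  rewrite -(RintD (mO l0)); [|exact: (integZ (mO l0) _ up.2)|exact: (integZ (mO l0) _ fl.2)].
  apply: (le_Rint (mO l0)) => //.
    by apply: (integD (mO l0)); [exact: (integZ (mO l0) _ up.2)|exact: (integZ (mO l0) _ fl.2)].
  move=> x _; apply: le_trans (ler_norm _) _; rewrite mulrC; exact: Ch.
have h3 := CPP _ _ (mO l0) (@cyl_slab l) u Du uW.
have h4 : \int[leb (m + k)]_(x in cyl l) (`|Du x ord0 (rshift m j0)| `^ p) <=
    \int[leb (m + k)]_(x in cyl l) (enorm (Du x) `^ p).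
  apply: (le_Rint (mO l0)) => //; first exact: (Dup _).2.
  move=> x _; apply: ge0_ler_powR; rewrite ?nnegrE ?enorm_ge0 ?(ltW p0)//.
  exact: coord_le_enorm.
move=> eqE; move: h1 h2 h3 h4 fle; rewrite eqE -/F.
set X := \int[leb (m + k)]_(x in cyl l) (enorm (Du x) `^ p).
set fu := \int[leb (m + k)]_(x in cyl l) (f (rsubmx x) * u x).
set U := \int[leb (m + k)]_(x in cyl l) (`|u x| `^ p).
set V := \int[leb (m + k)]_(x in cyl l) (`|Du x ord0 _| `^ p).
set G := \int[leb (m + k)]_(x in cyl l) (`|f (rsubmx x)| `^ q).
move=> h1 h2 h3 h4 h5; clearbody X fu U V G F.
have h6 : c / (2 * CP) * U <= c / 2 * X.
  apply: (@le_trans _ _ (c / (2 * CP) * (CP * X))).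
    rewrite ler_wpM2l ?(ltW t0)//; apply: le_trans h3 _.
    by rewrite ler_wpM2l ?(ltW CP0).
  by rewrite le_eqVlt; apply/orP; left; apply/eqP; field; rewrite gt_eqF.
have h7 : C * G <= C * ((2 * M) ^+ m * l ^+ m * F).
  by rewrite ler_wpM2l ?(ltW C0)//; apply: le_trans h5 _; rewrite mulrA exprMn.
have h8 : c * X <= 2 * C * (2 * M) ^+ m * F * l ^+ m.
  lra.
apply: (@le_trans _ _ (2 * C * (2 * M) ^+ m * F / c * l ^+ m)); last first.
  by rewrite ler_wpM2r ?exprn_ge0 ?(ltW l0)// lerDl.
by rewrite mulrAC ler_pdivlMr// mulrC.
Qed.

Lemma energy_section : exists2 E : R, 0 < E & forall l, 0 < l ->
  \int[leb (m + k)]_(x in cyl l) (enorm (lift0 (Dw0 (rsubmx x))) `^ p) <=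
  E * l ^+ m.
Proof.
pose F := \int[leb k]_(y in omega2) (enorm (lift0 (Dw0 y)) `^ p).
have F0 : 0 <= F by apply: Rint_ge0 => y _; exact: powR_ge0.
exists ((2 * M) ^+ m * F + 1) => [|l l0].
  by rewrite ltr_wpDl// mulr_ge0 ?exprn_ge0 ?mulr_ge0.
have [|_ h] := cylinder_integ omega1_open omega2_open M0 omega1_M l0 _ w0_integ.
  by move=> y _; exact: powR_ge0.
apply: le_trans h _; rewrite -/F.
have -> : (2 * (M * l)) ^+ m * F = (2 * M) ^+ m * F * l ^+ m by rewrite mulrA exprMn; ring.
by rewrite ler_wpM2r ?exprn_ge0 ?(ltW l0)// lerDl.
Qed.

End energy.

End problems.

(** * Localized estimates *)

Section powR_interpolation.
Context {R : realType}.
Variable p : R.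
Hypotheses (p1 : 1 < p) (p2 : p < 2).

Let p0 : 0 < p. Proof. exact: lt_trans p1. Qed.

(* Compare [e] with [lam^(-1/(2-p)) S]. *)
Lemma powR_interpolate (e S lam : R) : 0 <= e -> e <= S -> 0 < lam ->
  e `^ p <= lam * (e ^+ 2 * S `^ (p - 2)) + lam `^ (- (p / (2 - p))) * S `^ p.
Proof.
move=> e0 eS lam0; have := e0; rewrite le_eqVlt => /predU1P[<-|e_gt0].
  by rewrite powR0 ?gt_eqF// addr_ge0// mulr_ge0 ?powR_ge0 ?mulr_ge0 ?powR_ge0 ?exprn_ge0// ltW.
have S0 : 0 < S by exact: lt_le_trans eS.
have p20 : 0 < 2 - p by rewrite subr_gt0.
pose tau := lam `^ (- (2 - p)^-1); have tau0 : 0 < tau by exact: powR_gt0.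
(* If e >= tau S, then e^(2-p) >= S^(2-p) / lam, so the first term alone dominates e^p; otherwise
   e^p <= tau^p S^p, which is the second term. *)
have [tS|tS] := leP (tau * S) e.
  rewrite -[leLHS]addr0 lerD ?mulr_ge0 ?powR_ge0//.
  have h : lam^-1 * S `^ (2 - p) <= e `^ (2 - p).
    have -> : lam^-1 = tau `^ (2 - p).
      by rewrite /tau -powRrM mulNr mulVf ?gt_eqF// powR_inv1// ltW.
    rewrite -powRM ?(ltW tau0) ?(ltW S0)//.
    by apply: ge0_ler_powR; rewrite ?nnegrE ?(ltW p20) ?mulr_ge0 ?(ltW tau0) ?(ltW S0).
  have -> : e ^+ 2 = e `^ p * e `^ (2 - p).
    by rewrite -powRD ?(gt_eqF e_gt0) ?implybT// addrC subrK powR_mulrn.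
  rewrite [leLHS](_ : _ = e `^ p * (lam * (lam^-1 * S `^ (2 - p)) * S `^ (p - 2))); last first.
    have hS : S `^ (2 - p) * S `^ (p - 2) = 1.
      by rewrite -powRD ?(gt_eqF S0) ?implybT// addrC addrA subrK subrr powRr0.
    rewrite -[LHS]mulr1 -[in LHS]hS.
    by move: (S `^ _) (S `^ _) => a b; field; rewrite gt_eqF.
  rewrite [leRHS](_ : _ = e `^ p * (lam * e `^ (2 - p) * S `^ (p - 2))); last by ring.
  by rewrite ler_wpM2l ?powR_ge0// ler_wpM2r ?powR_ge0// ler_wpM2l// ltW.
rewrite -[leLHS]add0r lerD ?mulr_ge0 ?powR_ge0 ?exprn_ge0 ?(ltW lam0)//.
have -> : lam `^ (- (p / (2 - p))) = tau `^ p.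
  by rewrite /tau -powRrM mulNr mulrC.
rewrite -powRM ?(ltW tau0) ?(ltW S0)//.
by apply: ge0_ler_powR; rewrite ?nnegrE ?(ltW p0) ?mulr_ge0 ?(ltW tau0) ?(ltW S0)// ltW.
Qed.

(** For S > 0 the quotient of the two sides is (d / S)^(q-2) with q = p/(p-1), and q > 2 because p <
    2. Combined with condition (iii), it bounds |a|^q by a multiple of the monotonicity
    integrand. *)
Lemma powR_conj_le (d S : R) : 0 <= d -> d <= S ->
  (d * S `^ (p - 2)) `^ (p / (p - 1)) <= d ^+ 2 * S `^ (p - 2).
Proof.
move=> d0 dS; set q := p / (p - 1).
have p10 : 0 < p - 1 by rewrite subr_gt0.
have q2 : 2 < q by rewrite /q ltr_pdivlMr// mulrBr mulr1 ltrBlDr mulr_natl mulr2n ltrD2l.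
have := d0; rewrite le_eqVlt => /predU1P[<-|d_gt0].
  by rewrite mul0r powR0 ?expr0n ?mul0r// gt_eqF// (lt_trans _ q2).
have S0 : 0 < S by exact: lt_le_trans dS.
rewrite powRM ?powR_ge0//.
have -> : d `^ q = d ^+ 2 * d `^ (q - 2).
  by rewrite -powR_mulrn// -powRD ?(gt_eqF d_gt0) ?implybT// addrC subrK.
rewrite -mulrA ler_wpM2l ?exprn_ge0//.
rewrite [leRHS](_ : _ = S `^ (q - 2) * (S `^ (p - 2)) `^ q); last first.
  rewrite -powRrM -powRD ?(gt_eqF S0) ?implybT//; congr (_ `^ _).
  by rewrite /q; field; rewrite gt_eqF.
rewrite ler_wpM2r ?powR_ge0//.
by apply: ge0_ler_powR; rewrite ?nnegrE ?(ltW S0)// subr_ge0 ltW.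
Qed.

End powR_interpolation.

(** * The cutoff in the variables X_1 *)

Section cutoff.
Context {R : realType} {m k : nat}.
Variables (omega1 : set 'rV[R]_m) (omega2 : set 'rV[R]_k) (M : R).
Hypotheses (omega1_open : open omega1) (omega1_convex : convex_set omega1)
  (omega1_0 : omega1 0) (omega2_open : open omega2) (M0 : 0 <= M)
  (omega1_M : forall x, omega1 x -> `|x| <= M)
  (omega2_M : forall y, omega2 y -> `|y| <= M).

Local Notation cyl := (cylinder omega1 omega2).

(** K is the closure of omega1 / 2. A limit point z close to x/2 equals x/2 plus half of 2 (z -
    x/2); the latter vector is small, hence in the open set omega1 around 0, and convexity puts z in
    omega1. *)
Lemma half_compact : exists2 K : set 'rV[R]_m, compact K /\ K `<=` omega1 &
  forall x, omega1 x -> K (2^-1 *: x).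
Proof.
pose K := closure [set 2^-1 *: x | x in omega1].
have K1 : K `<=` omega1.
  move=> z Kz; have /nbhs_ballP[e /= e0 eo] : nbhs (0 : 'rV[R]_m) omega1.
    exact: open_nbhs_nbhs.
  have e2 : 0 < e / 2 by rewrite divr_gt0.
  have [_ [[x ox <-]]] := Kz _ (nbhsx_ballx z _ e2).
  rewrite -ball_normE /= => zx.
  rewrite [z](_ : _ = 2^-1 *: x + 2^-1 *: (2 *: (z - 2^-1 *: x))); last first.
    by rewrite scalerA mulVf// scale1r addrC subrK.
  apply: omega1_half => //; apply: eo; rewrite -ball_normE /= sub0r normrN.
  by rewrite normrZ ger0_norm// mulrC -ltr_pdivlMr.
exists K; last by move=> x ox; apply: subset_closure; exists x.
split => //; apply: (subclosed_compact (@closed_closure _ _) (@compact_norm_le R m M)).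
by move=> x /K1; exact: omega1_M.
Qed.

(** All that later arguments use about rho, with d and K meant to be independent of l. In the last
    clause the exponent N + 1 is positive, so that the factor really vanishes for X_1 near the
    boundary of l omega1. *)
Definition cutoff l d K (rho : 'rV[R]_(m + k) -> R) :=
  [/\ forall j, Ck j rho, forall x, 0 <= rho x <= 1,
      forall i x, `|partial i rho x| <= K / l,
      forall j x, partial (rshift m j) rho x = 0 &
      (forall x, cyl (l / 2) x -> d <= rho x) /\
      forall N phi psi, test_function (cyl l) phi -> test_function omega2 psi ->
        test_function (cyl l) (fun x => rho x ^+ N.+1 * (phi x - psi (rsubmx x)))].

(** A single cutoff of omega1 is built and then rescaled, so l appears only as the factor 1/l of the
    chain rule. *)
Lemma exists_cylinder_cutoff : exists2 d, 0 < d & exists2 K, 0 < K &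
  forall l, 0 < l -> exists rho, cutoff l d K rho.
Proof.
have [K0 [K0c K01] K0h] := half_compact.
have [th tth [th01 [d d0 dth]]] := exists_cutoff K0c omega1_open K01.
exists d => //; have [B B0 thB] := test_function_grad_bounded tth.
(* The chain rule yields at most m terms, each bounded by B / l; the 1 makes the constant
   positive. *)
exists (m%:R * B + 1) => [|l l0]; first by rewrite ltr_wpDl// mulr_ge0// ltW.
have [thC thc tho] := tth.
pose L (x : 'rV[R]_(m + k)) : 'rV[R]_m := l^-1 *: lsubmx x.
pose A : 'M[R]_(m + k, m) := l^-1 *: col_mx 1%:M 0.
have LA x : L x = 0 + x *m A.
  rewrite add0r /A -scalemxAr -[X in _ = _ *: (X *m _)]hsubmxK.
  by rewrite mul_row_col mulmx1 mulmx0 addr0.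
have rhoC j : Ck j (th \o L).
  rewrite (_ : _ \o _ = fun x => th (0 + x *m A)); first exact: Ck_affine.
  by apply/funext => x /=; rewrite LA.
have Lc : continuous L.
  apply: continuous_rV => i; under eq_fun do rewrite !mxE.
  by apply: (@Ck_continuous _ _ 0); apply: CkM; [exact: Ck_cst|exact: Ck_coord].
have dL i x : partial i (th \o L) x =
    \sum_j (l^-1 * (delta_mx ord0 i : 'rV[R]_(m + k)) ord0 (lshift k j)) * partial j th (L x).
  rewrite /partial (@derive_along _ _ _ _ th L _ (L (delta_mx ord0 i))); last first.
    by move=> h; apply/rowP => j; rewrite !mxE; ring.
  rewrite derive_partial; last by have [] := thC 1%N.
  by apply: eq_bigr => j _; rewrite !mxE.
exists (th \o L); split => //.
- by move=> x; exact: th01.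
- move=> i x; rewrite dL; apply: le_trans (ler_norm_sum _ _ _) _.
  rewrite ler_pdivlMr//; apply: (@le_trans _ _ (m%:R * B)); last by rewrite lerDl.
  rewrite mulr_suml -[m in leRHS]card_ord -sumr_const mulr_suml.
  apply: ler_sum => j _; rewrite mul1r !normrM ger0_norm ?invr_ge0 ?(ltW l0)//.
  rewrite [leLHS](_ : _ = `|(delta_mx ord0 i : 'rV[R]_(m + k)) ord0 (lshift k j)| *
      `|partial j th (L x)|); last by field; rewrite gt_eqF.
  apply: (@le_trans _ _ (1 * B)); last by rewrite mul1r.
  by apply: ler_pM => //; rewrite mxE /=; case: (_ == _); rewrite /= ?normr1 ?normr0.
- move=> j x; rewrite dL big1// => i _.
  by rewrite mxE /= eq_lrshift mulr0 mul0r.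
split=> [x|N phi psi tphi tpsi].
  rewrite cylinderE ?divr_gt0// => -[ox _]; apply: dth.
  rewrite /L (_ : l^-1 *: _ = 2^-1 *: ((l / 2)^-1 *: lsubmx x)); first exact: K0h.
  by rewrite scalerA; congr (_ *: _); field; rewrite gt_eqF.
have [phiC phic phio] := tphi; have [psiC psic psio] := tpsi.
(* Where phi vanishes, a nonzero value forces both rho and psi to be nonzero. C is bounded because
   |X_1| <= l M and |X_2| <= M on it. *)
pose C := [set x | tsupport th (L x) /\ tsupport psi (rsubmx x)].
have Cc : compact C.
  apply: (@subclosed_compact _ C [set x : 'rV[R]_(m + k) | `|x| <= (l + 1) * M]).
  - apply: closedI.
      by apply: preimage_closed => [x _|]; [exact: Lc|exact: closed_closure].
    apply: preimage_closed => [x _|]; last exact: closed_closure.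
    exact: continuous_rsubmx.
  - exact: compact_norm_le.
  - move=> x [/tho /omega1_M Lx /psio /omega2_M x2] /=.
    apply: rV_norm_le => [|i]; first by rewrite mulr_ge0// addr_ge0// ltW.
    case: (fintype.splitP i) => j ij.
      have -> : i = lshift k j by exact/val_inj.
      apply: (@le_trans _ _ (l * M)); last by rewrite mulrDl mul1r lerDl.
      rewrite -ler_pdivrMl//; apply: le_trans Lx.
      have := ler_rV_norm (L x) j; rewrite !mxE normrM ger0_norm// invr_ge0 ltW//.
    have -> : i = rshift m j by exact/val_inj.
    apply: (@le_trans _ _ M); last by rewrite mulrDl mul1r lerDr mulr_ge0// ltW.
    by apply: le_trans x2; have := ler_rV_norm (rsubmx x) j; rewrite mxE.
apply: (@test_function_of _ _ _ _ (tsupport phi `|` C)).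
- move=> j; apply: (@CkM _ _ _ (fun x => (th \o L) x ^+ N.+1) (fun x => phi x - psi (rsubmx x))).
    exact: CkX.
  apply: (@CkB _ _ _ phi (psi \o rsubmx)); first exact: phiC.
  exact: Ck_rsubmx.
- exact: compactU.
- move=> x [/phio//|[/tho xo /psio xo2]]; rewrite cylinderE//; split => //.
- move=> x; rewrite mulf_eq0 negb_or expf_eq0 /= => /andP[thx].
  have [phx|phx _] := eqVneq (phi x) 0; last by left; exact: tsupport_neq0.
  rewrite phx sub0r oppr_eq0 => psx; right; split; exact: tsupport_neq0.
Qed.

End cutoff.

Lemma powR_div {R : realType} (L l r : R) : 0 <= L -> 0 < l ->
  (L / l) `^ r = L `^ r * l `^ (- r).
Proof.
move=> L0 l0; have := l0; rewrite -invr_gt0 => il0.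
by rewrite powRM// ?(ltW il0)// -powR_inv1 ?(ltW l0)// -powRrM mulN1r.
Qed.

Lemma powRX_sub {R : realType} (l r : R) m : 0 < l -> l ^+ m * l `^ (- r) = l `^ (m%:R - r).
Proof. by move=> l0; rewrite -powR_mulrn ?(ltW l0)// -powRD// (gt_eqF l0) implybT. Qed.

Section localized_estimates.
Context {R : realType} {m k : nat}.
Local Notation leb := (lebesgue_rV R).
Variables (omega1 : set 'rV[R]_m) (omega2 : set 'rV[R]_k) (M p : R)
  (H : 'rV[R]_(m + k) -> R) (f : 'rV[R]_k -> R)
  (w0 : 'rV[R]_k -> R) (Dw0 : 'rV[R]_k -> 'rV[R]_k).
Hypotheses (omega1_open : open omega1) (omega1_convex : convex_set omega1)
  (omega1_0 : omega1 0) (omega2_open : open omega2) (M0 : 0 <= M)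
  (omega1_M : forall x, omega1 x -> `|x| <= M)
  (omega2_M : forall y, omega2 y -> `|y| <= M)
  (p1 : 1 < p) (H_ge0 : forall x, 0 <= H x)
  (H_convex : convex_function setT H)
  (H_homogeneous : forall t x, H (t *: x) = `|t| * H x)
  (H_C1 : forall x, x != 0 ->
     differentiable H x /\ {for x, continuous (grad H)}).

Local Notation cyl := (cylinder omega1 omega2).
Local Notation A := (flux p H).
Local Notation q := (p / (p - 1)).
Local Notation lift0 v := (row_mx (0 : 'rV[R]_m) v).

Let p0 : 0 < p. Proof. exact: lt_trans p1. Qed.
Let q1 : 1 < q.
Proof. exact: conjugate_exponent_gt1. Qed.
Let q0 : 0 < q. Proof. exact: lt_trans q1. Qed.
Let pq : p^-1 + q^-1 = 1.
Proof. exact: conjugate_exponentE. Qed.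
Let mO l (l0 : 0 < l) := measurable_cylinder omega1_open omega2_open l0.

Hypothesis f_q : pLp (leb k) omega2 q f.
Hypothesis w0_W : Wapprox omega2 p (test_function omega2) w0 Dw0.
Hypothesis w0_eq : forall psi, test_function omega2 psi ->
  \int[leb k]_(y in omega2)
    (\sum_j A (lift0 (Dw0 y)) ord0 (rshift m j) * partial j psi y) =
  \int[leb k]_(y in omega2) (f y * psi y).
Hypothesis k_gt0 : (0 < k)%N.

Local Notation j0 := (rshift m (Ordinal k_gt0)).
Local Notation lifted x := (lift0 (Dw0 (rsubmx x))).

Section fixed_l.
Variables (l : R) (u : 'rV[R]_(m + k) -> R) (Du : 'rV[R]_(m + k) -> 'rV[R]_(m + k)).
Hypotheses (l0 : 0 < l) (us : solves omega1 omega2 p H f l u Du).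

Local Notation w x := (u x - w0 (rsubmx x)).
Local Notation Dw x := (Du x - lifted x).
Local Notation dA x := (A (Du x) - A (lifted x)).

(** The approximants are recorded as differences phi - psi(X_2): this is precisely the class that
    positive powers of the cutoff send into test functions. *)
Lemma difference_Wapprox : Wapprox (cyl l) p
  (fun g => exists phi psi, [/\ test_function (cyl l) phi, test_function omega2 psi &
     g = fun x => phi x - psi (rsubmx x)]) (fun x => w x) (fun x => Dw x).
Proof.
have w0L : Wapprox (cyl l) p
    (fun g => exists2 psi, test_function omega2 psi & g = psi \o rsubmx)
    (w0 \o rsubmx) (fun x => lifted x).
  by apply: (Wapprox_lift omega1_open omega2_open M0 omega1_M l0 p1 _ w0_W) => psi; exists psi.
apply: (Wapprox_sub (mO l0) p1 _ _ _ us.1 w0L).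
- by move=> g [].
- by move=> g [psi [psiC _ _] ->] j; exact: Ck_rsubmx.
- by move=> g h tg [psi tpsi ->]; exists g, psi.
Qed.

Lemma pLp_difference : pLp (leb (m + k)) (cyl l) p (fun x => enorm (Dw x)).
Proof. by have [_ Dp _] := difference_Wapprox; exact: (pLp_enorm (mO l0) p1 Dp). Qed.

Lemma lifted_pLp i : pLp (leb (m + k)) (cyl l) p (fun x => lifted x ord0 i).
Proof.
have [_ Dp _] := Wapprox_lift omega1_open omega2_open M0 omega1_M l0 p1
  (Q := fun=> True) (fun _ _ => I) w0_W.
exact: Dp.
Qed.

Lemma integ_energies : integ (leb (m + k)) (cyl l)
  (fun x => enorm (Du x) `^ p + enorm (lifted x) `^ p).
Proof.
have [_ Dup _] := us.1.
apply: (integD (mO l0)); apply: (integ_enorm omega1_open omega2_open p1 l0) => //.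
exact: lifted_pLp.
Qed.

Variables (d K : R) (rho : 'rV[R]_(m + k) -> R).
Hypotheses (K0 : 0 <= K) (rhoP : cutoff omega1 omega2 l d K rho).

Let rho0 x : 0 <= rho x. Proof. by have [_ /(_ x)/andP[]] := rhoP. Qed.
Let rho1 x : rho x <= 1. Proof. by have [_ /(_ x)/andP[]] := rhoP. Qed.
Let rhoC j : Ck j rho. Proof. by have [] := rhoP. Qed.
Let rhoX0 N x : 0 <= rho x ^+ N. Proof. exact: exprn_ge0. Qed.
Let rhoX1 N x : rho x ^+ N <= 1. Proof. exact: exprn_ile1. Qed.

Let partial_rhoX N i x :
  partial i (fun x => rho x ^+ N.+1) x = N.+1%:R * rho x ^+ N * partial i rho x.
Proof. by apply: partialX => y; have [] := rhoC 1%N. Qed.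

Lemma partial_cutoffX_le N i x :
  `|partial i (fun x => rho x ^+ N.+1) x| <= N.+1%:R * rho x ^+ N * (K / l).
Proof.
have [_ _ rhoK _ _] := rhoP.
rewrite partial_rhoX normrM ger0_norm ?mulr_ge0//.
by rewrite ler_wpM2l ?mulr_ge0.
Qed.

Lemma cutoff_mul N : Wapprox (cyl l) p (test_function (cyl l))
  (fun x => rho x ^+ N.+1 * w x)
  (fun x => rho x ^+ N.+1 *: Dw x + w x *: grad (fun x => rho x ^+ N.+1) x).
Proof.
have [_ _ _ _ [_ rhoT]] := rhoP.
have Kl : 0 <= N.+1%:R * (K / l) by rewrite mulr_ge0// divr_ge0// ltW.
apply: (@Wapprox_mul _ _ _ _ (mO l0) p1 _ _ _ _ _ (1 + N.+1%:R * (K / l))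
  _ _ _ _ _ _ difference_Wapprox).
- move=> g [phi [psi [[phiC _ _] [psiC _ _] ->]]] j.
  by apply: (@CkB _ _ _ phi (psi \o rsubmx)) => //; exact: Ck_rsubmx.
- by move=> j; exact: CkX.
- by rewrite addr_ge0.
- by move=> x; rewrite ger0_norm// (le_trans (rhoX1 _ _))// lerDl.
- move=> i x; apply: le_trans (partial_cutoffX_le _ _ _) _.
  apply: (@le_trans _ _ (N.+1%:R * (K / l))); last by rewrite lerDr.
  by rewrite -mulrA ler_wpM2l// ler_piMl// divr_ge0// ltW.
- by move=> g [phi [psi [tphi tpsi ->]]]; exact: rhoT.
Qed.

Lemma pLp_cutoff g : pLp (leb (m + k)) (cyl l) p (fun x => rho x ^+ g * enorm (Dw x)).
Proof.
apply: (pLpM (mO l0) (B := 1) (ltW p0) _ _ pLp_difference).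
  apply: measurable_funS (continuous_measurable_rV _) => //.
  exact: (Ck_continuous (k := 0%N) (CkX g (rhoC 0%N))).
by move=> x _; rewrite ger0_norm.
Qed.

Lemma integ_cutoff g :
  integ (leb (m + k)) (cyl l) (fun x => (rho x ^+ g * enorm (Dw x)) `^ p).
Proof.
have [_] := pLp_cutoff g; congr integ; apply/funext => x.
by rewrite ger0_norm// mulr_ge0// enorm_ge0.
Qed.

Lemma cutoff_poincare CP g : 0 <= CP ->
  (forall (Om : set 'rV[R]_(m + k)) i, measurable Om -> (forall x, Om x -> `|x ord0 i| <= M) ->
   forall v Dv, Wapprox Om p (test_function Om) v Dv ->
   \int[leb (m + k)]_(x in Om) (`|v x| `^ p) <=
   CP * \int[leb (m + k)]_(x in Om) (`|Dv x ord0 i| `^ p)) ->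
  \int[leb (m + k)]_(x in cyl l) (`|rho x ^+ g.+1 * w x| `^ p) <=
  CP * \int[leb (m + k)]_(x in cyl l) ((rho x ^+ g.+1 * enorm (Dw x)) `^ p).
Proof.
have [_ _ _ rho2 _] := rhoP.
move=> CP0 CPP; have W := cutoff_mul g; have [_ DW _] := W.
have slab x : cyl l x -> `|x ord0 j0| <= M by exact: (cyl_slab omega2_M).
apply: le_trans (CPP _ j0 (mO l0) slab _ _ W) _.
rewrite ler_wpM2l//; apply: (le_Rint (mO l0)); [exact: (DW _).2|exact: integ_cutoff|].
move=> x _; apply: ge0_ler_powR; rewrite ?nnegrE ?(ltW p0) ?mulr_ge0 ?enorm_ge0//.
rewrite [X in `|X|](_ : _ = rho x ^+ g.+1 * (Dw x) ord0 j0); last first.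
  by rewrite mxE [X in X + _]mxE [X in _ + X]mxE [grad _ _ _ _]mxE partial_rhoX rho2 !mulr0 addr0.
by rewrite normrM ger0_norm// ler_wpM2l// coord_le_enorm.
Qed.

(** G is the integrand obtained by testing with rho^(2g+2) w, so its integral is 0. In the remainder
    rho^(2g+1) is split as rho^(g+1) rho^g: the first factor goes with w for Poincare, the second
    with the flux difference. The bound stays pointwise so that Young can be applied before
    integrating. *)
Lemma cutoff_orthogonal g : exists G : 'rV[R]_(m + k) -> R,
  [/\ integ (leb (m + k)) (cyl l) G, \int[leb (m + k)]_(x in cyl l) G x = 0 &
   forall x, rho x ^+ g.+1 ^+ 2 * dot (dA x) (Dw x) <=
     G x + ((m + k)%:R * ((g.*2.+2)%:R * K)) / l *
       (`|rho x ^+ g.+1 * w x| * (rho x ^+ g * enorm (dA x)))].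
Proof.
have [iG G0] := flux_difference_orthogonal omega1_open omega2_open M0 omega1_M p1
  H_ge0 H_convex H_homogeneous H_C1 f_q w0_W w0_eq l0 us (cutoff_mul g.*2.+1).
exists (fun x => dot (dA x)
  (rho x ^+ g.*2.+2 *: Dw x + w x *: grad (fun x => rho x ^+ g.*2.+2) x)).
split => // x; rewrite [X in _ <= X + _]dotDr !dotZr.
have -> : rho x ^+ g.+1 ^+ 2 = rho x ^+ g.*2.+2.
  by rewrite -exprM -mul2n -[in RHS]addn2 -mulnSr mulnC.
rewrite -addrA lerDl; set gr := grad _ _.
have h : `|w x * dot (dA x) gr| <= ((m + k)%:R * ((g.*2.+2)%:R * K)) / l *
    (`|rho x ^+ g.+1 * w x| * (rho x ^+ g * enorm (dA x))).
  rewrite normrM; apply: (@le_trans _ _ (`|w x| * (enorm (dA x) *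
      ((m + k)%:R * (g.*2.+2%:R * rho x ^+ g.*2.+1 * (K / l)))))).
    rewrite ler_wpM2l//; apply: le_trans (dot_le _ _) _.
    rewrite ler_wpM2l ?enorm_ge0// -[(m + k)%N in leRHS]card_ord mulr_natl -sumr_const.
    by apply: ler_sum => i _; rewrite mxE; exact: partial_cutoffX_le.
  rewrite normrM (ger0_norm (rhoX0 _ _)).
  have -> : rho x ^+ g.*2.+1 = rho x ^+ g.+1 * rho x ^+ g.
    by rewrite -exprD addSn addnn.
  by rewrite le_eqVlt; apply/orP; left; apply/eqP; ring.
by move: h; rewrite ler_norml => /andP[h _]; rewrite -lerBlDr sub0r.
Qed.

End fixed_l.

Section estimates.
Variables (c E d K : R).
Hypotheses (c0 : 0 < c) (K0 : 0 < K).
Hypothesis energy : forall l u Du, 0 < l -> solves omega1 omega2 p H f l u Du ->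
  \int[leb (m + k)]_(x in cyl l) (enorm (Du x) `^ p + enorm (lifted x) `^ p) <=
  E * l ^+ m.

Let E0 l u Du : 0 < l -> solves omega1 omega2 p H f l u Du -> 0 <= E * l ^+ m.
Proof.
move=> l0 us; apply: le_trans (energy l0 us); apply: Rint_ge0 => x _.
by rewrite addr_ge0 ?powR_ge0.
Qed.

Lemma enorm_fluxB_le z1 z2 : enorm (A z1 - A z2) <=
  (m + k)%:R * Cflux p H * (enorm z1 `^ (p - 1) + enorm z2 `^ (p - 1)).
Proof.
apply: le_trans (enorm_le_sum _) _.
apply: le_trans (_ : \sum_(i < m + k) Cflux p H *
  (enorm z1 `^ (p - 1) + enorm z2 `^ (p - 1)) <= _); last first.
  by rewrite sumr_const card_ord -mulrA mulr_natl.
apply: ler_sum => i _.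
rewrite mxE [in X in _ + X]mxE; apply: le_trans (ler_normB _ _) _.
by rewrite mulrDr lerD//; exact: flux_le.
Qed.

(** Young gives the factor (1/l)^q to the integral of S^p, which is O(l^m), and a multiple of the
    integral of |rho w|^p that Poincare turns into half of the left side. *)
Lemma estimate_degenerate : 2 <= p ->
  (forall z1 z2, c * enorm (z1 - z2) `^ p <= dot (A z1 - A z2) (z1 - z2)) ->
  exists2 C : R, 0 < C & forall l u Du rho, 0 < l ->
    solves omega1 omega2 p H f l u Du -> cutoff omega1 omega2 l d K rho ->
    \int[leb (m + k)]_(x in cyl l) ((rho x ^+ 1 * enorm (Du x - lifted x)) `^ p) <=
    C * l `^ (m%:R - q).
Proof.
move=> p2 mono; have [CP CP0 CPP] := poincare (n := m + k) p1 M.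
have qp : q^-1 + p^-1 = 1 by rewrite addrC.
have t0 : 0 < c / (2 * CP) by rewrite divr_gt0// mulr_gt0.
have [C C0 Ch] := young_eps q0 p0 qp t0.
pose L := (m + k)%:R * (2 * K) * ((m + k)%:R * Cflux p H).
have Cf0 : 0 <= Cflux p H := Cflux_ge0 p H_ge0.
have L0 : 0 <= L by rewrite /L; move: (Cflux p H) Cf0 => a a0; rewrite !mulr_ge0// ltW.
pose C1 := C * L `^ q * 2 `^ q.
have C10 : 0 <= C1 by rewrite !mulr_ge0 ?powR_ge0 ?(ltW C0).
(* The sign of E is not known at this point, since its nonnegativity follows only from a given
   solution; the absolute value plus 1 is positive in any case. *)
exists (`|2 / c * C1 * E| + 1) => [|l u Du rho l0 us rhoP]; first by rewrite ltr_wpDl.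
have [G [iG G0 Gle]] := cutoff_orthogonal l0 us (ltW K0) rhoP 0.
have iX := integ_cutoff l0 us rhoP 1.
have iT := integ_energies l0 us.
have [up _ _] := cutoff_mul l0 us (ltW K0) rhoP 0.
have UX := cutoff_poincare l0 us (ltW K0) rhoP 0 (ltW CP0) CPP.
have ET := energy l0 us; have ETpos := E0 l0 us.
have [_ rho01 _ _ _] := rhoP.
have pw x : c * (rho x ^+ 1 * enorm (Du x - lifted x)) `^ p <=
    G x + (c / (2 * CP) * `|rho x ^+ 1 * (u x - w0 (rsubmx x))| `^ p +
      (C1 * l `^ (- q)) * (enorm (Du x) `^ p + enorm (lifted x) `^ p)).
  have /andP[r0 r1] := rho01 x.
  apply: (@le_trans _ _ (rho x ^+ 1 ^+ 2 *
      dot (A (Du x) - A (lifted x)) (Du x - lifted x))).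
    apply: le_trans (_ : rho x ^+ 1 ^+ 2 * (c * enorm (Du x - lifted x) `^ p) <= _); last first.
      by rewrite ler_wpM2l ?exprn_ge0.
    rewrite expr1 powRM ?enorm_ge0// [leRHS]mulrCA ler_wpM2l ?(ltW c0)//.
    (* This is rho^p <= rho^2, which uses p >= 2 and rho <= 1; the value 0 is treated apart because
       the comparison of powers asks for a positive base. *)
    rewrite ler_wpM2r ?powR_ge0//; have [->|rn0] := eqVneq (rho x) 0.
      by rewrite powR0 ?gt_eqF// exprn_ge0.
    by rewrite -powR_mulrn// ger_powR// lt_neqAle eq_sym rn0 r0.
  apply: le_trans (Gle x) _; rewrite lerD2l expr0 mul1r.
  set s := enorm (Du x) `^ (p - 1) + enorm (lifted x) `^ (p - 1).
  have s0 : 0 <= s by rewrite addr_ge0 ?powR_ge0.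
  have Ls0 : 0 <= L / l * s by apply: mulr_ge0 => //; apply: divr_ge0 => //; exact: ltW.
  apply: (@le_trans _ _ `|rho x ^+ 1 * (u x - w0 (rsubmx x)) * (L / l * s)|).
    rewrite (normrM _ (L / l * s)) (ger0_norm Ls0).
    rewrite mulrCA ler_wpM2l//.
    apply: le_trans (_ : (m + k)%:R * (2 * K) / l * ((m + k)%:R * Cflux p H * s) <= _).
      by rewrite ler_wpM2l ?divr_ge0 ?mulr_ge0 ?(ltW K0) ?(ltW l0)//; exact: enorm_fluxB_le.
    by rewrite le_eqVlt; apply/orP; left; apply/eqP; rewrite /L; ring.
  apply: le_trans (Ch _ _) _; rewrite lerD2l.
  rewrite (ger0_norm Ls0).
  rewrite (powRM q (divr_ge0 L0 (ltW l0)) s0) (powR_div q L0 l0).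
  (* Since (p-1) q = p, the q-th power of the flux growth is an energy density. *)
  have sq : s `^ q <= 2 `^ q * (enorm (Du x) `^ p + enorm (lifted x) `^ p).
    have := powR_normD (enorm (Du x) `^ (p - 1)) (enorm (lifted x) `^ (p - 1)) (ltW q0).
    rewrite !ger0_norm ?powR_ge0// -/s -!powRrM.
    by rewrite [(p - 1) * _]mulrC divfK// gt_eqF// subr_gt0.
  apply: le_trans (_ : C * (L `^ q * l `^ (- q) *
     (2 `^ q * (enorm (Du x) `^ p + enorm (lifted x) `^ p))) <= _).
    by rewrite !ler_wpM2l ?mulr_ge0 ?powR_ge0 ?(ltW C0).
  by rewrite le_eqVlt; apply/orP; left; apply/eqP; rewrite /C1; ring.
have iU : integ (leb (m + k)) (cyl l) (fun x => `|rho x ^+ 1 * (u x - w0 (rsubmx x))| `^ p).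
  exact: up.2.
have iR := integD (mO l0) (integZ (mO l0) (c / (2 * CP)) iU) (integZ (mO l0) (C1 * l `^ (- q)) iT).
have := le_Rint (mO l0) (integZ (mO l0) c iX) (integD (mO l0) iG iR) (fun x _ => pw x).
rewrite (RintZ (mO l0) _ iX) (RintD (mO l0) iG iR) G0 add0r.
rewrite (RintD (mO l0) (integZ (mO l0) (c / (2 * CP)) iU) (integZ (mO l0) (C1 * l `^ (- q)) iT)).
rewrite (RintZ (mO l0) _ iU) (RintZ (mO l0) _ iT).
move: UX ET ETpos.
set U := \int[leb (m + k)]_(x in cyl l) _.
set X := \int[leb (m + k)]_(x in cyl l) _.
set T := \int[leb (m + k)]_(x in cyl l) _.
move=> UX ET ETpos XU; clearbody X U T C1.
have h1 : c / (2 * CP) * U <= c / 2 * X.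
  apply: le_trans (_ : c / (2 * CP) * (CP * X) <= _); first by rewrite ler_wpM2l ?(ltW t0).
  by rewrite le_eqVlt; apply/orP; left; apply/eqP; field; rewrite gt_eqF.
have h2 : C1 * l `^ (- q) * T <= C1 * l `^ (- q) * (E * l ^+ m).
  by rewrite ler_wpM2l ?mulr_ge0 ?powR_ge0.
have h3 : c * X <= 2 * (C1 * l `^ (- q) * (E * l ^+ m)) by lra.
apply: le_trans (_ : 2 / c * C1 * E * l `^ (m%:R - q) <= _); last first.
  by rewrite ler_wpM2r ?powR_ge0// (le_trans (ler_norm _))// lerDl.
rewrite -powRX_sub// [leRHS](_ : _ = 2 * (C1 * l `^ (- q) * (E * l ^+ m)) / c); last first.
  by ring.
by rewrite ler_pdivlMr// mulrC.
Qed.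

(** Two inequalities between X and Y are played against each other: Y <= B l^(-p) X, and X bounded
    by lam Y plus an energy term. The exponent g depends on p only, and its code value is one less
    than the power of the cutoff in X. *)
Lemma estimate_singular (c3 : R) : p < 2 -> 0 < c3 ->
  (forall z1 z2, c * enorm (z1 - z2) ^+ 2 * (enorm z1 + enorm z2) `^ (p - 2) <=
     dot (A z1 - A z2) (z1 - z2)) ->
  (forall z1 z2, enorm (A z1 - A z2) <=
     c3 * enorm (z1 - z2) * (enorm z1 + enorm z2) `^ (p - 2)) ->
  exists g, exists2 C : R, 0 < C & forall l u Du rho, 0 < l ->
    solves omega1 omega2 p H f l u Du -> cutoff omega1 omega2 l d K rho ->
    \int[leb (m + k)]_(x in cyl l) ((rho x ^+ g.+1 * enorm (Du x - lifted x)) `^ p) <=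
    C * l `^ (m%:R - p ^+ 2 / (2 - p)).
Proof.
move=> p2 c30 mono lip; have [CP CP0 CPP] := poincare (n := m + k) p1 M.
have p20 : 0 < 2 - p by rewrite subr_gt0.
have p10 : 0 < p - 1 by rewrite subr_gt0.
have t0 : 0 < c / 2 by rewrite divr_gt0.
have [C C0 Ch] := young_eps p0 q0 pq t0.
have q2 : 0 < q - 2.
  by rewrite subr_gt0 ltr_pdivlMr// mulrBr mulr1 ltrBlDr mulr_natl mulr2n ltrD2l.
pose g := (Num.bound (2 / (q - 2))).+1.
(* so that [(rho^g)^q <= rho^(2 (g+1))] *)
have gq : (g.+1 * 2)%:R <= g%:R * q.
  have : 2 / (q - 2) <= g%:R.
    apply/ltW/(lt_trans (archi_boundP _)); last by rewrite ltr_nat.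
    by rewrite divr_ge0// ltW.
  rewrite ler_pdivrMr// mulrBr natrM -[g.+1]addn1 natrD; move: (q) => q'; lra.
have g0 : (0 < g)%N by [].
clearbody g.
pose L := (m + k)%:R * ((g.*2.+2)%:R * K) * c3.
have L0 : 0 <= L by rewrite /L !mulr_ge0// ltW.
(* B - 1 is the constant that comes out of Young and Poincare in Y <= (B - 1) l^(-p) X; the 1 makes
   B positive, as needed to divide by it. *)
pose B := 2 / c * (C * L `^ p * CP) + 1.
have B0 : 0 < B.
  by rewrite ltr_wpDl// !mulr_ge0 ?powR_ge0 ?invr_ge0 ?(ltW C0) ?(ltW CP0) ?(ltW c0).
pose r := p / (2 - p).
pose C2 := 2 * ((2 * B) `^ r * (2 `^ p * E)).
exists g; exists (`|C2| + 1) => [|l u Du rho l0 us rhoP]; first by rewrite ltr_wpDl.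
have [G [iG G0 Gle]] := cutoff_orthogonal l0 us (ltW K0) rhoP g.
have iX := integ_cutoff l0 us rhoP g.+1.
have iT := integ_energies l0 us.
have [up _ _] := cutoff_mul l0 us (ltW K0) rhoP g.
have UX := cutoff_poincare l0 us (ltW K0) rhoP g (ltW CP0) CPP.
have ET := energy l0 us; have ETpos := E0 l0 us.
have [rhoC rho01 _ _ _] := rhoP.
pose S x := enorm (Du x) + enorm (lifted x).
pose e x := enorm (Du x - lifted x).
have eS x : e x <= S x.
  by rewrite /e /S -(enormN (lifted x)); exact: enorm_triangle.
have e0 x : 0 <= e x by exact: enorm_ge0.
have S0 x : 0 <= S x by rewrite addr_ge0 ?enorm_ge0.
have r0 x : 0 <= rho x by have /andP[] := rho01 x.
have r1 x : rho x <= 1 by have /andP[] := rho01 x.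
have rX0 N x : 0 <= rho x ^+ N by exact: exprn_ge0.
have rX1 N x : rho x ^+ N <= 1 by exact: exprn_ile1.
pose V x := rho x ^+ g.+1 ^+ 2 * (e x ^+ 2 * S x `^ (p - 2)).
have V0 x : 0 <= V x.
  apply: mulr_ge0; first exact: exprn_ge0.
  by apply: mulr_ge0; [exact: exprn_ge0|exact: powR_ge0].
have SE x : S x `^ p <= 2 `^ p * (enorm (Du x) `^ p + enorm (lifted x) `^ p).
  have := powR_normD (enorm (Du x)) (enorm (lifted x)) (ltW p0).
  by rewrite !ger0_norm ?enorm_ge0//; exact: S0.
(* Young is applied to Q and (L / l) |rho^(g+1) w|. The choice of g and [powR_conj_le] give |Q|^q <=
   V, so half of c V is absorbed. *)
have pw1 x : c / 2 * V x <=
    G x + C * (L `^ p * l `^ (- p)) * `|rho x ^+ g.+1 * (u x - w0 (rsubmx x))| `^ p.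
  have h1 : c * V x <= rho x ^+ g.+1 ^+ 2 *
      dot (A (Du x) - A (lifted x)) (Du x - lifted x).
    by rewrite /V mulrCA ler_wpM2l ?exprn_ge0// mulrA; exact: mono.
  have Gx := Gle x; set b := `|rho x ^+ g.+1 * _| in Gx *.
  have b0 : 0 <= b by exact: normr_ge0.
  pose Q := rho x ^+ g * (e x * S x `^ (p - 2)).
  have Q0 : 0 <= Q by apply: mulr_ge0 => //; apply: mulr_ge0 => //; exact: powR_ge0.
  have Ll : 0 <= L / l by apply: divr_ge0 => //; exact: ltW.
  have Lb : 0 <= L / l * b by exact: mulr_ge0.
  have h2 : (m + k)%:R * (g.*2.+2%:R * K) / l *
      (b * (rho x ^+ g * enorm (A (Du x) - A (lifted x)))) <= `|L / l * b * Q|.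
    rewrite (ger0_norm (mulr_ge0 Lb Q0)).
    apply: le_trans (_ : (m + k)%:R * (g.*2.+2%:R * K) / l *
      (b * (rho x ^+ g * (c3 * e x * S x `^ (p - 2)))) <= _).
      apply: ler_wpM2l; first by rewrite divr_ge0 ?mulr_ge0 ?(ltW l0) ?(ltW K0).
      by apply: ler_wpM2l => //; apply: ler_wpM2l => //; exact: lip.
    by rewrite le_eqVlt; apply/orP; left; apply/eqP; rewrite /L /Q; ring.
  have h3 := Ch Q (L / l * b); rewrite [Q * _]mulrC in h3.
  have h4 : `|Q| `^ q <= V x.
    rewrite (ger0_norm Q0) /Q powRM ?mulr_ge0 ?powR_ge0//.
    apply: ler_pM; [exact: powR_ge0|exact: powR_ge0| |exact: powR_conj_le].
    rewrite -exprM; have [->|rn0] := eqVneq (rho x) 0.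
      by rewrite [0 ^+ g]expr0n gtn_eqF// powR0 ?gt_eqF// expr0n.
    rewrite -!powR_mulrn// -powRrM ger_powR//.
    by rewrite lt_neqAle eq_sym rn0 r0 r1.
  have h5 : `|L / l * b| `^ p = L `^ p * l `^ (- p) * b `^ p.
    by rewrite (ger0_norm Lb) (powRM _ Ll b0) (powR_div _ L0 l0).
  have h7 : c / 2 * `|Q| `^ q <= c / 2 * V x by rewrite ler_wpM2l// ltW.
  move: h1 h2 h3 h7 Gx; rewrite h5.
  move: (dot _ _) (_ / l * _) `|_ * Q| (`|Q| `^ q) (rho x ^+ _ ^+ _) => a1 a2 a3 a4 a5.
  move: (V x) (G x) => v gx; move: (L `^ p * l `^ (- p)) (b `^ p) => y1 y2.
  by move=> h1 h2 h3 h7 Gx; rewrite -mulrA; lra.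
have mS : measurable_fun (cyl l) S.
  have mDu i : measurable_fun (cyl l) (fun x => Du x ord0 i).
    by have [_ /(_ i)[]] := us.1.
  have ml i : measurable_fun (cyl l) (fun x => lifted x ord0 i).
    exact: (lifted_pLp l0 i).1.
  by apply: measurable_funD; exact: measurable_enorm.
have mSr (t : R) : measurable_fun (cyl l) (fun x => S x `^ t).
  by apply: (@measurableT_comp _ _ _ _ _ _ (fun y : R => y `^ t)) => //; exact: measurable_powR.
have iS : integ (leb (m + k)) (cyl l) (fun x => S x `^ p).
  apply: (integ_le (mO l0) _ _ (integZ (mO l0) (2 `^ p) iT)); first exact: mSr.
  by move=> x _; rewrite ger0_norm ?powR_ge0//; exact: SE.
(* From e <= S and rho <= 1 follows V <= S^p, so Y is finite and may be absorbed. *)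
have iV : integ (leb (m + k)) (cyl l) V.
  apply: (integ_le (mO l0) _ _ iS).
    have mr : measurable_fun (cyl l) rho.
      by apply: measurable_funS (continuous_measurable_rV (Ck_continuous (rhoC 0%N))).
    apply: measurable_funM; first by do 2 apply: measurable_funX.
    apply: measurable_funM => //; apply: measurable_funX.
    exact: (pLp_difference l0 us).1.
  move=> x _; rewrite ger0_norm//.
  apply: le_trans (_ : 1 * (S x ^+ 2 * S x `^ (p - 2)) <= _).
    apply: ler_pM; rewrite ?exprn_ge0 ?exprn_ile1//.
      by rewrite mulr_ge0 ?powR_ge0 ?exprn_ge0.
    by rewrite ler_wpM2r ?powR_ge0//; apply: lerXn2r; rewrite ?nnegrE.
  rewrite mul1r; have [->|Sn0] := eqVneq (S x) 0.
    by rewrite expr0n mul0r powR_ge0.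
  by rewrite -powR_mulrn// -powRD ?Sn0 ?implybT// addrC subrK.
have pw2 x (lam : R) : 0 < lam -> (rho x ^+ g.+1 * e x) `^ p <= lam * V x + lam `^ (- r) * S x `^ p.
  move=> lam0; have re : rho x ^+ g.+1 * e x <= S x.
    by apply: le_trans (eS x); rewrite ler_piMl.
  have := powR_interpolate p1 p2 (mulr_ge0 (rX0 g.+1 x) (e0 x)) re lam0.
  by rewrite exprMn -mulrA.
(* Chosen so that Y <= B l^(-p) X becomes lam Y <= X / 2. Then lam^(-r) = (2 B)^r l^(-p r), and p r
   = p^2 / (2 - p) is the announced gain. *)
pose lam := l `^ p / (2 * B).
have lam0 : 0 < lam by rewrite divr_gt0 ?powR_gt0// mulr_gt0.
have iU : integ (leb (m + k)) (cyl l) (fun x => `|rho x ^+ g.+1 * (u x - w0 (rsubmx x))| `^ p).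
  exact: up.2.
have Y1 := le_Rint (mO l0) (integZ (mO l0) (c / 2) iV)
  (integD (mO l0) iG (integZ (mO l0) (C * (L `^ p * l `^ (- p))) iU)) (fun x _ => pw1 x).
have Y2 := le_Rint (mO l0) iX
  (integD (mO l0) (integZ (mO l0) lam iV) (integZ (mO l0) (lam `^ (- r)) iS))
  (fun x _ => pw2 x lam lam0).
have Y3 := le_Rint (mO l0) iS (integZ (mO l0) (2 `^ p) iT) (fun x _ => SE x).
move: Y1 Y2 Y3 UX ET ETpos.
rewrite (RintZ (mO l0) _ iV) (RintD (mO l0) iG (integZ (mO l0) _ iU)) G0 add0r (RintZ (mO l0) _ iU).
rewrite (RintD (mO l0) (integZ (mO l0) lam iV) (integZ (mO l0) (lam `^ (- r)) iS)).
rewrite (RintZ (mO l0) _ iV) (RintZ (mO l0) _ iS) (RintZ (mO l0) _ iT).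
pose X := \int[leb (m + k)]_(x in cyl l) (rho x ^+ g.+1 * enorm (Du x - lifted x)) `^ p.
have X0 : 0 <= X by apply: Rint_ge0 => x _; exact: powR_ge0.
rewrite -/X.
set Y := \int[leb (m + k)]_(x in cyl l) V x.
set Z := \int[leb (m + k)]_(x in cyl l) S x `^ p.
set T := \int[leb (m + k)]_(x in cyl l) (_ + _).
set U := \int[leb (m + k)]_(x in cyl l) _.
move=> Y1 Y2 Y3 UX ET ETpos; clearbody X Y Z T U.
have h1 : Y <= B * l `^ (- p) * X.
  have h : C * (L `^ p * l `^ (- p)) * U <= C * (L `^ p * l `^ (- p)) * (CP * X).
    by apply: ler_wpM2l => //; rewrite !mulr_ge0 ?powR_ge0 ?(ltW C0).
  have h' : c / 2 * Y <= c / 2 * ((B - 1) * l `^ (- p) * X).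
    apply: le_trans Y1 _; apply: le_trans h _.
    by rewrite le_eqVlt; apply/orP; left; apply/eqP; rewrite /B; field; rewrite gt_eqF.
  rewrite ler_pM2l// in h'; apply: le_trans h' _.
  by rewrite ler_wpM2r// ler_wpM2r ?powR_ge0// gerBl.
have h2 : lam * Y <= X / 2.
  apply: le_trans (ler_wpM2l (ltW lam0) h1) _.
  rewrite powRN /lam le_eqVlt; apply/orP; left; apply/eqP; field.
  by rewrite !gt_eqF ?powR_gt0.
have h3 : lam `^ (- r) * Z <= lam `^ (- r) * (2 `^ p * (E * l ^+ m)).
  apply: ler_wpM2l; first exact: powR_ge0.
  by apply: le_trans Y3 _; rewrite ler_wpM2l ?powR_ge0.
have h4 : X <= 2 * (lam `^ (- r) * (2 `^ p * (E * l ^+ m))).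
  move: h3 h2 Y2; move: (lam `^ (- r) * (2 `^ p * (E * l ^+ m))).
  by move: (lam `^ (- r) * Z) (lam * Y) => a1 a2 a3; lra.
have h5 : lam `^ (- r) = (2 * B) `^ r * l `^ (- (p ^+ 2 / (2 - p))).
  have B20 : 0 <= 2 * B by rewrite mulr_ge0// ltW.
  rewrite /lam mulrC powRM ?invr_ge0 ?powR_ge0//; congr (_ * _).
    by rewrite -powR_inv1// -powRrM mulN1r opprK.
  by rewrite -powRrM /r; congr (_ `^ _); ring.
apply: le_trans h4 _; rewrite h5.
apply: le_trans (_ : C2 * l `^ (m%:R - p ^+ 2 / (2 - p)) <= _); last first.
  by rewrite ler_wpM2r ?powR_ge0// (le_trans (ler_norm _))// lerDl.
by rewrite -powRX_sub// le_eqVlt; apply/orP; left; apply/eqP; rewrite /C2; ring.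
Qed.

End estimates.

(** On the half cylinder rho >= d, so the weight rho^g can be removed at the price of d^(-g p).
    There w need not vanish on the boundary, hence the conclusion in W^{1,p} only. *)
Lemma difference_estimate l u Du d K rho g C : 0 < l -> 0 < d ->
  solves omega1 omega2 p H f l u Du -> cutoff omega1 omega2 l d K rho ->
  \int[leb (m + k)]_(x in cyl l) ((rho x ^+ g * enorm (Du x - lifted x)) `^ p) <= C ->
  W1p (cyl (l / 2)) p (fun x => u x - w0 (rsubmx x)) (fun x => Du x - lifted x) /\
  (Lp_norm (cyl (l / 2)) p (fun x => enorm (Du x - lifted x)) `^ p <=
   ((d ^+ g) `^ (- p) * C)%:E)%E.
Proof.
move=> l0 d0 us rhoP XC; have l20 : 0 < l / 2 by rewrite divr_gt0.
have sub := @cylinder_half _ _ _ omega1 omega2 omega1_convex omega1_0 l l0.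
have W := Wapprox_subset (mO l20) (mO l0) sub (difference_Wapprox l0 us).
split.
  apply: (Wapprox_W1p (mO l20) p1 _ W) => h [phi [psi [[phiC _ _] [psiC _ _] ->]]] j.
  by apply: (@CkB _ _ _ phi (psi \o rsubmx)) => //; exact: Ck_rsubmx.
have [_ Dp _] := W; have ep := pLp_enorm (mO l20) p1 Dp.
rewrite (Lp_norm_powE (mO l20) p1 ep) lee_fin powRN ler_pdivlMl; last first.
  by rewrite powR_gt0// exprn_gt0.
apply: le_trans XC; have iX := integ_cutoff l0 us rhoP g.
have X0 x : 0 <= (rho x ^+ g * enorm (Du x - lifted x)) `^ p by exact: powR_ge0.
have [iX2 X2] := Rint_subset (mO l20) (mO l0) sub X0 iX.
apply: le_trans X2; rewrite -(RintZ (mO l20) _ ep.2).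
apply: (le_Rint (mO l20)) => //; first exact: (integZ (mO l20) _ ep.2).
move=> x cx; have [_ _ _ _ [/(_ x cx) dx _]] := rhoP.
have dg : 0 <= d ^+ g by rewrite exprn_ge0// ltW.
rewrite (ger0_norm (enorm_ge0 _)) -powRM ?enorm_ge0//.
have dr : d ^+ g <= rho x ^+ g by apply: lerXn2r; rewrite ?nnegrE ?(ltW d0)// (le_trans _ dx)// ltW.
apply: ge0_ler_powR; rewrite ?nnegrE ?(ltW p0)//.
- by apply: mulr_ge0 => //; exact: enorm_ge0.
- by apply: mulr_ge0; [exact: le_trans dr|exact: enorm_ge0].
- by apply: ler_wpM2r => //; exact: enorm_ge0.
Qed.

End localized_estimates.

(** * From the localized bounds to the two estimates of the theorem *)

Lemma bounded_set_norm {R : realType} {n} (A : set 'rV[R]_n) : bounded_set A ->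
  exists2 M : R, 0 <= M & forall x, A x -> `|x| <= M.
Proof.
move=> [M [_ AM]]; exists (`|M| + 1) => [|x Ax]; first by rewrite addr_ge0.
by apply: (AM (`|M| + 1)) => //; rewrite (le_lt_trans (ler_norm _))// ltrDl.
Qed.

Theorem theorem1p4 (R : realType) (m k : nat) (m_gt0 : (0 < m)%N)
  (k_gt0 : (0 < k)%N)
  (omega1 : set 'rV[R]_m) (omega2 : set 'rV[R]_k)
  (omega1_open : open omega1) (omega1_bounded : bounded_set omega1)
  (omega1_convex : convex_set omega1) (omega1_0 : omega1 0)
  (omega2_open : open omega2) (omega2_bounded : bounded_set omega2)
  (p : R) (p_gt1 : 1 < p)
  (H : 'rV[R]_(m + k) -> R)
  (H_ge0 : forall x, 0 <= H x)
  (H_gt0 : forall x, x != 0 -> 0 < H x)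
  (H_convex : convex_function setT H)
  (H_homogeneous : forall t x, H (t *: x) = `|t| * H x)
  (H_C1 : forall x, x != 0 ->
     differentiable H x /\ {for x, continuous (grad H)})
  (c1 c2 c3 : R) (c1_gt0 : 0 < c1) (c2_gt0 : 0 < c2) (c3_gt0 : 0 < c3)
  (H_structure : structure_conditions p H c1 c2 c3)
  (f : 'rV[R]_k -> R) (f_Lp' : in_Lp omega2 (p / (p - 1)) f)
  (u : R -> 'rV[R]_(m + k) -> R)
  (Du : R -> 'rV[R]_(m + k) -> 'rV[R]_(m + k))
  (u_solution : forall l, 0 < l ->
     weak_solution p H f (cylinder omega1 omega2 l) (u l) (Du l))
  (u_oo : 'rV[R]_k -> R) (Du_oo : 'rV[R]_k -> 'rV[R]_k)
  (u_oo_solution : weak_solution_section p H f omega2 u_oo Du_oo) :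
  (2 <= p -> exists2 C1 : R, 0 < C1 & forall l, 0 < l ->
     exists2 Dw : 'rV[R]_(m + k) -> 'rV[R]_(m + k),
       W1p (cylinder omega1 omega2 (l / 2)) p
         (fun x => u l x - u_oo (rsubmx x)) Dw &
       (Lp_norm (cylinder omega1 omega2 (l / 2)) p (fun x => enorm (Dw x))
          `^ p <= (C1 * l `^ (m%:R - p / (p - 1)))%:E)%E) /\
  (p < 2 -> exists2 C2 : R, 0 < C2 & forall l, 0 < l ->
     exists2 Dw : 'rV[R]_(m + k) -> 'rV[R]_(m + k),
       W1p (cylinder omega1 omega2 (l / 2)) p
         (fun x => u l x - u_oo (rsubmx x)) Dw &
       (Lp_norm (cylinder omega1 omega2 (l / 2)) p (fun x => enorm (Dw x))
          `^ p <= (C2 * l `^ (m%:R - p ^+ 2 / (2 - p)))%:E)%E).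
Proof.
have [M1 M10 M1P] := bounded_set_norm omega1_bounded.
have [M2 M20 M2P] := bounded_set_norm omega2_bounded.
pose M := M1 + M2; have M0 : 0 <= M by rewrite addr_ge0.
have oM1 x : omega1 x -> `|x| <= M by move=> /M1P xM; rewrite (le_trans xM)// lerDl.
have oM2 x : omega2 x -> `|x| <= M by move=> /M2P xM; rewrite (le_trans xM)// lerDr.
have p0 : 0 < p by exact: lt_trans p_gt1.
have q1 := conjugate_exponent_gt1 p_gt1.
have mO2 : measurable omega2 by exact: open_measurable_rV.
have f_q := (in_LpP omega2 q1 f).1 f_Lp'.
have w0_W := W1p0_Wapprox mO2 p_gt1 u_oo_solution.1.
have w0_eq psi : test_function omega2 psi ->
    \int[lebesgue_rV R k]_(y in omega2)
      (\sum_j flux p H (row_mx (0 : 'rV_m) (Du_oo y)) ord0 (rshift m j) * partial j psi y) =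
    \int[lebesgue_rV R k]_(y in omega2) (f y * psi y).
  move=> tpsi; rewrite -(u_oo_solution.2 _ _ (Wapprox_W1p0 mO2 p_gt1 (Wapprox_self mO2 p_gt1 tpsi))).
  apply: eq_Rintegral => y _; rewrite /dot mulr_sumr; apply: eq_bigr => j _.
  by rewrite !mxE mulrA.
have us l : 0 < l -> solves omega1 omega2 p H f l (u l) (Du l).
  move=> l0; exact: (weak_solution_solves omega1_open omega2_open p_gt1 l0 (u_solution l l0)).
have [d d0 [K K0 cutoffs]] := exists_cylinder_cutoff omega1_open omega1_convex
  omega1_0 M0 oM1 oM2.
have [E2 E20 E2P] := energy_section omega1_open omega2_open M0 oM1 p_gt1 w0_W.
have energy c : 0 < c -> (forall z, c * enorm z `^ p <= dot (flux p H z) z) ->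
    exists E, forall l v Dv, 0 < l -> solves omega1 omega2 p H f l v Dv ->
    \int[lebesgue_rV R (m + k)]_(x in cylinder omega1 omega2 l)
      (enorm (Dv x) `^ p + enorm (row_mx (0 : 'rV_m) (Du_oo (rsubmx x))) `^ p) <=
    E * l ^+ m.
  move=> c0 coer.
  have [E1 E10 E1P] := energy_solution omega1_open omega2_open M0 oM1 oM2 p_gt1 H_ge0
    H_convex H_homogeneous H_C1 f_q c0 coer k_gt0.
  exists (E1 + E2) => l v Dv l0 vs.
  have mO := measurable_cylinder omega1_open omega2_open l0; have [_ Dvp _] := vs.1.
  have i1 := integ_enorm omega1_open omega2_open p_gt1 l0 Dvp.
  have i2 := integ_enorm omega1_open omega2_open p_gt1 l0
    (lifted_pLp omega1_open omega2_open M0 oM1 p_gt1 w0_W l0).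
  rewrite (RintD mO i1 i2) mulrDl.
  apply: lerD; [exact: (E1P l v Dv)|exact: E2P].
(* The common end of both cases: a weighted bound c l^s on the cylinder becomes (d^g)^(-p) c l^s on
   its half. The weak gradient exhibited is the difference of the given versions. *)
have concl c g s : 0 < c ->
    (forall l v Dv rho, 0 < l -> solves omega1 omega2 p H f l v Dv ->
      cutoff omega1 omega2 l d K rho ->
      \int[lebesgue_rV R (m + k)]_(x in cylinder omega1 omega2 l)
        ((rho x ^+ g * enorm (Dv x - row_mx (0 : 'rV_m) (Du_oo (rsubmx x)))) `^ p) <=
      c * l `^ s) ->
    exists2 C : R, 0 < C & forall l, 0 < l ->
      exists2 Dw : 'rV[R]_(m + k) -> 'rV[R]_(m + k),
       W1p (cylinder omega1 omega2 (l / 2)) p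
         (fun x => u l x - u_oo (rsubmx x)) Dw &
       (Lp_norm (cylinder omega1 omega2 (l / 2)) p (fun x => enorm (Dw x))
          `^ p <= (C * l `^ s)%:E)%E.
  move=> c0 h; exists ((d ^+ g) `^ (- p) * c).
    by rewrite mulr_gt0// powR_gt0// exprn_gt0.
  move=> l l0; have [rho rhoP] := cutoffs l l0.
  have [W N] := difference_estimate omega1_open omega1_convex omega1_0 omega2_open
    M0 oM1 p_gt1 w0_W l0 d0 (us l l0) rhoP (h l (u l) (Du l) rho l0 (us l l0) rhoP).
  by exists (fun x => Du l x - row_mx 0 (Du_oo (rsubmx x))) => //; rewrite -mulrA.
split=> [p2|p2].
  have mono z1 z2 : c1 * enorm (z1 - z2) `^ p <= dot (flux p H z1 - flux p H z2) (z1 - z2).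
    by have [/(_ p2)] := H_structure z1 z2.
  (* Strong monotonicity against z2 = 0, where the flux vanishes. *)
  have coer z : c1 * enorm z `^ p <= dot (flux p H z) z.
    by have := mono z 0; rewrite (flux0 p_gt1 H_homogeneous) !subr0.
  have [E EP] := energy c1 c1_gt0 coer.
  have [C C0 CP] := estimate_degenerate omega1_open omega2_open M0 oM1 oM2 p_gt1 H_ge0
    H_convex H_homogeneous H_C1 f_q w0_W w0_eq k_gt0 d c1_gt0 K0 EP p2 mono.
  exact: (concl C 1%N _ C0 CP).
have mono z1 z2 : c2 * enorm (z1 - z2) ^+ 2 * (enorm z1 + enorm z2) `^ (p - 2) <=
    dot (flux p H z1 - flux p H z2) (z1 - z2).
  by have [_ /(_ p2)] := H_structure z1 z2.
have lip z1 z2 : enorm (flux p H z1 - flux p H z2) <=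
    c3 * enorm (z1 - z2) * (enorm z1 + enorm z2) `^ (p - 2).
  by have [_ _ /(_ p2)] := H_structure z1 z2.
(* Again z2 = 0: the right-hand side of (ii) becomes |z|^2 |z|^(p-2) = |z|^p, with z = 0 handled
   separately because 0 to a negative power is 0 here. *)
have coer z : c2 * enorm z `^ p <= dot (flux p H z) z.
  have := mono z 0; rewrite (flux0 p_gt1 H_homogeneous) !subr0 enorm0 addr0 -mulrA.
  apply: le_trans; rewrite ler_wpM2l ?(ltW c2_gt0)//.
  have [->|zn0] := eqVneq (enorm z) 0; first by rewrite powR0 ?gt_eqF// expr0n mul0r.
  by rewrite -powR_mulrn ?enorm_ge0// -powRD ?zn0 ?implybT// addrC subrK.
have [E EP] := energy c2 c2_gt0 coer.
have [g [C C0 CP]] := estimate_singular omega1_open omega2_open M0 oM1 oM2 p_gt1 H_ge0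
  H_convex H_homogeneous H_C1 f_q w0_W w0_eq k_gt0 d c2_gt0 K0 EP p2 c3_gt0 mono lip.
exact: (concl C g.+1 _ C0 CP).
Qed.
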